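(* Let $p\ge2$ and let $T=(T^{(N)})_{N\ge1}$ be a sequence of heavy-Wigner tensors of order $p$ with parameters $(M_k)_{k\ge2}$, $M_2>0$. Let $$(\tilde A_N)_{a,b}=\frac{1}{\sqrt{M_2(p-2)!}}\sum_{j_1,\dots,j_{p-2}=1}^N T^{(N)}_{a,b,j_1,\dots,j_{p-2}},\qquad 1\le a,b\le N .$$ Then the empirical spectral distribution of $\tilde A_N$ converges weakly in probability, as $N\to\infty$, to the probability measure $\nu$ whose moments are $(\eta_k^{(M'_r)})_{k\ge0}$, where $$M'_r:=\frac{(p-2)!^{r/2}M_r}{M_2^{r/2}},\qquad r\ge2 .$$ In particular, $(\eta_k^{(M'_r)})_k$ is the sequence of moments of a probability measure, with $\eta_2^{(M'_r)}=1$.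
   Context: Heavy-Wigner tensors: a sequence of heavy-Wigner tensors of order $p$ with parameters $(M_k)_{k\ge2}$ is a sequence $(T^{(N)})_{N\ge1}$ of real random tensors $T^{(N)}=(T_{i_1,\dots,i_p})_{1\le i_1,\dots,i_p\le N}$ that are symmetric (invariant under permutation of the indices), whose entries indexed by $i_1\le\cdots\le i_p$ are independent (not necessarily identically distributed), such that $\mathbb{E}[T_{i_1,\dots,i_p}]=0$ for all indices, for every $k\ge2$ one has $\sup_{i_1,\dots,i_p}N^{p-1}\mathbb{E}[T_{i_1,\dots,i_p}^k]=O(1)$ as $N\to\infty$, and for all $i_1<\cdots<i_p$ and every $k\ge2$, $N^{p-1}\mathbb{E}[T_{i_1,\dots,i_p}^k]\to M_k$ as $N\to\infty$. Definition of $\eta_k$: a hypertree is a simple hypergraph (distinct hyperedges, each a set of distinct vertices) whose vertex–hyperedge incidence bipartite graph is a tree. A rooted $p$-uniform fat hypertree $(H,o)$ is a $p$-uniform hypertree with a distinguished vertex $o$ together with a multiplicity for each hyperedge. For a sequence of real numbers $(a_r)_{r\ge2}$, put $\eta_0^{(a_r)}=1$ and, for $k\ge1$, $$\eta_k^{(a_r)}=\sum_{(H,o)\in\mathcal{T}_k^\bullet}\frac{1}{|\mathrm{Aut}(H,o)|}\sum_{P\in P_k(H)}\ \prod_{e\in E(H)}a_{m(P,e)},$$ where $\mathcal{T}_k^\bullet$ is the set of isomorphism classes of rooted $p$-uniform fat hypertrees with $k$ hyperedges counted with multiplicity, every hyperedge having multiplicity at least $2$; $\mathrm{Aut}(H,o)$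 is the group of automorphisms of $H$ (permutations of the vertices preserving hyperedges and their multiplicities) fixing the root; $P_k(H)$ is the set of closed walks of length $k$ starting from the root $o$ on the clique expansion of $H$ (the graph where two distinct vertices are adjacent iff they lie in a common hyperedge) such that, for each distinct hyperedge $e$, the number $m(P,e)$ of steps of the walk $P$ using an edge coming from $e$ equals the multiplicity of $e$ in $H$; and the product runs over the distinct hyperedges of $H$. The empirical spectral distribution of a real symmetric $N\times N$ matrix is the uniform probability measure on its eigenvalues.
   Formalization: Convergence of the spectral distribution is proved when the moments η_k determine their measure (existence of ν and η_2=1 need no such assumption), and N^{p-1}E[T^k]→M_k is assumed uniformly over i_1<...<i_p; without either assumption the claim can fail. *)

(* Defs.v *)
From HB Require Import structures.
From mathcomp Require Import all_boot all_order all_algebra all_fingroup.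
From mathcomp Require Import all_classical all_reals all_analysis.

Set Implicit Arguments.
Unset Strict Implicit.
Unset Printing Implicit Defensive.

Import Order.TTheory GRing.Theory Num.Theory.
Import numFieldNormedType.Exports.

Local Open Scope ring_scope.

Definition is_tree (V : finType) (g : rel V) : Prop :=
  [/\ (0 < #|V|)%N,
      forall x y, connect g x y &
      forall c : seq V, (2 < size c)%N -> ~~ ucycleb g c].

(* A rooted fat hypergraph on the vertices 0, ..., n - 1 is its root together
   with the multiplicity of every set of vertices, 0 meaning "not a hyperedge".
   Multiplicities are bounded by the prescribed total k. *)
Definition rooted_fat_hypergraph (n k : nat) : finType :=
  ('I_n * {ffun {set 'I_n} -> 'I_k.+1})%type.

Section FatHypergraph.
Variables (n k : nat).
Implicit Types (H : rooted_fat_hypergraph n k) (e : {set 'I_n}).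

Definition root_of H : 'I_n := H.1.

Definition multiplicity H e : nat := H.2 e.

Definition hyperedges H : {set {set 'I_n}} :=
  [set e | (0 < multiplicity H e)%N].

Definition incidence H : rel ('I_n + {e | e \in hyperedges H}) :=
  fun x y => match x, y with
             | inl v, inr e | inr e, inl v => v \in val e
             | _, _ => false
             end.

Definition fat_hypertree (p : nat) H : Prop :=
  [/\ forall e, e \in hyperedges H -> #|e| = p,
      forall e, e \in hyperedges H -> (2 <= multiplicity H e)%N,
      is_tree (@incidence H) &
      (\sum_(e in hyperedges H) multiplicity H e)%N = k].

Definition fat_hypertrees (p : nat) : {set rooted_fat_hypergraph n k} :=
  [set H | `[< fat_hypertree p H >]].

Definition is_isomorphism (s : {perm 'I_n}) H1 H2 : bool :=
  (s (root_of H1) == root_of H2) &&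
  [forall e : {set 'I_n}, multiplicity H2 (s @: e) == multiplicity H1 e].

Definition isomorphic H1 H2 : bool :=
  [exists s : {perm 'I_n}, is_isomorphism s H1 H2].

Definition automorphisms H : {set {perm 'I_n}} :=
  [set s | is_isomorphism s H H].

(* One representative of each isomorphism class. *)
Definition fat_hypertree_classes (p : nat) : {set rooted_fat_hypergraph n k} :=
  transversal (equivalence_partition isomorphic (fat_hypertrees p))
              (fat_hypertrees p).

Definition clique_expansion H : rel 'I_n :=
  fun x y => (x != y) &&
             [exists e in hyperedges H, (x \in e) && (y \in e)].

(* The walk o, w_1, ..., w_k is encoded by (w_1, ..., w_k).  Two distinct
   vertices of a hypertree have at most one hyperedge in common, so the vertices
   of the walk determine the hyperedges it uses. *)
Definition steps_in H (w : k.-tuple 'I_n) e : nat :=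
  count (fun xy => (xy.1 \in e) && (xy.2 \in e)) (zip (root_of H :: w) w).

Definition closed_walks H : {set k.-tuple 'I_n} :=
  [set w : k.-tuple 'I_n |
    [&& path (clique_expansion H) (root_of H) w,
        last (root_of H) w == root_of H &
        [forall e in hyperedges H, steps_in H w e == multiplicity H e]]].

End FatHypergraph.

(* For k > 0 every vertex of a hypertree lies in one of its at most k
   hyperedges, so there are at most k * p vertices. *)
Definition eta (R : realType) (p : nat) (a : nat -> R) (k : nat) : R :=
  if k is 0%N then 1 else
  \sum_(n < (k * p).+1)
    \sum_(H in fat_hypertree_classes n k p)
      #|automorphisms H|%:R^-1 *
      \sum_(w in closed_walks H) \prod_(e in hyperedges H) a (steps_in H w e).

(* The sequence (a, b, j_1, ..., j_{p-2}), for p >= 2. *)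
Definition tensor_index (p N : nat) (a b : 'I_N) (j : (p - 2).-tuple 'I_N) :
    p.-tuple 'I_N :=
  [tuple nth a [:: a, b & j] i | i < p].

Definition contracted_matrix (R : realType) (p N : nat) (M2 : R)
    (t : p.-tuple 'I_N -> R) : 'M[R]_N :=
  \matrix_(a, b) ((Num.sqrt (M2 * (p - 2)`!%:R))^-1 *
                  \sum_(j : (p - 2).-tuple 'I_N) t (tensor_index a b j)).

Local Open Scope classical_set_scope.

(* With multiplicity, in increasing order; meaningful when the characteristic
   polynomial splits over R, e.g. for symmetric A. *)
Definition eigenvalues (R : realType) (N : nat) (A : 'M[R]_N) : seq R :=
  xget [::] [set s | sorted <=%R s /\
                     char_poly A = \prod_(x <- s) ('X - x%:P)].

Definition esd (R : realType) (N : nat) (A : 'M[R]_N) :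
    {measure set (measurableTypeR R) -> \bar R} :=
  mscale (N%:R^-1)%:nng
    (msum (fun i => dirac ((eigenvalues A)`_i : measurableTypeR R)) N).

Definition mutually_independent (d : measure_display) (Omega : measurableType d)
    (R : realType) (P : probability Omega R) (I : finType)
    (X : I -> Omega -> R) (D : {set I}) : Prop :=
  forall (J : {set I}) (B : I -> set R),
    J \subset D -> (forall i, measurable (B i)) ->
    P (\bigcap_(i in [set` J]) (X i @^-1` B i)) =
    (\prod_(i in J) P (X i @^-1` B i))%E.

Section HeavyWigner.
Variables (R : realType) (p : nat).
Variables (d : nat -> measure_display) (Omega : forall N, measurableType (d N)).
Variable (P : forall N, probability (Omega N) R).
Variable (T : forall N, p.-tuple 'I_N -> {RV (P N) >-> R}).
Variable (M : nat -> R).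

Definition scaled_moment (N k : nat) (i : p.-tuple 'I_N) : R :=
  N%:R ^+ (p - 1) * fine ('E_(P N)[fun w => (T i w ^+ k)%R])%E.

(* The entries of T^(N) form a triangular array: the convergence of the moments
   at strictly increasing indices is uniform in the index, i.e. it holds along
   every choice of an index for each N. *)
Record heavy_wigner : Prop := {
  hw_symmetric : forall N (i : p.-tuple 'I_N) (s : 'S_p) w,
    T [tuple tnth i (s l) | l < p] w = T i w;
  hw_independent : forall N,
    mutually_independent (P N) (fun i : p.-tuple 'I_N => T i : Omega N -> R)
      [set i : p.-tuple 'I_N | sorted leq (map val i)]%SET;
  hw_moments : forall N (i : p.-tuple 'I_N) k,
    (P N).-integrable setT (fun w => (T i w ^+ k)%:E);
  hw_centered : forall N (i : p.-tuple 'I_N), ('E_(P N)[T i] = 0)%E;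
  hw_bounded : forall k, (2 <= k)%N ->
    (fun N => sup (range (@scaled_moment N k)) : R^o) =O_\oo (fun=> 1 : R^o);
  hw_limit : forall k, (2 <= k)%N -> forall eps : R, 0 < eps ->
    \forall N \near \oo, forall i : p.-tuple 'I_N,
      sorted ltn (map val i) -> `|scaled_moment k i - M k| < eps }.

Definition cvg_weakly_in_probability
    (mu : forall N, Omega N -> {measure set (measurableTypeR R) -> \bar R})
    (nu : probability (measurableTypeR R) R) : Prop :=
  forall f : R -> R, continuous f -> (exists C : R, forall x, `|f x| <= C) ->
  forall eps : R, 0 < eps ->
    P N [set w | eps < `|\int[mu N w]_x f x - \int[nu]_x f x|]
      @[N --> \oo] --> 0%E.

End HeavyWigner.

Definition has_moments (R : realType)
    (nu : probability (measurableTypeR R) R) (m : nat -> R) : Prop :=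
  forall k, nu.-integrable setT (fun x : R => (x ^+ k)%:E) /\
            \int[nu]_x (x ^+ k) = m k.

Definition moment_determinate (R : realType) (m : nat -> R) : Prop :=
  forall nu1 nu2 : probability (measurableTypeR R) R,
    has_moments nu1 m -> has_moments nu2 m ->
    forall B : set R, measurable B -> nu1 B = nu2 B.

(* Main.v *)
(* The moment method. The trace of the k-th power of the contracted matrix is a
   sum over closed chains of k tuples of products of tensor entries. A chain with
   E distinct unordered tuples visits at most 1 + (p - 1) E vertices, while its
   expectation is of order N^(- (p - 1) E) and vanishes if some tuple is used only
   once; so the expected normalized traces converge, and the chains attaining the
   bound are those whose tuples form a hypertree covered by a closed walk, each
   step of the walk leaving (p - 2)! orderings of its hyperedge. Two chains without
   common tuple are uncorrelated and a common tuple costs at least one vertex: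
   the variance of the normalized traces tends to 0, and they converge in
   probability.

   Empirical distributions are represented by their quantile functions on ]0, 1[.
   Since |q(u)|^k is at most a constant times u^(-1/2) + (1 - u)^(-1/2) as soon as
   the moment of order 2k is bounded, Helly selection and dominated convergence
   yield, along a subsequence, a limit law having the limiting moments; if these
   determine the law, closeness of finitely many moments forces closeness of the
   integral of a given bounded continuous function. *)
From mathcomp Require Import all_boot all_order all_algebra all_fingroup.
From mathcomp Require Import boolp reals.
From mathcomp Require Import zify lra ring.
Require Import Defs.

Set Implicit Arguments.
Unset Strict Implicit.
Unset Printing Implicit Defensive.

Import Order.TTheory GRing.Theory Num.Theory.

Local Open Scope ring_scope.

(** * Patterns and hypertrees *)

(** Both sides meet on labelled structures. In [eta], orbit-stabilizer replaces 1 / |Aut| on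
    isomorphism classes by 1 / n! on hypertrees with vertex set 'I_n; in the trace the same 1 / n!
    appears when a chain is written as an injective relabelling of a surjective pattern. Patterns do
    not depend on N, so each limit is a finite sum of limits over fixed patterns. Two obstacles
    shape the estimates. The limits of the moments are known only at strictly increasing indices, so
    patterns with a repeated entry in a tuple must be shown negligible. And the assumed bound
    concerns the supremum of the signed moments, hence is one-sided: odd moments are controlled
    through the neighbouring even ones. The limit law is built from deterministic data: an event of
    probability less than 1 leaves an outcome whose spectrum is a finite list with nearly the right
    moments, and compactness is applied to such lists. Convergence in probability also needs
    measurable deviation events, while only traces of powers, that is power sums of the eigenvalues,
    are measurable at the outset; hence the argument on sorted lists. *)

Section Patterns.
Variable R : numFieldType.

Definition ffcomp (Q : finType) (n N : nat) (i : {ffun 'I_n -> 'I_N})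
    (f : {ffun Q -> 'I_n}) : {ffun Q -> 'I_N} := [ffun x => i (f x)].

(** Composition with [i] is a bijection from the surjections onto 'I_n to the maps with the same
    image as [i]. Its inverse [h] needs a default vertex, so n = 0 is treated apart; both sums are
    then empty unless [Q] is. *)
Lemma reindex_pattern (Q : finType) (n N : nat) (G : {ffun Q -> 'I_N} -> R)
    (i : {ffun 'I_n -> 'I_N}) : injective i ->
  \sum_(f : {ffun Q -> 'I_n} | [set f x | x in Q] == setT) G (ffcomp i f) =
  \sum_(f : {ffun Q -> 'I_N} | [set f x | x in Q] == [set i x | x in 'I_n]) G f.
Proof.
move=> inji; case: n i inji => [|n] i inji.
  have [e|x0] := pickP (pred_of_simpl (@predT Q)).
    move=> _; rewrite !big_pred0 //.
      move=> f; apply/eqP => /setP /(_ (f e)); rewrite imset_f //.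
      by case/esym/imsetP=> -[].
    by move=> f; case: (f e).
  have Gc (f g : {ffun Q -> 'I_N}) : f = g by apply/ffunP => x; have := x0 x.
  pose f0 : {ffun Q -> 'I_0} := ffun0 (eq_card0 x0).
  have emp0 (T : finType) (f : {ffun Q -> T}) : [set f x | x in Q] = set0.
    by apply/setP => y; rewrite inE; apply/imsetP => -[x]; have := x0 x.
  have emp1 : [set i x | x in 'I_0] = set0.
    by apply/setP => y; rewrite inE; apply/imsetP => -[[]].
  rewrite (big_pred1 f0) ?(big_pred1 (ffcomp i f0)) // => f.
    by rewrite emp0 emp1 eqxx; apply/esym/eqP/Gc.
  rewrite emp0; transitivity true; last first.
    by apply/esym/eqP/ffunP => x; have := x0 x.
  by apply/eqP/setP => -[].
pose h (g : {ffun Q -> 'I_N}) : {ffun Q -> 'I_n.+1} :=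
  [ffun x => odflt ord0 [pick y | i y == g x]].
rewrite [RHS](reindex_onto (ffcomp i) h) /=; last first.
  move=> g /eqP gi; apply/ffunP => x; rewrite !ffunE.
  have /imsetP[y _ gy] : g x \in [set i x | x in 'I_n.+1].
    by rewrite -gi imset_f.
  by case: pickP => [z /eqP //|/(_ y)]; rewrite gy eqxx.
apply: eq_bigl => f; apply/eqP/andP => [fT|[/eqP ifi _]].
  split; apply/eqP.
    apply/setP => y; apply/imsetP/imsetP => -[x _ ->].
      by exists (f x) => //; rewrite ffunE.
    have : x \in setT by [].
    by rewrite -fT => /imsetP[z _ ->]; exists z => //; rewrite ffunE.
  apply/ffunP => x; rewrite !ffunE; case: pickP => [z /eqP /inji //|/(_ (f x))].
  by rewrite eqxx.
apply/setP => y; rewrite inE; apply/imsetP.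
have : i y \in [set i x | x in 'I_n.+1] by rewrite imset_f.
by rewrite -ifi => /imsetP[x _]; rewrite ffunE => /inji ->; exists x.
Qed.

Lemma card_inj_onto (n N : nat) (A : {set 'I_N}) :
  #|[set i : {ffun 'I_n -> 'I_N} | injectiveb i &&
      (A == [set i x | x in 'I_n])]| = if #|A| == n then n`! else 0%N.
Proof.
case: eqP => An; last first.
  apply/eqP; rewrite cards_eq0; apply/eqP/setP => i; rewrite !inE.
  apply/negP => /andP[/injectiveP inji /eqP Ai]; apply: An.
  by rewrite Ai card_imset // card_ord.
transitivity #|[set i : {ffun 'I_n -> 'I_N} in ffun_on (mem A) | injectiveb i]|.
  apply: eq_card => i; rewrite !inE andbC; case: (boolP (injectiveb i)) => // /injectiveP inji;
    rewrite ?andbF // !andbT; apply/eqP/ffun_onP => [-> x|iA]; first exact: imset_f.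
  apply/eqP; rewrite eq_sym eqEcard card_imset // card_ord An leqnn andbT.
  by apply/subsetP => y /imsetP[x _ ->]; apply: iA.
by rewrite card_inj_ffuns_on card_ord An ffactnn.
Qed.

(* A function is an injective relabelling of a surjection onto 'I_n, where n is
   the size of its image, in n! ways. *)
Lemma pattern_sum (Q : finType) (N : nat) (G : {ffun Q -> 'I_N} -> R) :
  \sum_f G f = \sum_(n < #|Q|.+1) (n`!%:R)^-1 *
    \sum_(f : {ffun Q -> 'I_n} | [set f x | x in Q] == setT)
      \sum_(i : {ffun 'I_n -> 'I_N} | injectiveb i) G (ffcomp i f).
Proof.
have countE (n : 'I_#|Q|.+1) :
    \sum_(f : {ffun Q -> 'I_n} | [set f x | x in Q] == setT)
      \sum_(i : {ffun 'I_n -> 'I_N} | injectiveb i) G (ffcomp i f) =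
    \sum_f G f *+ (if #|[set f x | x in Q]| == n then n`! else 0%N).
  rewrite (exchange_big_dep [pred i : {ffun 'I_n -> 'I_N} | injectiveb i]) //=.
  transitivity (\sum_(i : {ffun 'I_n -> 'I_N} | injectiveb i)
      \sum_(f : {ffun Q -> 'I_N} | [set f x | x in Q] == [set i x | x in 'I_n]) G f).
    apply: eq_bigr => i /injectiveP inji; rewrite -(reindex_pattern _ inji).
    by apply: eq_bigl => f; rewrite (introT (injectiveP i) inji) andbT.
  rewrite (exchange_big_dep xpredT) //=.
  apply: eq_bigr => f _; rewrite sumr_const -card_inj_onto; congr (_ *+ _).
  by apply: eq_card => i; rewrite !inE.
transitivity (\sum_(n < #|Q|.+1) \sum_f (n`!%:R)^-1 *
    (G f *+ (if #|[set f x | x in Q]| == n then n`! else 0%N))); last first.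
  by apply: eq_bigr => n _; rewrite -mulr_sumr; congr (_ * _); rewrite countE.
rewrite exchange_big /=; apply: eq_bigr => f _.
have ltQ : (#|[set f x | x in Q]| < #|Q|.+1)%N by rewrite ltnS leq_imset_card.
rewrite (bigD1 (Ordinal ltQ)) //= eqxx big1 ?addr0 => [|n nN].
  by rewrite -[G f *+ _]mulr_natl mulKf // pnatr_eq0 -lt0n fact_gt0.
case: eqP => [e|_]; last by rewrite mulr0n mulr0.
by case/eqP: nN; apply/val_inj => /=.
Qed.

End Patterns.

(** * Number of vertices of a list of tuples that meet one another *)

Section VertexBound.
Variables (T : finType) (K : eqType) (cls : seq T -> K) (p : nat).
Hypothesis cls_perm : forall t t', cls t = cls t' -> perm_eq t t'.
Hypothesis p_gt1 : (1 < p)%N.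
Implicit Types (t : seq T) (L : seq (seq T)).

Definition meets t t' := has (mem t) t'.

(* Bounding also the defect from distinctness shows that, in the extremal case,
   no tuple contains a repeated vertex. *)
Definition few_vertices L :=
  (#|[set x in flatten L]| + ~~ all uniq L <=
   1 + (p - 1) * size (undup (map cls L)))%N.

Lemma card_seq_nuniq t : (#|[set x in t]| + ~~ uniq t <= size t)%N.
Proof.
rewrite cardsE; case: (boolP (uniq t)) => [/card_uniqP ->|nu]; first by rewrite addn0.
rewrite addn1 ltn_neqAle card_size andbT.
by apply: contra nu => /eqP /card_uniqP.
Qed.

Lemma few_vertices1 t : size t = p -> few_vertices [:: t].
Proof.
rewrite /few_vertices /= cats0 andbT muln1 subnKC ?(ltnW p_gt1) // => <-.
exact: card_seq_nuniq.
Qed.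

(** A tuple of a known class brings no new vertex and no new defect. A tuple of a new class shares a
    vertex with [L], so it brings at most p - 1 vertices, and at most p - 2 if it repeats an entry,
    which pays for the defect. *)
Lemma few_vertices_cons t L : size t = p -> has (meets t) L ->
  few_vertices L -> few_vertices (t :: L).
Proof.
rewrite /few_vertices /= => tp tL; case: ifP => [/mapP[t' t'L e]|_ IH].
  have pt := cls_perm e.
  have -> : [set x in t ++ flatten L] = [set x in flatten L].
    apply/setP => x; rewrite !inE mem_cat (perm_mem pt).
    by case: (boolP (x \in t')) => //= xt'; apply/esym/flattenP; exists t'.
  suff -> : uniq t && all uniq L = all uniq L by [].
  rewrite andbC; case: (boolP (all uniq L)) => //= /allP /(_ _ t'L).
  by rewrite (perm_uniq pt).
have -> : [set x in t ++ flatten L] = [set x in t] :|: [set x in flatten L].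
  by apply/setP => x; rewrite !inE mem_cat.
have I1 : (0 < #|[set x in t] :&: [set x in flatten L]|)%N.
  case/hasP: tL => t' t'L /hasP[x xt' xt]; apply/card_gt0P; exists x.
  have {}xt : x \in t by [].
  by rewrite !inE xt; apply/flattenP; exists t'.
have := cardsUI [set x in t] [set x in flatten L].
have := card_seq_nuniq t; rewrite tp mulnS.
move: I1 IH; move: #|_ :&: _| => i; move: #|_ :|: _| => u.
move: #|[set x in t]| => a; move: #|_| => b; move: (_ * _)%N => c.
by case: (uniq t); case: (all _ _) => /=; lia.
Qed.

(** The tuples of the path are put in front of [L] one after the other, which reverses them: hence
    [catrev]. The relation is reversed as well, because each new tuple has to meet the previous
    one. *)
Lemma few_vertices_path t l L : all (fun t' => size t' == p) (t :: l) ->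
  has (meets t) L -> path (fun a b => meets b a) t l ->
  few_vertices L -> few_vertices (catrev (t :: l) L).
Proof.
elim: l t L => [|t' l IH] t L /=.
  by rewrite andbT => /eqP tp tL _; apply: few_vertices_cons.
case/and3P=> /eqP tp tp' alp tL /andP[tt' pl] fL; apply: IH; rewrite /= ?tt' //.
- exact/andP.
- exact: few_vertices_cons.
Qed.

End VertexBound.

(** * Acyclic incidence graphs and the count of vertices *)

Section HypergraphTrees.
Variable V : finType.
Implicit Types (e : {set V}) (l : seq {set V}).

Definition acyclic (T : finType) (g : rel T) :=
  forall c : seq T, (2 < size c)%N -> ~~ ucycleb g c.

(** Every set of vertices is a node, isolated unless it belongs to [l]: the type of nodes does not
    depend on [l], which permits induction on [l]. *)
Definition incidence_seq l : rel (V + {set V}) := fun x y =>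
  match x, y with
  | inl v, inr e | inr e, inl v => (e \in l) && (v \in e)
  | _, _ => false
  end.

Definition covered l := [set v | has (fun e => v \in e) l].

Fixpoint linked l := if l is e :: l' then
  (nilp l' || has (fun e' => e :&: e' != set0) l') && linked l' else true.

Lemma incidence_seq_sym l : symmetric (incidence_seq l).
Proof. by case=> [v|e] [w|f]. Qed.

Lemma eq_incidence_seq l l' : l =i l' -> incidence_seq l =2 incidence_seq l'.
Proof. by move=> ll' [v|e] [w|f] //=; rewrite ll'. Qed.

Lemma incidence_seqS l e : subrel (incidence_seq l) (incidence_seq (e :: l)).
Proof.
by case=> [v|f] [w|g] //= /andP[fl ->]; rewrite inE fl orbT.
Qed.

Lemma covered_cons e l : covered (e :: l) = e :|: covered l.
Proof. by apply/setP => v; rewrite !inE. Qed.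

Lemma connect_linked l : linked l ->
  {in covered l &, forall x y, connect (incidence_seq l) (inl x) (inl y)}.
Proof.
elim: l => [_ x y|e l IH /= /andP[el /IH{}IH]]; first by rewrite inE.
have sub : subrel (connect (incidence_seq l)) (connect (incidence_seq (e :: l))).
  by apply: connect_sub => x y xy; apply/connect1/incidence_seqS.
have csym : connect_sym (incidence_seq (e :: l)).
  exact/sym_connect_sym/incidence_seq_sym.
have inee x y : x \in e -> y \in e ->
    connect (incidence_seq (e :: l)) (inl x) (inl y).
  move=> xe ye; apply: (@connect_trans _ _ (inr e)); apply: connect1;
    by rewrite /= inE eqxx.
have mixed x y : x \in e -> y \in covered l ->
    connect (incidence_seq (e :: l)) (inl x) (inl y).
  move=> xe yl; case/orP: el yl => [/nilP -> |/hasP[f fl /set0Pn[z]]].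
    by rewrite inE.
  rewrite inE => /andP[ze zf] yl; apply: connect_trans (inee _ _ xe ze) _.
  by apply/sub/IH => //; rewrite inE; apply/hasP; exists f.
rewrite covered_cons => x y; rewrite !inE => /orP[xe|xl] /orP[ye|yl].
- exact: inee.
- by apply: mixed => //; rewrite inE.
- by rewrite csym; apply: mixed => //; rewrite inE.
- by apply/sub/IH; rewrite inE.
Qed.

Lemma incidence_seq_path l x s : path (incidence_seq l) x s ->
  forall e, inr e \in s -> e \in l.
Proof.
elim: s x => //= y s IH x /andP[xy ys] e; rewrite inE => /predU1P[ey|].
  by move: xy; rewrite -ey; case: x => //= v /andP[].
exact: IH ys e.
Qed.

Lemma mem_covered_other l e e' v :
  e' != e -> e' \in e :: l -> v \in e' -> v \in covered l.
Proof.
rewrite !inE => /negPf -> /= e'l ve'; by apply/hasP; exists e'.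
Qed.

(* On a cycle through [e], the two neighbours of [e] are distinct vertices of [e]
   that also lie in other hyperedges. *)
Lemma acyclic_cons e l : e \notin l -> linked l ->
  acyclic (incidence_seq (e :: l)) <->
  acyclic (incidence_seq l) /\ (#|e :&: covered l| <= 1)%N.
Proof.
move=> enl ll; split=> [ac|[ac /card_le1_eqP I1]].
  split=> [c c2|].
    apply: contra (ac c c2) => /andP[cc uc]; rewrite /ucycleb uc andbT.
      by apply: sub_cycle cc; apply: incidence_seqS.
  apply/card_le1_eqP => a b; rewrite !inE => /andP[ae al] /andP[be bl].
  apply/eqP/negPn/negP => ab.
  have aU : a \in covered l by rewrite inE.
  have bU : b \in covered l by rewrite inE.
  (* A simple path from [a] to [b] through [l] is closed into a cycle by [e]. *)
  have /connectP[s ps ls] := connect_linked ll aU bU.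
  move: ls; case/shortenP: ps => s' ps' us' _ ls'.
  have := ac (inr e :: inl a :: s'); case: s' ps' us' ls' => [|y s'] ps' us' ls' /=.
    by case: ls' => e'; rewrite e' eqxx in ab.
  move=> /(_ isT) /negP; apply; apply/andP; split; last first.
    rewrite cons_uniq us' andbT inE /=.
    by apply: contra enl => /(incidence_seq_path ps').
  change (incidence_seq (e :: l) (inr e) (inl a) &&
    path (incidence_seq (e :: l)) (inl a) (rcons (y :: s') (inr e))).
  rewrite rcons_path (sub_path (@incidence_seqS l e) ps') -ls' /=.
  by rewrite inE eqxx ae be.
move=> c c2; apply/negP => /andP[cc uc].
(* A cycle that avoids [e] is already a cycle for [l]; any other is rotated so as to start at
   [e]. *)
have [ec|enc] := boolP (inr e \in c); last first.
  have /negP := ac c c2; apply; rewrite /ucycleb uc andbT.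
  apply: (@sub_in_cycle _ [pred z | z != inr e] (incidence_seq (e :: l))) cc => //.
    move=> x y; rewrite !inE => xe ye.
    by case: x y xe ye => [v|f] [w|g] //= xe ye /andP[]; rewrite inE =>
      /predU1P[E|-> -> //]; rewrite E eqxx in xe ye.
  by apply/allP => z zc; rewrite inE; apply: contraNneq enc => <-.
have [i c' ec'] := rot_to ec.
have {cc}: path.cycle (incidence_seq (e :: l)) (rot i c) by rewrite rot_cycle.
have {uc}: uniq (rot i c) by rewrite rot_uniq.
have {c2}: (2 < size (rot i c))%N by rewrite size_rot.
rewrite {}ec' => {c ec i}; case: c' => [|x [|z c]] // _.
case: x => [a|f]; last by move=> _ /andP[].
case: z => [z|f]; first by rewrite /= andbF.
case/and3P=> enc anc uc /=; case/and3P=> /andP[_ ae] /andP[fel af].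
rewrite rcons_path => /andP[fc cb].
have other g : inr g \in inr f :: c -> g != e.
  move=> gc; apply: contraNneq enc => <-; by rewrite inE gc orbT.
have aU : a \in covered l.
  by apply: mem_covered_other fel af; apply: other; rewrite inE eqxx.
case: (lastP c) fc cb anc other {enc uc} => [_ //|c1 y].
rewrite rcons_path last_rcons => /andP[_ c1y].
case: y c1y => [b|//] c1b /andP[_ be] anc other.
have bU : b \in covered l.
  case E : (last (inr f) c1) c1b => [//|g] /andP[gel bg].
  apply: mem_covered_other gel bg; apply: other.
  by rewrite -rcons_cons mem_rcons inE -E mem_last orbT.
have ab : a != b by apply: contraNneq anc => ->; rewrite inE mem_rcons inE eqxx orbT.
by move/eqP: ab; case; apply: I1; rewrite in_setI ?ae ?be.
Qed.

(** Read from its end, a linked list adds hyperedges that each meet the earlier ones, so a new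
    hyperedge brings at most p - 1 vertices. Equality means exactly one common vertex each time,
    which is acyclicity by [acyclic_cons]. *)
Lemma covered_count p l : (0 < p)%N -> l != [::] -> all (fun e => #|e| == p) l ->
  linked l ->
  (#|covered l| <= 1 + (p - 1) * size (undup l))%N /\
  (#|covered l| = (1 + (p - 1) * size (undup l))%N <-> acyclic (incidence_seq l)).
Proof.
move=> p0; elim: l => // e [|e' l] IH _ /=.
  rewrite andbT => /eqP ep _; have -> : covered [:: e] = e.
    by apply/setP => v; rewrite inE /= orbF.
  rewrite ep muln1 subnKC //; split => //; split => // _.
  apply/(acyclic_cons _ _) => //; split.
    move=> [|x [|y c]] // _; apply/negP => /andP[/=]; by case: x y => [v|f] [w|g].
  rewrite (_ : _ :&: _ = set0) ?cards0 //.
  by apply/setP => v; rewrite !inE andbF.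
case/andP=> /eqP ep alp /andP[]; set l' := e' :: l in IH alp *.
move=> el' ll'.
have {}el' : has (fun f => e :&: f != set0) l' by [].
have {}ll' : linked l' by [].
have {}IH := IH isT alp ll'.
rewrite -/(undup l'); case: ifP => [el|/negbT el].
  have ll : e :: l' =i l'.
    by move=> x; rewrite inE; case: eqP => // ->; rewrite el.
  have -> : covered (e :: l') = covered l'.
    apply/setP => v; rewrite !inE; apply/hasP/hasP => -[x xl vx]; exists x => //.
      by rewrite -ll.
    by rewrite ll.
  case: IH => [? IH]; split => //; rewrite IH; have E := eq_incidence_seq ll.
  split=> ac c /ac; rewrite /ucycleb; [rewrite -(eq_cycle E)|rewrite (eq_cycle E)] => //.
rewrite covered_cons /= mulnS (acyclic_cons el ll').
have I1 : (0 < #|e :&: covered l'|)%N.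
  case/hasP: el' => f fl /set0Pn[x]; rewrite inE => /andP[xe xf].
  by apply/card_gt0P; exists x; rewrite !inE xe; apply/hasP; exists f.
case: IH => IH1 IH2; rewrite -IH2; have := cardsUI e (covered l'); rewrite ep.
move: IH1 I1; move: #|_ :&: _| #|_ :|: _| #|covered l'| ((p - 1) * _)%N.
move=> i u c m; move=> *; split; first lia.
split=> *; lia.
Qed.

End HypergraphTrees.

Lemma zip_map2 (S T S' T' : Type) (f : S -> S') (g : T -> T') s t :
  zip (map f s) (map g t) = [seq (f xy.1, g xy.2) | xy <- zip s t].
Proof. by elim: s t => [|x s IH] [|y t] //=; rewrite IH. Qed.

Section Embedding.
Variables (T T' : finType) (g : rel T) (g' : rel T') (h : T -> T').
Hypothesis h_inj : injective h.
Hypothesis gE : forall x y, g' (h x) (h y) = g x y.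
Hypothesis g'_codom : forall x' y', g' x' y' -> (exists x, x' = h x) /\ (exists y, y' = h y).

Lemma path_embedding x s' : path g' (h x) s' -> exists s, s' = map h s.
Proof.
elim: s' x => [x _|y' s' IH x /= /andP[xy ys]]; first by exists [::].
have [_ [y e]] := g'_codom xy; rewrite {}e in ys *.
by have [s ->] := IH _ ys; exists (y :: s).
Qed.

(** By [g'_codom] the nodes outside the image of [h] are isolated for [g'], so a path that starts in
    the image stays there. *)
Lemma connect_embedding x y : connect g' (h x) (h y) = connect g x y.
Proof.
apply/connectP/connectP => -[s ps ls].
  have [t e] := path_embedding ps; rewrite {}e in ps ls.
  exists t; last by apply: h_inj; rewrite -last_map.
  by move: ps; rewrite path_map; apply: sub_path => a b; rewrite /relpre /= gE.
exists (map h s); last by rewrite last_map -ls.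
by rewrite path_map; apply: sub_path ps => a b; rewrite /relpre /= gE.
Qed.

Lemma acyclic_embedding : acyclic g <-> acyclic g'.
Proof.
have cycE c : path.cycle g' (map h c) = path.cycle g c.
  by rewrite cycle_map; apply: eq_cycle => a b; rewrite /relpre /= gE.
split=> ac c c2; last first.
  apply: contra (ac (map h c) _); last by rewrite size_map.
  by case/andP=> cc uc; rewrite /ucycleb cycE cc map_inj_uniq.
apply/negP => /andP[cc uc].
have [d dE] : exists d, c = map h d.
  have : forall x', x' \in c -> exists x, x' = h x.
    by move=> x' /(next_cycle cc) /g'_codom[].
  elim: c {c2 cc uc} => [|x' c IH] hc; first by exists [::].
  have [x ->] := hc x' (mem_head _ _).
  have [|d ->] := IH; last by exists (x :: d).
  by move=> y yc; apply: hc; rewrite inE yc orbT.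
subst c; rewrite size_map in c2; have /negP := ac d c2; apply.
by rewrite /ucycleb -cycE cc -(map_inj_uniq h_inj).
Qed.

End Embedding.

(** * Isomorphism classes and labelled hypertrees *)

Section Relabelling.
Variables (n k : nat).
Implicit Types (H : rooted_fat_hypergraph n k) (s : {perm 'I_n}) (e : {set 'I_n}).

(** The incidence graph on the subtype of hyperedges is replaced by [incidence_seq] on all sets. It
    suffices to connect the vertices to one another: for p > 0 every hyperedge is adjacent to a
    vertex. *)
Lemma fat_hypertreeP p H : (0 < p)%N -> fat_hypertree p H <->
  [/\ forall e, e \in hyperedges H -> #|e| = p,
      forall e, e \in hyperedges H -> (2 <= multiplicity H e)%N,
      (0 < n)%N,
      (forall v w, connect (incidence_seq (enum (hyperedges H))) (inl v) (inl w)) /\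
      acyclic (incidence_seq (enum (hyperedges H))) &
      (\sum_(e in hyperedges H) multiplicity H e)%N = k].
Proof.
move=> p0.
pose h (x : 'I_n + {e | e \in hyperedges H}) : 'I_n + {set 'I_n} :=
  match x with inl v => inl v | inr e => inr (val e) end.
have hinj : injective h.
  by move=> [v|e] [w|f] //= []; [move=> ->|move=> /val_inj ->].
have hE x y : incidence_seq (enum (hyperedges H)) (h x) (h y) = incidence x y.
  by case: x y => [v|[e eH]] [w|[f fH]] //=; rewrite mem_enum ?eH ?fH.
have hcod x y : incidence_seq (enum (hyperedges H)) x y ->
    (exists x', x = h x') /\ (exists y', y = h y').
  case: x y => [v|e] [w|f] //= /andP[]; rewrite mem_enum => eH _.
    by split; [exists (inl v)|exists (inr (Sub f eH))].
  by split; [exists (inr (Sub e eH))|exists (inl w)].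
have cE := connect_embedding hinj hE hcod; have aE := acyclic_embedding hinj hE hcod.
split=> [[c2 m2 [V0 conn ac] sk]|[c2 m2 n0 [conn ac] sk]]; split=> //.
- case/card_gt0P: V0 => -[v _|[e eH] _]; first exact: leq_ltn_trans (ltn_ord v).
  have /card_gt0P[v _] : (0 < #|e|)%N by rewrite c2.
  exact: leq_ltn_trans (ltn_ord v).
- by split; [move=> v w; rewrite (cE (inl v) (inl w))|apply/aE].
- have csym := sym_connect_sym (@incidence_seq_sym _ (enum (hyperedges H))).
  split; last by apply/aE.
    by apply/card_gt0P; exists (inl (Ordinal n0)).
  have toV x : exists v, connect (incidence_seq (enum (hyperedges H))) (h x) (inl v).
    case: x => [v|[e eH]]; first by exists v.
    have /card_gt0P[v ve] : (0 < #|e|)%N by rewrite c2.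
    by exists v; apply: connect1; rewrite /= mem_enum eH.
  move=> x y; rewrite -cE; have [v xv] := toV x; have [w yw] := toV y.
  apply: connect_trans xv _; apply: connect_trans (conn v w) _.
  by rewrite csym.
Qed.

Definition relabel H s : rooted_fat_hypergraph n k :=
  (s H.1, [ffun e : {set 'I_n} => H.2 (s^-1%g @: e)]).

Lemma multiplicity_relabel H s e : multiplicity (relabel H s) (s @: e) = multiplicity H e.
Proof.
rewrite /multiplicity ffunE -imset_comp (eq_imset (g := id)) ?imset_id //.
by move=> x /=; rewrite permK.
Qed.

Lemma imset_permKV s e : s @: (s^-1%g @: e) = e.
Proof.
rewrite -imset_comp (eq_imset (g := id)) ?imset_id // => x /=.
by rewrite permKV.
Qed.

Lemma is_isomorphismE s H1 H2 : is_isomorphism s H1 H2 = (relabel H1 s == H2).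
Proof.
apply/andP/eqP => [[/eqP rE /forallP mE]|<-].
  case: H2 rE mE => o2 m2 /= rE mE; rewrite /relabel [s H1.1]rE; congr pair.
  apply/ffunP => e; rewrite ffunE; apply/val_inj/esym/eqP.
  by have := mE (s^-1%g @: e); rewrite imset_permKV.
split; first exact: eqxx.
by apply/forallP => e; rewrite multiplicity_relabel.
Qed.

Lemma relabel1 H : relabel H 1%g = H.
Proof.
apply/eqP; rewrite -is_isomorphismE; apply/andP; split; first by rewrite perm1.
apply/forallP => e; rewrite (eq_imset (g := id)) ?imset_id // => x.
by rewrite perm1.
Qed.

Lemma relabelM H s t : relabel H (s * t)%g = relabel (relabel H s) t.
Proof.
rewrite /relabel permM; congr pair; apply/ffunP => e; rewrite !ffunE.
by rewrite -imset_comp; congr (H.2 _); apply: eq_imset => x; rewrite invMg permM.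
Qed.

(** The isomorphism classes are the orbits of this action and the automorphism groups its
    stabilizers. *)
Definition relabel_action := TotalAction relabel1 relabelM.

Lemma isomorphicE H1 H2 : isomorphic H1 H2 = (H2 \in orbit relabel_action setT H1).
Proof.
apply/existsP/orbitP => [[s]|[s _ <-]].
  by rewrite is_isomorphismE => /eqP <-; exists s.
by exists s; rewrite is_isomorphismE.
Qed.

Lemma card_isomorphic H : (#|[set H' | isomorphic H H']| * #|automorphisms H| = n`!)%N.
Proof.
rewrite -card_Sn -cardsT -(card_orbit_stab relabel_action setT%G H).
congr (_ * _)%N; apply: eq_card => x; rewrite inE ?isomorphicE //.
rewrite is_isomorphismE !inE /=.
by rewrite sub1set inE.
Qed.

Lemma isomorphic_equiv (D : {set rooted_fat_hypergraph n k}) : {in D & &, equivalence_rel (@isomorphic n k)}.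
Proof.
move=> x y z _ _ _; rewrite !isomorphicE; split; first exact: (orbit_refl relabel_action).
by move/orbit_eqP => <-.
Qed.

Lemma hyperedges_relabel H s : hyperedges (relabel H s) = [set s @: (e : {set 'I_n}) | e in hyperedges H].
Proof.
apply/setP => e; rewrite inE; apply/idP/imsetP => [|[f fH ->]].
  by exists (s^-1%g @: e); rewrite ?imset_permKV // inE -(multiplicity_relabel _ s) imset_permKV.
by rewrite multiplicity_relabel; rewrite inE in fH.
Qed.

Lemma fat_hypertree_relabel p H s : (0 < p)%N -> fat_hypertree p H -> fat_hypertree p (relabel H s).
Proof.
move=> p0 /(fat_hypertreeP _ p0)[c2 m2 n0 [conn ac] sk]; apply/(fat_hypertreeP _ p0).
pose h (x : 'I_n + {set 'I_n}) : 'I_n + {set 'I_n} :=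
  match x with inl v => inl (s v) | inr e => inr (s @: e) end.
have sinj : injective (fun e : {set 'I_n} => s @: e) by apply/imset_inj/perm_inj.
have hinj : injective h.
  by move=> [v|e] [w|f] //= []; [move=> /perm_inj ->|move=> /sinj ->].
have memE e : s @: e \in enum (hyperedges (relabel H s)) = (e \in enum (hyperedges H)).
  by rewrite !mem_enum hyperedges_relabel mem_imset.
have hE x y : incidence_seq (enum (hyperedges (relabel H s))) (h x) (h y) =
    incidence_seq (enum (hyperedges H)) x y.
  by case: x y => [v|e] [w|f] //=; rewrite memE mem_imset //; apply: perm_inj.
have hcod x : exists x', x = h x'.
  case: x => [v|e]; first by exists (inl (s^-1%g v)); rewrite /= permKV.
  by exists (inr (s^-1%g @: e)); rewrite /= imset_permKV.
have hcod2 x y : incidence_seq (enum (hyperedges (relabel H s))) x y ->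
    (exists x', x = h x') /\ (exists y', y = h y') by [].
have cE := connect_embedding hinj hE hcod2; have aE := acyclic_embedding hinj hE hcod2.
split=> //.
- by move=> e; rewrite hyperedges_relabel => /imsetP[f fH ->]; rewrite card_imset ?c2 //; apply: perm_inj.
- by move=> e; rewrite hyperedges_relabel => /imsetP[f fH ->]; rewrite multiplicity_relabel m2.
- split; last exact/aE.
  move=> v w; have := conn (s^-1%g v) (s^-1%g w); rewrite -cE /= !permKV.
  by [].
- rewrite hyperedges_relabel big_imset /=; last by move=> e f _ _ /sinj.
  by rewrite -[RHS]sk; apply: eq_bigr => e _; rewrite multiplicity_relabel.
Qed.

Lemma steps_in_relabel H s (w : k.-tuple 'I_n) e :
  steps_in (relabel H s) (map_tuple s w) (s @: e) = steps_in H w e.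
Proof.
rewrite /steps_in -[tval (map_tuple s w)]/(map s w) -[root_of _]/(s (root_of H)).
rewrite -map_cons zip_map2 count_map; apply: eq_count => -[x y] /=.
by rewrite !mem_imset //; apply: perm_inj.
Qed.

Lemma closed_walks_relabel H s (w : k.-tuple 'I_n) :
  (map_tuple s w \in closed_walks (relabel H s)) = (w \in closed_walks H).
Proof.
rewrite !inE /root_of /= last_map (inj_eq perm_inj); congr [&& _, _ & _].
  rewrite path_map; apply: eq_path => x y; rewrite /relpre /= /clique_expansion.
  rewrite (inj_eq perm_inj); congr (_ && _).
  apply/exists_inP/exists_inP => -[e].
    rewrite hyperedges_relabel => /imsetP[f fH ->]; rewrite !mem_imset; try exact: perm_inj.
    by exists f.
  move=> eH xy; exists (s @: e); first by rewrite hyperedges_relabel imset_f.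
  by rewrite !mem_imset //; apply: perm_inj.
apply/forall_inP/forall_inP => hw e eH.
  by have := hw (s @: e); rewrite steps_in_relabel multiplicity_relabel; apply; rewrite hyperedges_relabel imset_f.
move: eH; rewrite hyperedges_relabel => /imsetP[f fH ->].
by rewrite steps_in_relabel multiplicity_relabel hw.
Qed.

Definition walk_sum (R : realType) (a : nat -> R) H : R :=
  \sum_(w in closed_walks H) \prod_(e in hyperedges H) a (steps_in H w e).

Lemma walk_sum_relabel (R : realType) (a : nat -> R) H s :
  walk_sum a (relabel H s) = walk_sum a H.
Proof.
rewrite /walk_sum (reindex (fun w : k.-tuple 'I_n => map_tuple s w)) /=; last first.
  exists (fun w : k.-tuple 'I_n => map_tuple s^-1%g w) => w _; apply/val_inj => /=;
    by rewrite -map_comp map_id_in // => x _ /=; rewrite ?permK ?permKV.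
apply: eq_big => w; first exact: closed_walks_relabel.
move=> _; rewrite hyperedges_relabel big_imset /=.
  by apply: eq_bigr => e _; rewrite steps_in_relabel.
by move=> e f _ _ ef; apply: (imset_inj (@perm_inj _ s)).
Qed.

(* Orbit-stabilizer turns the weights [1 / |Aut|] on isomorphism classes into
   the weight [1 / n!] on labelled hypertrees. *)
Lemma sum_fat_hypertree_classes (R : realType) (a : nat -> R) p : (0 < p)%N ->
  \sum_(H in fat_hypertree_classes n k p) #|automorphisms H|%:R^-1 * walk_sum a H =
  (n`!%:R)^-1 * \sum_(H in fat_hypertrees n k p) walk_sum a H.
Proof.
move=> p0; rewrite /fat_hypertree_classes; set D := fat_hypertrees n k p.
set P := equivalence_partition _ _.
have partP : partition P D by apply/equivalence_partitionP/isomorphic_equiv.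
have trX := transversalP partP.
have PE : {in D &, forall x y, (y \in pblock P x) = isomorphic x y}.
  exact/pblock_equivalence_partition/isomorphic_equiv.
move: (transversal P D) trX => X trX.
rewrite (set_partition_big _ partP) /= -[in RHS](pblock_transversal trX).
rewrite [in RHS]big_imset /=; last exact: (pblock_inj trX).
rewrite mulr_sumr; apply: eq_bigr => H HX.
have HD : H \in D by apply: (subsetP (transversal_sub trX)).
(* The block of [H] is its whole orbit, because relabelling preserves fat hypertrees. *)
have -> : pblock P H = [set H' | isomorphic H H'].
  apply/setP => H'; rewrite inE; have [H'D|H'nD] := boolP (H' \in D); first exact: PE.
  transitivity false.
    by apply: contraNF H'nD => H'P; rewrite -(cover_partition partP); apply/bigcupP;
      exists (pblock P H); rewrite ?pblock_mem // (cover_partition partP).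
  apply/esym; apply: contraNF H'nD; rewrite isomorphicE => /orbitP[s _ <-].
  by move: HD; rewrite !inE => /asboolP HD; apply/asboolP/fat_hypertree_relabel.
rewrite (eq_bigr (fun=> walk_sum a H)); last first.
  move=> H'; rewrite inE isomorphicE => /orbitP[s _ <-]; exact: walk_sum_relabel.
rewrite sumr_const -(card_isomorphic H) -[walk_sum a H *+ _]mulr_natl.
have /andP[c1 c2] : (0 < #|[set H' | isomorphic H H']|)%N && (0 < #|automorphisms H|)%N.
  by rewrite -muln_gt0 card_isomorphic fact_gt0.
by rewrite natrM; field; rewrite !pnatr_eq0 -!lt0n c1 c2.
Qed.

End Relabelling.

Lemma eta_labelled (R : realType) p (a : nat -> R) k : (0 < p)%N -> (0 < k)%N ->
  eta p a k = \sum_(n < (k * p).+1) (n`!%:R)^-1 *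
    \sum_(H in fat_hypertrees n k p) walk_sum a H.
Proof.
case: k => // k p0 _; apply: eq_bigr => n _.
exact: sum_fat_hypertree_classes.
Qed.

(** As k > 0 there is a hyperedge, and as p > 1 it has a vertex other than [v]; the first step of a
    path from [v] to that vertex enters a hyperedge containing [v]. *)
Lemma hyperedges_cover n k p (H : rooted_fat_hypergraph n k) : (1 < p)%N -> (0 < k)%N ->
  fat_hypertree p H -> forall v, exists2 e, e \in hyperedges H & v \in e.
Proof.
move=> p_gt1 k0 tH v; have [c2 _ _ [conn _] sk] := (fat_hypertreeP H (ltnW p_gt1)).1 tH.
have [e eH] : exists e, e \in hyperedges H.
  apply/set0Pn; apply: contraTneq k0 => H0; rewrite -sk H0 big_set0 //.
have [u uv] : exists u, u != v.
  have : (1 < #|e|)%N by rewrite c2.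
  case/card_gt1P => x [y [_ _ xy]]; have [xv|xv] := eqVneq x v; last by exists x.
  by exists y; rewrite -xv eq_sym.
have /connectP[[|[x|e'] t] /= pt lt] := conn v u.
- by case: lt => lt; rewrite lt eqxx in uv.
- by [].
by case/andP: pt => /andP[]; rewrite mem_enum => eH' ve' _; exists e'.
Qed.

(** * Closed chains of edges *)

Lemma path_zip (T : Type) (e : rel T) x s :
  path e x s = all (fun xy => e xy.1 xy.2) (zip (x :: s) s).
Proof. by elim: s x => //= y s IH x; rewrite IH. Qed.

Lemma sorted_enum_ordS k : sorted (fun s s' => s' == ordS s) (enum 'I_k).
Proof.
have : sorted (fun a b => b == a.+1) (iota 0 k).
  by elim: k 0%N => // k IH m; have := IH m.+1; case: k {IH} => //= k ->; rewrite eqxx.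
rewrite -val_enum_ord sorted_map => so; refine (sub_sorted _ so) => s s' /eqP ss'.
apply/eqP/val_inj; rewrite /= modn_small //.
by have := ltn_ord s'; rewrite -[nat_of_ord s']/(val s') ss'.
Qed.

(** Since [ordS] is cyclic, the last entry of [t] is [a ord0] again: the steps of a closed walk
    written as a list are its steps indexed cyclically. *)
Lemma cyclic_zip (T : Type) k (a : 'I_k.+1 -> T) :
  let t := [seq a (ordS s) | s <- enum 'I_k.+1] in
  zip (a ord0 :: t) t = [seq (a s, a (ordS s)) | s <- enum 'I_k.+1].
Proof.
set o := a ord0; move=> t.
have st : size t = k.+1 by rewrite size_map size_enum_ord.
have tE (s : 'I_k.+1) : nth o t s = a (ordS s).
  by rewrite (nth_map ord0) ?size_enum_ord // nth_ord_enum.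
have sz : size (zip (o :: t) t) = k.+1 by rewrite size_zip /= st (minn_idPr (leqnSn _)).
apply: (@eq_from_nth _ (o, o)) => [|i]; first by rewrite sz size_map size_enum_ord.
rewrite sz => ik; rewrite nth_zip_cond sz ik.
rewrite [RHS](nth_map ord0) ?size_enum_ord // (nth_ord_enum ord0 (Ordinal ik)).
congr pair; last exact: (tE (Ordinal ik)).
case: i ik => [|i] ik; first by congr a; apply/val_inj.
rewrite -[LHS]/(nth o t i) (tE (Ordinal (ltnW ik))).
by congr a; apply/val_inj; rewrite /= modn_small.
Qed.

Lemma val_tensor_index p N (a b : 'I_N) (j : (p - 2).-tuple 'I_N) : (1 < p)%N ->
  tensor_index a b j = [:: a, b & j] :> seq 'I_N.
Proof.
move=> p1; apply: (@eq_from_nth _ a) => [|i].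
  by rewrite size_tuple /= size_tuple; lia.
rewrite size_tuple => ip; rewrite -[i]/(val (Ordinal ip)) -tnth_nth.
by rewrite tnth_mktuple.
Qed.

Lemma tensor_index_inj p N (a b : 'I_N) : (1 < p)%N ->
  injective (@tensor_index p N a b).
Proof.
move=> p1 j j' /(congr1 val) /=; rewrite !val_tensor_index // => -[e].
exact/val_inj.
Qed.

(** Two distinct hyperedges with two common vertices would form a cycle of length 4. *)
Lemma acyclic_meet (V : finType) (l : seq {set V}) (e f : {set V}) a b :
  acyclic (incidence_seq l) -> e \in l -> f \in l -> a != b ->
  a \in e -> b \in e -> a \in f -> b \in f -> e = f.
Proof.
move=> ac el fl ab ae be af bf; apply/eqP/negPn/negP => ef.
have /negP := ac [:: inl a; inr e; inl b; inr f] isT; apply.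
rewrite /ucycleb; apply/andP; split; first by rewrite /= ae be af bf el fl.
rewrite !cons_uniq !inE !orFb ?orbF.
have inlE : (inl a == inl b :> V + {set V}) = (a == b) by [].
have inrE : (inr e == inr f :> V + {set V}) = (e == f) by [].
by rewrite inlE inrE ab ef.
Qed.

(** * Extremal patterns, hypertrees and closed walks *)

Section Configurations.
Variables (n k p : nat).
Hypothesis p_gt1 : (1 < p)%N.
Implicit Types (f : {ffun 'I_k.+1 * 'I_p -> 'I_n}) (s : 'I_k.+1) (e : {set 'I_n}).
Local Notation hyper := (rooted_fat_hypergraph n k.+1).
Implicit Types (H : hyper) (w : k.+1.-tuple 'I_n).

(* The step s of a closed walk is described by the tuple f (s, 0), ..., f (s, p - 1)
   of the vertices of its hyperedge, the step going from f (s, 0) to f (s, 1). *)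
Definition start f s := f (s, Ordinal (ltnW p_gt1)).
Definition stop f s := f (s, Ordinal p_gt1).
Definition edge (S : finType) N (g : {ffun S * 'I_p -> 'I_N}) (s : S) : p.-tuple 'I_N :=
  [tuple g (s, l) | l < p].
Definition chain f := [forall s, stop f s == start f (ordS s)].
Definition edge_set f s : {set 'I_n} := [set x in edge f s].
Definition edge_sets f := [set edge_set f s | s : 'I_k.+1].
Definition edge_mult f e := #|[set s | edge_set f s == e]|.

(** These are the patterns that contribute to the limit: no tuple repeats a vertex, the equation on
    [n] is equality in the vertex bound, and every hyperedge is used at least twice, since the
    entries are centered. *)
Definition tree_config f := [&& chain f, [set f x | x in {: 'I_k.+1 * 'I_p}] == setT,
  [forall s, uniq (edge f s)], n == (1 + (p - 1) * #|edge_sets f|)%N &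
  [forall e in edge_sets f, (1 < edge_mult f e)%N]].

Definition config_hypergraph f : hyper :=
  (start f ord0, [ffun e : {set 'I_n} => inord (edge_mult f e)]).
Definition config_walk f : k.+1.-tuple 'I_n := [tuple stop f s | s < k.+1].

Lemma multiplicity_config f e : multiplicity (config_hypergraph f) e = edge_mult f e.
Proof.
rewrite /multiplicity ffunE inordK // ltnS.
by apply: leq_trans (max_card _) _; rewrite card_ord.
Qed.

Lemma hyperedges_config f : hyperedges (config_hypergraph f) = edge_sets f.
Proof.
apply/setP => e; rewrite inE multiplicity_config card_gt0.
apply/set0Pn/imsetP => [[s]|[s _ ->]]; last by exists s; rewrite inE.
by rewrite inE => /eqP <-; exists s.
Qed.

Lemma start_in f s : start f s \in edge_set f s.
Proof. by rewrite inE; apply/tnthP; eexists; rewrite tnth_mktuple. Qed.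

Lemma stop_in f s : stop f s \in edge_set f s.
Proof. by rewrite inE; apply/tnthP; eexists; rewrite tnth_mktuple. Qed.

Lemma start_stop_neq f s : uniq (edge f s) -> start f s != stop f s.
Proof.
move=> /tuple_uniqP inj; apply/eqP => ss.
have := inj (Ordinal (ltnW p_gt1)) (Ordinal p_gt1).
by rewrite !tnth_mktuple => /(_ ss) /(congr1 val).
Qed.

Lemma size_config_walk f : size (config_walk f) = k.+1.
Proof. by rewrite size_tuple ?card_ord. Qed.

Lemma nth_config_walk f o (s : 'I_k.+1) : nth o (config_walk f) s = stop f s.
Proof. by rewrite (nth_map ord0) ?size_enum_ord // nth_ord_enum. Qed.

Lemma chain_zip f : chain f ->
  zip (start f ord0 :: config_walk f) (config_walk f) =
  [seq (start f s, stop f s) | s <- enum 'I_k.+1].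
Proof.
move=> /forallP ch.
have -> : config_walk f = [seq start f (ordS s) | s <- enum 'I_k.+1] :> seq _.
  by apply: eq_map => s; rewrite -(eqP (ch s)).
by rewrite (cyclic_zip (start f)); apply: eq_map => s; rewrite -(eqP (ch s)).
Qed.

Lemma linked_edge_sets f : chain f ->
  linked [seq edge_set f s | s <- enum 'I_k.+1].
Proof.
move=> /forallP ch; have := sorted_enum_ordS k.+1.
elim: (enum _) => //= s l IH sl; rewrite IH ?(path_sorted sl) // andbT.
case: l sl {IH} => //= s' l /andP[/eqP -> _]; apply/orP; left.
by apply/set0Pn; exists (stop f s); rewrite inE stop_in (eqP (ch s)) start_in.
Qed.

Lemma covered_edge_sets f : [set f x | x in {: 'I_k.+1 * 'I_p}] = setT ->
  covered [seq edge_set f s | s <- enum 'I_k.+1] = setT.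
Proof.
move=> fT; apply/setP => v; rewrite [RHS]inE inE.
have : v \in setT by [].
rewrite -fT => /imsetP[[s l] _ ->]; apply/hasP; exists (edge_set f s).
  by apply: map_f; rewrite mem_enum.
by rewrite inE; apply/tnthP; exists l; rewrite tnth_mktuple.
Qed.

Lemma mem_edge_sets f : [seq edge_set f s | s <- enum 'I_k.+1] =i edge_sets f.
Proof.
move=> e; apply/mapP/imsetP => -[s _ ->]; exists s => //.
by rewrite mem_enum.
Qed.

Lemma size_undup_edge_sets f :
  size (undup [seq edge_set f s | s <- enum 'I_k.+1]) = #|edge_sets f|.
Proof.
rewrite -(card_uniqP (undup_uniq _)); apply: eq_card => e.
by rewrite mem_undup mem_edge_sets.
Qed.

Lemma card_edge_set f s : uniq (edge f s) -> #|edge_set f s| = p.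
Proof. by move=> /card_uniqP; rewrite cardsE => ->; rewrite size_tuple. Qed.

Lemma steps_in_config f H w e : chain f -> root_of H = start f ord0 -> w = config_walk f ->
  steps_in H w e = #|[set s | (start f s \in e) && (stop f s \in e)]|.
Proof.
move=> ch rH wf; rewrite /steps_in rH wf chain_zip // count_map enumT cardE size_filter.
by apply: eq_count => s; rewrite /= inE.
Qed.

(** [steps_in] sees only the two ends of a step. In the acyclic case these are two distinct
    vertices, so they determine the hyperedge of the step. *)
Lemma edge_multE f e : acyclic (incidence_seq (enum (edge_sets f))) ->
  (forall s, uniq (edge f s)) -> e \in edge_sets f ->
  #|[set s | (start f s \in e) && (stop f s \in e)]| = edge_mult f e.
Proof.
move=> ac un eE; apply: eq_card => s; rewrite !inE.
apply/andP/eqP => [[se te]|<-]; last by rewrite start_in stop_in.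
apply: (acyclic_meet ac _ _ (start_stop_neq (un s)));
  rewrite ?mem_enum ?start_in ?stop_in //.
by apply/imsetP; exists s.
Qed.

(** Chaining makes the hyperedges connected and the walk closed; acyclicity comes from the equality
    case of [covered_count]. *)
Lemma tree_config_valid f : tree_config f ->
  config_hypergraph f \in fat_hypertrees n k.+1 p /\
  config_walk f \in closed_walks (config_hypergraph f).
Proof.
case/and5P=> ch /eqP fT /forallP un /eqP nE /forall_inP m2.
have lk := linked_edge_sets ch; have cv := covered_edge_sets fT.
have n0 : (0 < n)%N by rewrite nE.
have ac : acyclic (incidence_seq (enum (edge_sets f))).
  have [] // := @covered_count _ p [seq edge_set f s | s <- enum 'I_k.+1].
  - exact: ltnW.
  - by rewrite -size_eq0 size_map size_enum_ord.
  - by apply/allP => _ /mapP[s _ ->]; rewrite card_edge_set.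
  move=> _ []; rewrite cv cardsT card_ord size_undup_edge_sets => /(_ nE) ac _.
  move=> c c2; apply: contra (ac c c2).
  have E : incidence_seq (enum (edge_sets f)) =2
      incidence_seq [seq edge_set f s | s <- enum 'I_k.+1].
    by apply: eq_incidence_seq => e; rewrite mem_enum mem_edge_sets.
  by rewrite /ucycleb (eq_cycle E).
have pos e : e \in edge_sets f -> #|e| = p by move=> /imsetP[s _ ->]; exact: card_edge_set.
split; rewrite inE; last first.
  have lastE : last (root_of (config_hypergraph f)) (config_walk f) = start f ord0.
    rewrite (last_nth (start f ord0)) size_config_walk.
    rewrite -[LHS]/(nth (start f ord0) (config_walk f) (@ord_max k)) nth_config_walk.
    rewrite (eqP (forallP ch _)); congr start.
    by apply/val_inj; rewrite /= modnn.
  rewrite lastE eqxx path_zip chain_zip // all_map; apply/and3P; split => //.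
    apply/allP => s _ /=; rewrite /clique_expansion (start_stop_neq (un s)) /=.
    apply/exists_inP; exists (edge_set f s); rewrite ?start_in ?stop_in //.
    by rewrite hyperedges_config; apply/imsetP; exists s.
  apply/forall_inP => e; rewrite hyperedges_config => eE.
  by rewrite (@steps_in_config f) // edge_multE // multiplicity_config.
apply/asboolP/fat_hypertreeP; first exact: ltnW.
rewrite hyperedges_config; split => //.
- by move=> e eE; rewrite multiplicity_config; apply: m2.
- split=> // v w.
  have E : incidence_seq (enum (edge_sets f)) =2
      incidence_seq [seq edge_set f s | s <- enum 'I_k.+1].
    by apply: eq_incidence_seq => e; rewrite mem_enum mem_edge_sets.
  by rewrite (eq_connect E); apply: connect_linked => //; rewrite cv inE.
- rewrite (eq_bigr (fun e => \sum_(s | edge_set f s == e) 1)%N); last first.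
    by move=> e _; rewrite multiplicity_config sum1dep_card.
  transitivity (\sum_(s : 'I_k.+1) 1)%N; last by rewrite sum1_card card_ord.
  rewrite (partition_big (edge_set f) [in edge_sets f]) //= => s _.
  by apply/imsetP; exists s.
Qed.

Definition orderings (a b : 'I_n) e : {set p.-tuple 'I_n} :=
  [set t : p.-tuple 'I_n | [&& uniq t, tnth t (Ordinal (ltnW p_gt1)) == a,
    tnth t (Ordinal p_gt1) == b & [set x in t] == e]].

Lemma card_orderings a b e : #|e| = p -> a != b -> a \in e -> b \in e ->
  #|orderings a b e| = (p - 2)`!.
Proof.
move=> ep ab ae be.
have cE : #|e :\: [set a; b]| = (p - 2)%N.
  by rewrite cardsD (setIidPr _) ?cards2 ?ab ?ep // subUset !sub1set ae.
transitivity #|[set u : (p - 2).-tuple 'I_n | all [in e :\: [set a; b]] u & uniq u]|;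
  last by rewrite card_uniq_tuples cE ffactnn.
rewrite -(card_imset _ (@tensor_index_inj p n a b p_gt1)); apply: eq_card => t.
apply/idP/imsetP => [|[u]]; rewrite inE.
  case/and4P=> ut /eqP ta /eqP tb /eqP te.
  have tE : t = [:: a, b & drop 2 t] :> seq _.
    move: ta tb; rewrite !(tnth_nth a); have := size_tuple t.
    case: (tval t) => [|x [|y t']] /=; try by move: p_gt1; lia.
    by move=> _ -> ->; rewrite drop0.
  exists [tuple of drop 2 t]; last by apply/val_inj; rewrite /= val_tensor_index.
  rewrite inE /=; move: ut; rewrite tE /= drop0 !inE !negb_or.
  case/and3P=> /andP[_ ad] bd ->; rewrite andbT; apply/allP => x xd.
  have xe : x \in e by rewrite -te inE -[_ \in _]/(x \in tval t) tE !inE xd !orbT.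
  rewrite inE xe andbT !inE negb_or; apply/andP.
  by split; apply: contraTneq xd => ->.
case/andP=> /allP ue uu ->.
have tv := val_tensor_index a b u p_gt1.
have unT : uniq (tensor_index a b u).
  rewrite tv /= inE negb_or ab uu andbT /=; apply/andP; split;
    by apply/negP => /ue; rewrite !inE eqxx ?orbT.
rewrite inE; apply/and4P; split=> //.
- by rewrite (tnth_nth a) tv.
- by rewrite (tnth_nth a) tv.
rewrite eqEcard; apply/andP; split.
  apply/subsetP => x; rewrite inE => xt.
  have {xt} : x \in tval (tensor_index a b u) by [].
  rewrite tv !inE => /or3P[/eqP -> //|/eqP -> //|/ue].
  by rewrite inE => /andP[].
by rewrite ep cardsE (card_uniqP unT) size_tuple.
Qed.

Definition walk_start H w (s : 'I_k.+1) := nth (root_of H) (root_of H :: w) s.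
Definition walk_stop H w (s : 'I_k.+1) := nth (root_of H) w s.
(** For a closed walk on a fat hypertree exactly one hyperedge qualifies; [set0] is a dummy
    value. *)
Definition walk_edge H w s : {set 'I_n} := odflt set0
  [pick e in hyperedges H | (walk_start H w s \in e) && (walk_stop H w s \in e)].

Lemma walk_edgeP H w s : w \in closed_walks H ->
  [/\ walk_start H w s != walk_stop H w s, walk_edge H w s \in hyperedges H,
      walk_start H w s \in walk_edge H w s & walk_stop H w s \in walk_edge H w s].
Proof.
rewrite inE => /and3P[]; rewrite path_zip => /allP pw _ _.
have sz : size (zip (root_of H :: w) w) = k.+1.
  by rewrite size_zip /= size_tuple (minn_idPr (leqnSn _)).
have /pw : (walk_start H w s, walk_stop H w s) \in zip (root_of H :: w) w.
  apply/(nthP (root_of H, root_of H)); exists s; rewrite ?sz //.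
  by rewrite nth_zip_cond sz ltn_ord.
rewrite /= /clique_expansion => /andP[-> /exists_inP[e eH ste]].
rewrite /walk_edge; case: pickP => [f /andP[fH /andP[? ?]]|/(_ e)] //.
by rewrite eH ste.
Qed.

Lemma hyperedge_uniq H a b e e' : fat_hypertree p H -> a != b ->
  e \in hyperedges H -> e' \in hyperedges H ->
  a \in e -> b \in e -> a \in e' -> b \in e' -> e = e'.
Proof.
move=> /(fat_hypertreeP H (ltnW p_gt1))[_ _ _ [_ ac] _].
by move=> ab eH e'H; apply: (acyclic_meet ac); rewrite ?mem_enum.
Qed.

(** The patterns over a pair (H, w) form a product over the steps: each step chooses, independently
    of the others, an ordering of its hyperedge that begins with the two ends of the step. The other
    conditions in [tree_config] follow from the properties of [H] and [w]. *)
Lemma config_fiber H w f : fat_hypertree p H -> w \in closed_walks H ->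
  [&& tree_config f, config_hypergraph f == H & config_walk f == w] =
  [forall s, edge f s \in orderings (walk_start H w s) (walk_stop H w s) (walk_edge H w s)].
Proof.
move=> tH wH; apply/and3P/forallP => [[tf /eqP fH /eqP fw] s|fo].
  case/and5P: tf => ch _ /forallP un _ _.
  have stopE s' : stop f s' = walk_stop H w s'.
    by rewrite /walk_stop -fw nth_config_walk.
  have startE s' : start f s' = walk_start H w s'.
    case: s' => -[|i] ik.
      by rewrite /walk_start -fH /= /root_of /=; congr start; apply/val_inj.
    rewrite -[RHS]/(walk_stop H w (Ordinal (ltnW ik))) -stopE (eqP (forallP ch _)).
    by congr start; apply/val_inj; rewrite /= modn_small.
  have [ab eH ae be] := walk_edgeP s wH.
  rewrite inE un !tnth_mktuple -startE -stopE !eqxx /=; apply/eqP.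
  apply: (hyperedge_uniq tH ab _ eH _ _ ae be).
  - by rewrite -fH hyperedges_config; apply/imsetP; exists s.
  - by rewrite -startE start_in.
  - by rewrite -stopE stop_in.
have un s : uniq (edge f s) by have := fo s; rewrite inE => /and4P[].
have startE s : start f s = walk_start H w s.
  by have := fo s; rewrite inE => /and4P[_ /eqP <- _ _]; rewrite tnth_mktuple.
have stopE s : stop f s = walk_stop H w s.
  by have := fo s; rewrite inE => /and4P[_ _ /eqP <- _]; rewrite tnth_mktuple.
have edgeE s : edge_set f s = walk_edge H w s.
  by have := fo s; rewrite inE => /and4P[_ _ _ /eqP <-].
have ch : chain f.
  apply/forallP => s; rewrite stopE startE; case: (ltnP s k) => sk.
    by rewrite /walk_start /walk_stop /= modn_small.
  have -> : s = ord_max by apply/val_inj/eqP; rewrite eqn_leq sk -ltnS ltn_ord.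
  rewrite /walk_start /= modnn /=; have := wH; rewrite inE => /and3P[_ /eqP <- _].
  by rewrite (last_nth (root_of H)) size_tuple.
have rE : root_of H = start f ord0 by rewrite startE.
have wE : w = config_walk f.
  apply/val_inj/(@eq_from_nth _ (root_of H)) => [|i]; first by rewrite size_tuple size_config_walk.
  rewrite size_tuple => ik; rewrite -[i]/(nat_of_ord (Ordinal ik)).
  by rewrite nth_config_walk stopE.
have /forall_inP ms : [forall e in hyperedges H, steps_in H w e == multiplicity H e].
  by move: wH; rewrite inE => /and3P[].
have [c2 m2 n0 [conn ac] sk] := (fat_hypertreeP H (ltnW p_gt1)).1 tH.
(* Each hyperedge is crossed, since its number of steps equals its multiplicity, which is
   positive. *)
have esE : edge_sets f = hyperedges H.
  apply/setP => e; apply/imsetP/idP => [[s _ ->]|eH].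
    by rewrite edgeE; case: (walk_edgeP s wH).
  have : (0 < steps_in H w e)%N by rewrite (eqP (ms _ eH)) (leq_trans _ (m2 _ eH)).
  rewrite (@steps_in_config f) // => /card_gt0P[s]; rewrite inE => /andP[se te].
  exists s => //; apply: (hyperedge_uniq tH (start_stop_neq (un s))) => //.
  - by rewrite edgeE; case: (walk_edgeP s wH).
  - exact: start_in.
  - exact: stop_in.
have mE e : e \in hyperedges H -> edge_mult f e = multiplicity H e.
  by move=> eH; rewrite -(eqP (ms _ eH)) (@steps_in_config f) // edge_multE // esE.
have cv : covered [seq edge_set f s | s <- enum 'I_k.+1] = setT.
  apply/setP => v; rewrite [RHS]inE inE.
  have [e eH ve] := hyperedges_cover p_gt1 (ltn0Sn k) tH v.
  by apply/hasP; exists e; rewrite // mem_edge_sets esE.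
split.
- apply/and5P; split=> //.
  + rewrite eqEsubset subsetT; apply/subsetP => v.
    rewrite -cv inE => /hasP[_ /mapP[s _ ->]]; rewrite inE => /tnthP[l ->].
    by rewrite tnth_mktuple imset_f.
  + exact/forallP.
  + have [] // := @covered_count _ p [seq edge_set f s | s <- enum 'I_k.+1].
    * exact: ltnW.
    * by rewrite -size_eq0 size_map size_enum_ord.
    * by apply/allP => _ /mapP[s _ ->]; rewrite card_edge_set.
    * exact: linked_edge_sets.
    move=> _ [_]; rewrite cv cardsT card_ord size_undup_edge_sets => nE.
    apply/eqP/nE.
    have E : incidence_seq (enum (hyperedges H)) =2
        incidence_seq [seq edge_set f s | s <- enum 'I_k.+1].
      by apply: eq_incidence_seq => e; rewrite mem_enum mem_edge_sets esE.
    by move=> c c2'; apply: contra (ac c c2'); rewrite /ucycleb (eq_cycle E).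
  + by apply/forall_inP => e; rewrite esE => eH; rewrite mE // m2.
- rewrite /config_hypergraph; case: H rE mE esE {tH wH startE stopE edgeE fo wE ms c2 m2 conn ac sk} => o m /= rE mE esE.
  rewrite -[o]/(root_of (o, m)) rE; apply/eqP; congr pair.
  apply/ffunP => e; rewrite ffunE; apply/val_inj.
  transitivity (edge_mult f e).
    by have := multiplicity_config f e; rewrite /multiplicity ffunE.
  rewrite -[RHS]/(multiplicity (o, m) e).
  (* Away from the hyperedges both multiplicities are 0. *)
  have [eH|eH] := boolP (e \in hyperedges (o, m)); first exact: mE.
  have := eH; rewrite inE -eqn0Ngt => /eqP ->.
  apply/eqP; rewrite cards_eq0; apply/eqP/setP => s; rewrite !inE.
  apply: contraNF eH => /eqP <-; rewrite -esE; by apply/imsetP; exists s.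
- by rewrite -wE.
Qed.

Lemma card_edge_family (F : 'I_k.+1 -> {set p.-tuple 'I_n}) :
  #|[set f : {ffun 'I_k.+1 * 'I_p -> 'I_n} | [forall s, edge f s \in F s]]| =
  (\prod_s #|F s|)%N.
Proof.
transitivity #|family F|; last by rewrite card_family foldrE big_map big_enum.
pose h f : {ffun 'I_k.+1 -> p.-tuple 'I_n} := [ffun s => edge f s].
have hinj : injective h.
  move=> f g /ffunP fg; apply/ffunP => -[s l]; have := fg s.
  by rewrite !ffunE => /(congr1 (fun t => tnth t l)); rewrite !tnth_mktuple.
rewrite -(card_imset _ hinj); apply: eq_card => g; apply/imsetP/familyP => [[f fF ->] s|gF].
  by rewrite ffunE; move: fF; rewrite inE => /forallP.
have hg : h [ffun x => tnth (g x.1) x.2] = g.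
  apply/ffunP => s; rewrite ffunE; apply/eq_from_tnth => l.
  by rewrite tnth_mktuple ffunE.
exists [ffun x => tnth (g x.1) x.2] => //; rewrite inE; apply/forallP => s.
by have := gF s; rewrite -{1}hg ffunE.
Qed.

(** The summand depends only on the pair of the hypergraph and the walk, and each pair has (p - 2)!
    ^ k.+1 patterns above it. *)
Lemma sum_tree_config (R : realType) (M : nat -> R) :
  \sum_(f | tree_config f) \prod_(e in edge_sets f) M (edge_mult f e) =
  ((p - 2)`! ^ k.+1)%:R * \sum_(H in fat_hypertrees n k.+1 p) walk_sum M H.
Proof.
rewrite (partition_big config_hypergraph [in fat_hypertrees n k.+1 p]) /=; last first.
  by move=> f /tree_config_valid[].
rewrite mulr_sumr; apply: eq_bigr => H; rewrite inE => /asboolP tH.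
rewrite (partition_big config_walk [in closed_walks H]) /=; last first.
  by move=> f /andP[/tree_config_valid[_ ?] /eqP <-].
rewrite mulr_sumr; apply: eq_bigr => w wH.
rewrite [LHS](eq_bigr (fun=> \prod_(e in hyperedges H) M (steps_in H w e))); last first.
  move=> f /andP[/andP[_ /eqP fH] _]; rewrite -fH hyperedges_config; apply: eq_bigr => e eE.
  rewrite -multiplicity_config; congr M; rewrite fH.
  move: wH; rewrite inE => /and3P[_ _ /forall_inP /(_ e)].
  by rewrite -{1}fH hyperedges_config => /(_ eE) /eqP.
rewrite sumr_const -[X in X *+ _]mul1r -mulrnAl; congr (_%:R * _).
transitivity (\prod_(s < k.+1) (p - 2)`!)%N; last by rewrite prod_nat_const card_ord.
transitivity (\prod_(s < k.+1) #|orderings (walk_start H w s) (walk_stop H w s) (walk_edge H w s)|)%N.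
  rewrite -card_edge_family; apply: eq_card => f.
  by rewrite -topredE /= inE -config_fiber // ?andbA.
apply: eq_bigr => s _; have [ab eH ae be] := walk_edgeP s wH.
apply: card_orderings => //.
by have [c2 _ _ _ _] := (fat_hypertreeP H (ltnW p_gt1)).1 tH; apply: c2.
Qed.

End Configurations.

(** * Tuples up to permutation *)

Section EdgeClasses.
Variable p : nat.
Hypothesis p_gt1 : (1 < p)%N.
Local Notation leo := (fun x y => nat_of_ord x <= nat_of_ord y)%N.

(** By symmetry an entry of the tensor depends only on the multiset of its indices. The sorted tuple
    is the representative for which independence is assumed. *)
Definition sort_edge N (t : p.-tuple 'I_N) : p.-tuple 'I_N := [tuple of sort leo t].

Lemma leo_perm_sortP N (s t : seq 'I_N) : reflect (sort leo s = sort leo t) (perm_eq s t).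
Proof.
apply: perm_sortP => [x y|x y z|x y]; [exact: leq_total|exact: leq_trans|].
by move=> xy; apply/val_inj/anti_leq.
Qed.

Lemma sort_edgeP N (t t' : p.-tuple 'I_N) : reflect (sort_edge t = sort_edge t') (perm_eq t t').
Proof.
by apply: (iffP (leo_perm_sortP _ _)) => [?|/(congr1 val)//]; apply/val_inj.
Qed.

Lemma sorted_sort_edge N (t : p.-tuple 'I_N) : sorted leq (map val (sort_edge t)).
Proof. by rewrite sorted_map; apply: sort_sorted => x y; exact: leq_total. Qed.

Lemma sorted_ltn_sort_edge N (t : p.-tuple 'I_N) : uniq t -> sorted ltn (map val (sort_edge t)).
Proof.
move=> ut; rewrite ltn_sorted_uniq_leq sorted_sort_edge andbT.
by rewrite map_inj_uniq ?sort_uniq //; exact: val_inj.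
Qed.

Section Classes.
Variables (S : finType) (N : nat) (f : {ffun S * 'I_p -> 'I_N}).
Definition edge_classes := [set sort_edge (edge f s) | s in S].
Definition class_mult (i : p.-tuple 'I_N) := #|[set s | sort_edge (edge f s) == i]|.
Definition vertices := [set f x | x in {: S * 'I_p}].
End Classes.

Lemma seq_cls_perm N (t t' : seq 'I_N) : sort leo t = sort leo t' -> perm_eq t t'.
Proof. by move/leo_perm_sortP. Qed.

Section Walks.
Variables (k N : nat).
Implicit Types f g : {ffun 'I_k.+1 * 'I_p -> 'I_N}.
Local Notation chain := (chain p_gt1).
Local Notation start := (start p_gt1).
Local Notation stop := (stop p_gt1).

Lemma path_meets f s l : chain f -> path (fun s s' => s' == ordS s) s l ->
  path (fun a b => meets b a) (edge f s : seq 'I_N) [seq (edge f s : seq 'I_N) | s <- l].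
Proof.
move=> /forallP ch; elim: l s => //= s' l IH s /andP[/eqP -> /IH ->]; rewrite andbT.
apply/hasP; exists (stop f s); first by have := stop_in p_gt1 f s; rewrite inE.
by rewrite (eqP (ch s)); have := start_in p_gt1 f (ordS s); rewrite inE.
Qed.

Lemma size_edges f l : all (fun t => size t == p) [seq (edge f s : seq 'I_N) | s <- l].
Proof. by apply/allP => _ /mapP[x _ ->]; rewrite size_tuple. Qed.

Lemma few_vertices_walk f s l : chain f -> path (fun s s' => s' == ordS s) s l ->
  few_vertices (sort leo) p (catrev [seq (edge f s : seq 'I_N) | s <- l] [:: (edge f s : seq 'I_N)]).
Proof.
case: l => [|s' l] ch sl.
  apply: few_vertices1 => //; exact: size_tuple.
have /andP[ms ml] := path_meets ch sl.
apply: few_vertices_path => //.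
- exact: seq_cls_perm.
- exact: (size_edges f (s' :: l)).
- by apply/hasP; exists (edge f s : seq 'I_N); rewrite ?mem_head.
- by apply: few_vertices1 => //; exact: size_tuple.
Qed.

Lemma few_vertices_walk_cat f s l L : chain f -> path (fun s s' => s' == ordS s) s l ->
  has (meets (edge f s)) L -> few_vertices (sort leo) p L ->
  few_vertices (sort leo) p (catrev [seq (edge f s : seq 'I_N) | s <- s :: l] L).
Proof.
move=> ch sl mL fL; apply: few_vertices_path => //.
- exact: seq_cls_perm.
- exact: (size_edges f (s :: l)).
- exact: path_meets.
Qed.

Lemma cycle_ordS (K : nat) : path.cycle (fun s s' : 'I_K => s' == ordS s) (enum 'I_K).
Proof.
case: K => [|K]; first by rewrite (size0nil (size_enum_ord 0)).
have := sorted_enum_ordS K.+1.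
have lE : last ord0 (enum 'I_K.+1) = ord_max by rewrite enum_ordSr last_rcons.
have hE : head ord0 (enum 'I_K.+1) = ord0 by rewrite enum_ordSl.
case: (enum _) lE hE => //= s l lE sE sl; rewrite rcons_path sl lE sE.
by apply/eqP/val_inj; rewrite /= modnn.
Qed.

(** Passes from lists of tuples, on which the induction runs, to the sets attached to [f]. Order and
    repetitions in [L] do not matter, so a chain may be traversed from any starting point. *)
Lemma undup_classes (S : finType) (f : {ffun S * 'I_p -> 'I_N}) (L : seq (seq 'I_N)) :
  (forall t, t \in L <-> exists s, t = edge f s) ->
  [/\ size (undup (map (sort leo) L)) = #|edge_classes f|,
      [set x in flatten L] = vertices f & all uniq L = [forall s, uniq (edge f s)]].
Proof.
move=> LP; split.
- rewrite cardE -(size_map val); apply/perm_size/uniq_perm.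
  + exact: undup_uniq.
  + by rewrite map_inj_uniq ?enum_uniq //; exact: val_inj.
  + move=> c; rewrite mem_undup; apply/mapP/mapP => [[t /LP[s ->] ->]|[t]].
      by exists (sort_edge (edge f s)) => //; rewrite mem_enum; apply/imsetP; exists s.
    rewrite mem_enum => /imsetP[s _ ->] ->; exists (edge f s : seq 'I_N) => //.
    by apply/LP; exists s.
- apply/setP => x; rewrite inE; apply/flattenP/imsetP => [[t /LP[s ->] /tnthP[l ->]]|[[s l] _ ->]].
    by exists (s, l) => //; rewrite tnth_mktuple.
  exists (edge f s : seq 'I_N); first by apply/LP; exists s.
  by apply/tnthP; exists l; rewrite tnth_mktuple.
- apply/allP/forallP => [h s|h t /LP[s ->] //].
  by apply: h; apply/LP; exists s.
Qed.

Lemma card_vertices_chain f : chain f ->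
  (#|vertices f| + ~~ [forall s, uniq (edge f s)] <= 1 + (p - 1) * #|edge_classes f|)%N.
Proof.
move=> ch; have := sorted_enum_ordS k.+1; rewrite enum_ordSl /= => sl.
have := few_vertices_walk ch sl; set L := catrev _ _.
have [] // := @undup_classes _ f L; last by rewrite /few_vertices => -> -> ->.
move=> t; rewrite /L catrevE mem_cat mem_rev inE orbC.
have -> : (t == edge f ord0) || (t \in [seq (edge f s : seq 'I_N) | s <- [seq lift ord0 i | i <- enum 'I_k]]) =
    (t \in [seq (edge f s : seq 'I_N) | s <- enum 'I_k.+1]).
  by rewrite enum_ordSl.
by split=> [/mapP[s _ ->]|[s ->]]; [exists s|apply: map_f; rewrite mem_enum].
Qed.

Definition pair_config f g : {ffun ('I_k.+1 + 'I_k.+1) * 'I_p -> 'I_N} :=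
  [ffun x => match x.1 with inl s => f (s, x.2) | inr s => g (s, x.2) end].

Lemma edge_pairl f g s : edge (pair_config f g) (inl s) = edge f s.
Proof. by apply/eq_from_tnth => l; rewrite !tnth_mktuple ffunE. Qed.

Lemma edge_pairr f g s : edge (pair_config f g) (inr s) = edge g s.
Proof. by apply/eq_from_tnth => l; rewrite !tnth_mktuple ffunE. Qed.

Lemma edge_classes_pair f g : edge_classes (pair_config f g) = edge_classes f :|: edge_classes g.
Proof.
apply/setP => i; rewrite inE; apply/imsetP/orP => [[[s|s] _ ->]|[]/imsetP[s _ ->]].
- by left; rewrite edge_pairl; apply/imsetP; exists s.
- by right; rewrite edge_pairr; apply/imsetP; exists s.
- by exists (inl s) => //; rewrite edge_pairl.
- by exists (inr s) => //; rewrite edge_pairr.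
Qed.

(** The second chain, being cyclic, may be rotated so that it starts at a tuple whose class occurs
    in the first. It is then attached to the first chain, and a single [1 +] bounds both chains
    where two unrelated chains would need two. *)
Lemma card_vertices_pair f g : chain f -> chain g ->
  edge_classes f :&: edge_classes g != set0 ->
  (#|vertices (pair_config f g)| <= 1 + (p - 1) * #|edge_classes (pair_config f g)|)%N.
Proof.
move=> cf cg /set0Pn[i]; rewrite inE => /andP[/imsetP[s0 _ ->] /imsetP[s1 _ /sort_edgeP e01]].
have := sorted_enum_ordS k.+1; rewrite enum_ordSl /= => sl.
have := few_vertices_walk cf sl; set L := catrev _ _ => fL.
have LE t : (t \in L) = (t \in [seq (edge f s : seq 'I_N) | s <- enum 'I_k.+1]).
  by rewrite /L catrevE mem_cat mem_rev inE orbC enum_ordSl.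
have s1e : s1 \in enum 'I_k.+1 by rewrite mem_enum.
have [j l jl] := rot_to s1e.
have pl : path (fun s s' => s' == ordS s) s1 l.
  by have := cycle_ordS k.+1; rewrite -(rot_cycle j) jl /= rcons_path => /andP[].
have mL : has (meets (edge g s1)) L.
  apply/hasP; exists (edge f s0 : seq 'I_N); first by rewrite LE; apply: map_f; rewrite mem_enum.
  apply/hasP; exists (start f s0); first by have := start_in p_gt1 f s0; rewrite inE.
  by have := start_in p_gt1 f s0; rewrite inE /= -(perm_mem e01).
have := few_vertices_walk_cat cg pl mL fL; set L2 := catrev _ _.
have [] // := @undup_classes _ (pair_config f g) L2; last first.
  by rewrite /few_vertices => -> -> _; apply: leq_trans; rewrite leq_addr.
move=> t; rewrite /L2 catrevE mem_cat mem_rev -jl LE.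
split=> [/orP[]/mapP[s _ ->]|[[s|s] ->]].
- by exists (inr s); rewrite edge_pairr.
- by exists (inl s); rewrite edge_pairl.
- by apply/orP; right; rewrite edge_pairl; apply: map_f; rewrite mem_enum.
- by apply/orP; left; rewrite edge_pairr; apply: map_f; rewrite mem_rot mem_enum.
Qed.

End Walks.

Section Relabelled.
Variables (k n N : nat) (i : {ffun 'I_n -> 'I_N}) (f : {ffun 'I_k.+1 * 'I_p -> 'I_n}).
Hypothesis inji : injective i.

Lemma edge_ffcomp s : edge (ffcomp i f) s = map_tuple i (edge f s).
Proof. by apply/eq_from_tnth => l; rewrite !tnth_mktuple tnth_map tnth_mktuple ffunE. Qed.

Lemma chain_ffcomp : chain p_gt1 (ffcomp i f) = chain p_gt1 f.
Proof. by apply: eq_forallb => s; rewrite /start /stop !ffunE (inj_eq inji). Qed.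

Lemma uniq_edge_ffcomp s : uniq (edge (ffcomp i f) s) = uniq (edge f s).
Proof. by rewrite edge_ffcomp map_inj_uniq. Qed.

Lemma card_vertices_ffcomp : [set f x | x in {: 'I_k.+1 * 'I_p}] = setT ->
  #|vertices (ffcomp i f)| = n.
Proof.
move=> fT; rewrite -[RHS]card_ord -cardsT -fT -(card_imset _ inji) -imset_comp.
by congr #|pred_of_set _|; apply: eq_imset => x; rewrite ffunE.
Qed.

Hypothesis uf : forall s, uniq (edge f s).

Lemma sort_edge_ffcomp s s' :
  (sort_edge (edge (ffcomp i f) s) == sort_edge (edge (ffcomp i f) s')) =
  (edge_set f s == edge_set f s').
Proof.
rewrite -(sameP (sort_edgeP _ _) eqP) !edge_ffcomp.
rewrite (_ : perm_eq _ _ = perm_eq (edge f s) (edge f s')); last first.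
  by apply/idP/idP => [/(perm_map_inj inji)|]; [|exact: perm_map].
apply/idP/eqP => [/perm_mem ss'|/setP ss'].
  by apply/setP => x; rewrite !inE ss'.
by apply: uniq_perm => // x; have := ss' x; rewrite !inE.
Qed.

(** For a set that is not a hyperedge the value is still the class of a tuple of [f], so that it is
    strictly increasing for every [e]. *)
Definition class_of_edge_set (e : {set 'I_n}) : p.-tuple 'I_N :=
  if [pick s | edge_set f s == e] is Some s then sort_edge (edge (ffcomp i f) s)
  else sort_edge (edge (ffcomp i f) ord0).

Lemma class_of_edge_setE s : class_of_edge_set (edge_set f s) = sort_edge (edge (ffcomp i f) s).
Proof.
rewrite /class_of_edge_set; case: pickP => [s' ss'|/(_ s)]; last by rewrite eqxx.
by apply/eqP; rewrite sort_edge_ffcomp.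
Qed.

Lemma sorted_class_of_edge_set e : sorted ltn (map val (class_of_edge_set e)).
Proof.
rewrite /class_of_edge_set; case: pickP => [s _|_]; apply: sorted_ltn_sort_edge;
  by rewrite uniq_edge_ffcomp.
Qed.

Lemma edge_classes_ffcomp : edge_classes (ffcomp i f) = [set class_of_edge_set e | e in edge_sets f].
Proof.
rewrite /edge_sets -imset_comp; apply: eq_imset => s.
by rewrite /= class_of_edge_setE.
Qed.

Lemma class_of_edge_set_inj : {in edge_sets f &, injective class_of_edge_set}.
Proof.
move=> _ _ /imsetP[s _ ->] /imsetP[s' _ ->]; rewrite !class_of_edge_setE => /eqP.
by rewrite sort_edge_ffcomp => /eqP.
Qed.

Lemma class_mult_ffcomp e : e \in edge_sets f ->
  class_mult (ffcomp i f) (class_of_edge_set e) = edge_mult f e.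
Proof.
move=> /imsetP[s _ ->]; rewrite class_of_edge_setE; apply: eq_card => s'.
by rewrite !inE sort_edge_ffcomp.
Qed.

Lemma prod_edge_classes (R : comRingType) (F : p.-tuple 'I_N -> nat -> R) :
  \prod_(t in edge_classes (ffcomp i f)) F t (class_mult (ffcomp i f) t) =
  \prod_(e in edge_sets f) F (class_of_edge_set e) (edge_mult f e).
Proof.
rewrite edge_classes_ffcomp big_imset /=; last exact: class_of_edge_set_inj.
by apply: eq_bigr => e eE; rewrite class_mult_ffcomp.
Qed.

Lemma card_edge_classes_ffcomp : #|edge_classes (ffcomp i f)| = #|edge_sets f|.
Proof. by rewrite edge_classes_ffcomp card_in_imset //; exact: class_of_edge_set_inj. Qed.

End Relabelled.
End EdgeClasses.

(** * Traces of powers *)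

Section TracePowers.
Variables (R : comRingType) (N : nat).

Lemma sum_tuple_cons (I : finType) n (Q : seq I -> bool) (F : seq I -> R) :
  \sum_(t : n.+1.-tuple I | Q t) F t = \sum_x \sum_(t : n.-tuple I | Q (x :: t)) F (x :: t).
Proof.
rewrite pair_big_dep /=.
rewrite (reindex (fun xt : I * n.-tuple I => [tuple of xt.1 :: xt.2])) //=.
exists (fun t : n.+1.-tuple I => (thead t, [tuple of behead t])) => [[x t] _|t _].
  by congr pair; apply/val_inj.
by rewrite /= -tuple_eta.
Qed.

Lemma mx_power_walks (A : 'M[R]_N) k i j : (A ^+ k) i j =
  \sum_(t : k.-tuple 'I_N | last i t == j) \prod_(xy <- zip (i :: t) t) A xy.1 xy.2.
Proof.
elim: k i => [|k IH] i.
  rewrite expr0 mxE; case: eqVneq => [<-|ij].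
    rewrite (big_pred1 [tuple]) /= ?big_nil // => t.
    by rewrite (tuple0 t) /= !eqxx.
  rewrite big_pred0 // => t; by rewrite (tuple0 t) /= (negPf ij).
rewrite (@sum_tuple_cons _ k (fun t => last i t == j)
  (fun t => \prod_(xy <- zip (i :: t) t) A xy.1 xy.2)).
rewrite exprS mxE; apply: eq_bigr => l _; rewrite IH mulr_sumr.
by apply: eq_bigr => t _; rewrite [in RHS]big_cons.
Qed.

Lemma trace_power (A : 'M[R]_N) k :
  \tr (A ^+ k.+1) = \sum_(v : {ffun 'I_k.+1 -> 'I_N}) \prod_s A (v s) (v (ordS s)).
Proof.
rewrite /mxtrace; under eq_bigr do rewrite mx_power_walks.
rewrite pair_big_dep /=.
pose h (v : {ffun 'I_k.+1 -> 'I_N}) := (v ord0, [tuple v (ordS s) | s < k.+1]).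
pose h' (it : 'I_N * k.+1.-tuple 'I_N) : {ffun 'I_k.+1 -> 'I_N} :=
  [ffun s : 'I_k.+1 => nth it.1 (it.1 :: it.2) s].
rewrite (reindex_onto h h') /=; last first.
  case=> i t /= /eqP lt; rewrite /h /h' !ffunE /=; congr pair.
  apply/eq_from_tnth => s; rewrite tnth_mktuple ffunE (tnth_nth i) /=.
  case: (ltnP s k) => sk; first by rewrite modn_small.
  have -> : s = ord_max by apply/val_inj/eqP; rewrite eqn_leq sk -ltnS ltn_ord.
  by rewrite /= modnn /= -[LHS]lt (last_nth i) size_tuple.
have zE (v : {ffun 'I_k.+1 -> 'I_N}) := cyclic_zip v.
apply: eq_big => [v|v _]; last by rewrite zE big_map big_enum.
apply/andP; split.
  apply/eqP; rewrite (last_nth (v ord0)) size_map size_enum_ord /=.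
  rewrite (nth_map ord0) ?size_enum_ord // (nth_ord_enum ord0 ord_max).
  by congr (v _); apply/val_inj; rewrite /= modnn.
apply/eqP/ffunP => -[[|i] ik]; rewrite ffunE /=; first by congr (v _); apply/val_inj.
have ik' := ltnW ik.
rewrite (nth_map ord0) ?size_enum_ord // (nth_ord_enum ord0 (Ordinal ik')).
by congr (v _); apply/val_inj; rewrite /= modn_small.
Qed.

End TracePowers.

Section ContractedTrace.
Variables (R : comRingType) (p N : nat) (T : p.-tuple 'I_N -> R).
Hypothesis p_gt1 : (1 < p)%N.
Let i0 : 'I_p := Ordinal (ltnW p_gt1).
Let i1 : 'I_p := Ordinal p_gt1.

Lemma sum_tensor_index a b : \sum_(j : (p - 2).-tuple 'I_N) T (tensor_index a b j) =
  \sum_(t : p.-tuple 'I_N | (tnth t i0 == a) && (tnth t i1 == b)) T t.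
Proof.
pose h (t : p.-tuple 'I_N) : (p - 2).-tuple 'I_N := [tuple of drop 2 t].
rewrite [RHS](reindex_onto (@tensor_index p N a b) h) /=; last first.
  move=> t /andP[/eqP ta /eqP tb]; apply/val_inj; rewrite /= val_tensor_index //=.
  move: ta tb; rewrite !(tnth_nth a) /=; have := size_tuple t.
  case: (tval t) => [|x [|y t']] /=; try by move: p_gt1; lia.
  by move=> _ -> ->; rewrite drop0.
apply: eq_bigl => j; rewrite !(tnth_nth a) !val_tensor_index //= !eqxx /=.
by apply/esym/eqP/val_inj; rewrite /= val_tensor_index //= drop0.
Qed.

(** After expansion of every matrix entry, the tuples determine the visited vertices, the vertex at
    step s being the first entry of the tuple at s. The sum over vertices therefore collapses, and
    the compatibility of consecutive tuples is [chain]. *)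
Lemma trace_contracted (A : 'M[R]_N) c k :
  (forall a b, A a b = c * \sum_(j : (p - 2).-tuple 'I_N) T (tensor_index a b j)) ->
  \tr (A ^+ k.+1) = c ^+ k.+1 *
    \sum_(f : {ffun 'I_k.+1 * 'I_p -> 'I_N} | chain p_gt1 f) \prod_s T (edge f s).
Proof.
move=> AE; rewrite trace_power.
pose q (g : {ffun 'I_k.+1 -> p.-tuple 'I_N}) (v : {ffun 'I_k.+1 -> 'I_N}) :=
  [forall s, (tnth (g s) i0 == v s) && (tnth (g s) i1 == v (ordS s))].
transitivity (\sum_(v : {ffun 'I_k.+1 -> 'I_N}) c ^+ k.+1 *
    \sum_(g : {ffun 'I_k.+1 -> p.-tuple 'I_N} | q g v) \prod_s T (g s)).
  apply: eq_bigr => v _; under eq_bigr do rewrite AE sum_tensor_index.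
  rewrite big_split /= prodr_const card_ord; congr (_ * _).
  rewrite (bigA_distr_big_dep (fun s t => (tnth t i0 == v s) && (tnth t i1 == v (ordS s)))
    (fun s t => T t)) /=.
  by apply: eq_bigl => g; apply/familyP/forallP.
rewrite -mulr_sumr; congr (_ * _).
rewrite (exchange_big_dep (fun g : {ffun 'I_k.+1 -> p.-tuple 'I_N} =>
  [forall s, tnth (g s) i1 == tnth (g (ordS s)) i0])) /=; last first.
  move=> v g _ /forallP vg; apply/forallP => s.
  by have /andP[_ /eqP ->] := vg s; have /andP[/eqP <-] := vg (ordS s).
pose e (f : {ffun 'I_k.+1 * 'I_p -> 'I_N}) : {ffun 'I_k.+1 -> p.-tuple 'I_N} :=
  [ffun s => edge f s].
pose e' (g : {ffun 'I_k.+1 -> p.-tuple 'I_N}) : {ffun 'I_k.+1 * 'I_p -> 'I_N} :=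
  [ffun x => tnth (g x.1) x.2].
rewrite (reindex e) /=; last first.
  exists e' => [f _|g _].
    by apply/ffunP => -[s l]; rewrite !ffunE tnth_mktuple.
  by apply/ffunP => s; rewrite ffunE; apply/eq_from_tnth => l; rewrite tnth_mktuple ffunE.
apply: eq_big => [f|f fch].
  by apply: eq_forallb => s; rewrite !ffunE !tnth_mktuple.
rewrite (big_pred1 [ffun s => tnth (e f s) i0]); first by apply: eq_bigr => s _; rewrite ffunE.
move=> v; apply/forallP/eqP => [vg|->].
  by apply/ffunP => s; rewrite ffunE; have /andP[/eqP ->] := vg s.
by move=> s; rewrite !ffunE eqxx /=; have /forallP/(_ s) := fch; rewrite !ffunE.
Qed.

End ContractedTrace.

(** * Hypertrees with a single hyperedge *)

Section OneEdge.
Variable p : nat.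
Hypothesis p_gt1 : (1 < p)%N.

Definition one_edge (o : 'I_p) : rooted_fat_hypergraph p 2 :=
  (o, [ffun e : {set 'I_p} => if e == setT then ord_max else ord0]).

Lemma multiplicity_one_edge o e : multiplicity (one_edge o) e = if e == setT then 2 else 0.
Proof. by rewrite /multiplicity ffunE; case: ifP. Qed.

Lemma hyperedges_one_edge o : hyperedges (one_edge o) = [set setT].
Proof. by apply/setP => e; rewrite !inE multiplicity_one_edge; case: ifP. Qed.

Lemma fat_hypertree_one_edge o : fat_hypertree p (one_edge o).
Proof.
apply/(fat_hypertreeP _ (ltnW p_gt1)); rewrite hyperedges_one_edge; split.
- by move=> e /set1P ->; rewrite cardsT card_ord.
- by move=> e /set1P ->; rewrite multiplicity_one_edge eqxx.
- exact: ltnW.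
- have enumT : enum [set [set: 'I_p]] = [:: setT] by rewrite enum_set1.
  rewrite enumT; split=> [v w|].
    apply: (@connect_trans _ _ (inr setT)); apply: connect1.
      by rewrite /= mem_head inE.
    by rewrite /= mem_head inE.
  have [||||_ [h _]] := @covered_count _ p [:: [set: 'I_p]] => //; first exact: ltnW.
    by rewrite /= cardsT card_ord eqxx.
  apply: h => /=.
  rewrite (_ : covered _ = setT); last by apply/setP => v; rewrite !inE /= inE.
  by rewrite cardsT card_ord; lia.
- by rewrite big_set1 multiplicity_one_edge eqxx.
Qed.

(** Multiplicities at least 2 with total 2 leave a single hyperedge, which covers all the
    vertices. *)
Lemma fat_hypertree2 n (H : rooted_fat_hypergraph n 2) : fat_hypertree p H ->
  n = p /\ forall e, multiplicity H e = if e == setT then 2 else 0.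
Proof.
move=> tH; have cov := hyperedges_cover p_gt1 (isT : 0 < 2)%N tH.
have [c m n0 _ s2] := (fat_hypertreeP H (ltnW p_gt1)).1 tH.
have [e eH _] := cov (Ordinal n0).
move: s2; rewrite (bigD1 e) //= => s2.
have other e' : e' \in hyperedges H -> e' = e.
  move=> e'H; apply/eqP; apply: contraT => e'e.
  move: s2; rewrite (bigD1 e') /=; last by rewrite e'H.
  by have := m e eH; have := m e' e'H; lia.
have eT : e = setT.
  by apply/setP => v; rewrite [RHS]inE; have [e' /other -> ->] := cov v.
split; first by rewrite -(c e eH) eT cardsT card_ord.
move=> e'; rewrite -eT; case: eqP => [->|e'e]; first by have := m e eH; lia.
by apply/eqP; rewrite -leqn0 leqNgt; apply/negP => e'H; apply: e'e; apply: other; rewrite inE.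
Qed.

Lemma fat_hypertrees2 : fat_hypertrees p 2 p = [set one_edge o | o : 'I_p].
Proof.
apply/setP => H; rewrite inE; apply/asboolP/imsetP => [tH|[o _ ->]]; last first.
  exact: fat_hypertree_one_edge.
exists (root_of H) => //; have [_ mH] := fat_hypertree2 tH.
case: H {tH} mH => o m mH; congr pair; apply/ffunP => e.
by apply/val_inj; rewrite -[LHS]/(multiplicity (o, m) e) mH ffunE; case: ifP.
Qed.

Lemma walk_sum_one_edge (R : realType) (a : nat -> R) o :
  walk_sum a (one_edge o) = (p - 1)%:R * a 2.
Proof.
have stepsT (w : 2.-tuple 'I_p) : steps_in (one_edge o) w setT = 2.
  rewrite /steps_in (eq_count (a2 := predT)) ?count_predT; last by move=> x; rewrite !inE.
  by rewrite size_zip /= !size_tuple.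
have cl x y : clique_expansion (one_edge o) x y = (x != y).
  rewrite /clique_expansion; case: (x != y) => //=.
  by apply/exists_inP; exists setT; rewrite ?hyperedges_one_edge !inE.
have -> : walk_sum a (one_edge o) = \sum_(w in closed_walks (one_edge o)) a 2.
  by apply: eq_bigr => w _; rewrite hyperedges_one_edge big_set1 stepsT.
rewrite sumr_const mulr_natl; congr (_ *+ _).
have -> : closed_walks (one_edge o) = [set [tuple v; o] | v in [set~ o]].
  apply/setP => w; rewrite inE; apply/and3P/imsetP => [[]|[v]].
    case/tupleP: w => v w; case/tupleP: w => u w; rewrite (tuple0 w) /= !cl.
    move=> /and3P[ov _ _] /eqP -> _; exists v; first by rewrite !inE eq_sym.
    exact: val_inj.
  rewrite !inE => vo ->; rewrite /= !cl vo eq_sym vo eqxx; split=> //.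
  by apply/forall_inP => e; rewrite hyperedges_one_edge => /set1P ->; rewrite stepsT multiplicity_one_edge eqxx.
rewrite card_imset ?cardsC1 ?card_ord ?subn1 // => u v /(congr1 val) /=.
by case.
Qed.

(** There are p roots for the single hyperedge and p - 1 closed walks of length 2 from each, so the
    labelled sum is p (p - 1) a_2 / p!. *)
Lemma eta2 (R : realType) (a : nat -> R) : eta p a 2 = a 2 / (p - 2)`!%:R.
Proof.
rewrite eta_labelled //; last exact: ltnW.
have pS : (p < (2 * p).+1)%N by lia.
rewrite (bigD1 (Ordinal pS)) //= [X in _ + X]big1 ?addr0 => [|n np]; last first.
  rewrite [X in _ * X]big1 ?mulr0 // => H; rewrite inE => /asboolP/fat_hypertree2[nE _].
  by case/eqP: np; apply/val_inj.
rewrite fat_hypertrees2 big_imset /=; last by move=> x y _ _ [].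
rewrite (eq_bigr (fun=> (p - 1)%:R * a 2)) => [|o _]; last exact: walk_sum_one_edge.
rewrite sumr_const card_ord -mulr_natl.
have -> : p`! = (p * ((p - 1) * (p - 2)`!))%N.
  by case: p p_gt1 => [|[|q]] // _; rewrite !factS !subn1 subn2.
have p0 : p%:R != 0 :> R by rewrite pnatr_eq0; lia.
have p1 : (p - 1)%:R != 0 :> R by rewrite pnatr_eq0; lia.
have f0 : (p - 2)`!%:R != 0 :> R by rewrite pnatr_eq0 -lt0n fact_gt0.
by rewrite !natrM; field; rewrite p0 p1 f0.
Qed.

End OneEdge.

From mathcomp Require Import complex all_classical all_reals all_analysis measurable_realfun.
Import numFieldNormedType.Exports.

Local Open Scope classical_set_scope.

(** * Expectations of products of tensor entries *)

Section RealIntegrals.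
Context d (T : measurableType d) (R : realType) (mu : {measure set T -> \bar R}).
Implicit Types f g h : T -> R.

Definition integ f := mu.-integrable setT (EFin \o f).

Lemma integ_measurable f : integ f -> measurable_fun setT f.
Proof. by move=> /measurable_int /measurable_EFinP. Qed.

Lemma integ_le f g : measurable_fun setT f -> integ g -> (forall x, `|f x| <= `|g x|) -> integ f.
Proof.
move=> mf ig fg; apply: (le_integrable _ _ _ ig) => //; first exact/measurable_EFinP.
by move=> x _ /=; rewrite lee_fin.
Qed.

Lemma integD f g : integ f -> integ g -> integ (fun x => f x + g x).
Proof. by move=> fi gi; exact: (integrableD measurableT fi gi). Qed.

Lemma integB f g : integ f -> integ g -> integ (fun x => f x - g x).
Proof. by move=> fi gi; exact: (integrableB measurableT fi gi). Qed.

Lemma integZ r f : integ f -> integ (fun x => r * f x).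
Proof. by move=> fi; exact: (integrableZl measurableT r fi). Qed.

Lemma integ_sum (I : Type) (s : seq I) (Q : pred I) (F : I -> T -> R) :
  (forall i, Q i -> integ (F i)) -> integ (fun x => \sum_(i <- s | Q i) F i x).
Proof.
move=> iF; have := @integrable_sum _ _ _ mu _ measurableT I s Q (fun i => EFin \o F i) iF.
by apply: eq_integrable => // x _; rewrite /= sumEFin.
Qed.

Lemma Rintegral_sum (I : Type) (s : seq I) (Q : pred I) (F : I -> T -> R) :
  (forall i, Q i -> integ (F i)) ->
  \int[mu]_x (\sum_(i <- s | Q i) F i x) = \sum_(i <- s | Q i) \int[mu]_x F i x.
Proof.
move=> iF; elim: s => [|i s IH].
  rewrite big_nil; under eq_Rintegral do rewrite big_nil.
  by rewrite Rintegral_cst // mul0r.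
rewrite big_cons -IH; under eq_Rintegral do rewrite big_cons.
by case: ifP => Qi //; rewrite RintegralD //; [exact: iF | exact: integ_sum].
Qed.

Lemma Rdominated_convergence (F : nat -> T -> R) f g :
  (forall n, measurable_fun setT (F n)) -> measurable_fun setT f ->
  {ae mu, forall x, (F ^~ x) @ \oo --> f x} -> integ g ->
  {ae mu, forall x, forall n, `|F n x| <= g x} ->
  integ f /\ (fun n => \int[mu]_x F n x) @ \oo --> \int[mu]_x f x.
Proof.
move=> mF mf Ff ig Fg.
have [] := @dominated_convergence _ _ _ mu _ measurableT (fun n => EFin \o F n) (EFin \o f) (EFin \o g).
- by move=> n; exact/measurable_EFinP.
- exact/measurable_EFinP.
- by apply: filterS Ff => x Fx _; apply: cvg_EFin => //; apply: nearW.
- exact: ig.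
- by apply: filterS Fg => x Fx n _; rewrite /= lee_fin.
move=> fi _ cv; split; first exact: fi.
apply: fine_cvg; rewrite /Rintegral fineK //.
exact: (integrable_fin_num measurableT fi).
Qed.

End RealIntegrals.

Section AllMoments.
Context d (T : measurableType d) (R : realType) (P : probability T R).
Implicit Types f g h : T -> R.

(** Unlike integrability, this condition is stable under products; it settles the integrability of
    every product of entries at once. *)
Definition all_moments f := measurable_fun setT f /\ forall k, integ P (fun w => f w ^+ k).

Lemma all_momentsM f g : all_moments f -> all_moments g -> all_moments (fun w => f w * g w).
Proof.
move=> [mf fk] [mg gk]; split=> [|k]; first exact: measurable_funM.
(* From |ab| <= a^2 + b^2 with a = f^k and b = g^k. *)
apply: (@integ_le _ _ _ _ _ (fun w => f w ^+ (k * 2) + g w ^+ (k * 2))).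
- by apply: measurable_funX; apply: measurable_funM.
- exact: integD.
move=> w; rewrite exprMn !exprM [leRHS]ger0_norm ?addr_ge0 ?sqr_ge0 // ler_norml.
move: (f w ^+ k) (g w ^+ k) => a b.
by have := sqr_ge0 (a - b); have := sqr_ge0 (a + b); move=> *; apply/andP; split; nra.
Qed.

Lemma all_moments_bounded f C : measurable_fun setT f -> (forall w, `|f w| <= C) -> all_moments f.
Proof.
move=> mf fC; split=> // k; apply: measurable_bounded_integrable => //.
- by rewrite [ltLHS]probability_setT ltry.
- exact: measurable_funX.
- exists (C ^+ k); split; first exact: num_real.
  move=> y Cy w _ /=; apply: le_trans (ltW Cy); rewrite normrX.
  by apply: lerXn2r; rewrite ?nnegrE ?normr_ge0 //; apply: le_trans (fC w).
Qed.

Lemma all_moments_cst c : all_moments (fun=> c).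
Proof. by apply: (@all_moments_bounded _ `|c|) => //; exact: measurable_cst. Qed.

Lemma all_moments_prod (I : Type) (s : seq I) (Q : pred I) (F : I -> T -> R) :
  (forall i, all_moments (F i)) -> all_moments (fun w => \prod_(i <- s | Q i) F i w).
Proof.
move=> aF; elim: s => [|i s IH].
  rewrite (_ : (fun w => _) = fun=> 1); first exact: all_moments_cst.
  by apply/funext => w; rewrite big_nil.
have [Qi|nQi] := boolP (Q i); last first.
  rewrite (_ : (fun w => _) = fun w => \prod_(i <- s | Q i) F i w) //.
  by apply/funext => w; rewrite big_cons (negPf nQi).
rewrite (_ : (fun w => _) = fun w => F i w * \prod_(i <- s | Q i) F i w).
  exact: all_momentsM.
by apply/funext => w; rewrite big_cons Qi.
Qed.

Lemma all_momentsX f k : all_moments f -> all_moments (fun w => f w ^+ k).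
Proof.
move=> af; elim: k => [|k IH]; first exact: all_moments_cst.
rewrite (_ : (fun w => _) = fun w => f w * f w ^+ k); first exact: all_momentsM.
by apply/funext => w; rewrite exprS.
Qed.

Lemma all_moments_integ f : all_moments f -> integ P f.
Proof. by move=> [_ /(_ 1%N)]; under eq_fun do rewrite expr1. Qed.

End AllMoments.

Import HBSimple HBNNSimple.

(** * Expectations of products of independent observables *)

Section Independence.
Context d (T : measurableType d) (R : realType) (P : probability T R).

(** Factorization passes from indicators to simple functions by linearity. The next two lemmas reach
    nonnegative functions by dominated convergence and signed ones through positive and negative
    parts. *)
Lemma uncorrelated_indic_sfun (Z X : T -> R) (h : {nnsfun R >-> R}) :
  all_moments P Z -> measurable_fun setT X ->
  (forall B, measurable B ->
     \int[P]_w (Z w * \1_B (X w)) = \int[P]_w Z w * \int[P]_w \1_B (X w)) ->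
  \int[P]_w (Z w * h (X w)) = \int[P]_w Z w * \int[P]_w h (X w).
Proof.
move=> aZ mX ind.
have hE x : h x = \sum_(r <- finmap.enum_fset (fset_set (range h))) r * \1_(h @^-1` [set r]) x.
  by rewrite [LHS]fimfunE fsbig_finite.
have aI (r : R) : all_moments P (fun w => \1_(h @^-1` [set r]) (X w)).
  apply: (@all_moments_bounded _ _ _ _ _ 1).
    by apply: measurableT_comp => //; exact: measurable_indic.
  by move=> w; rewrite /indic ger0_norm //; case: (_ \in _).
have iI r := all_moments_integ (aI r).
have iZI r := all_moments_integ (all_momentsM aZ (aI r)).
transitivity (\int[P]_w (\sum_(r <- finmap.enum_fset (fset_set (range h))) r * (Z w * \1_(h @^-1` [set r]) (X w)))).
  by apply: eq_Rintegral => w _; rewrite hE mulr_sumr; apply: eq_bigr => r _; rewrite mulrCA.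
rewrite Rintegral_sum => [|r _]; last exact: integZ.
under [X in _ = _ * X]eq_Rintegral do rewrite hE.
rewrite Rintegral_sum => [|r _]; last exact: integZ.
rewrite mulr_sumr; apply: eq_bigr => r _.
by rewrite (RintegralZl r measurableT (iZI r)) (RintegralZl r measurableT (iI r)) ind // mulrCA.
Qed.

Lemma uncorrelated_ge0 (Z X : T -> R) (h : R -> R) :
  all_moments P Z -> measurable_fun setT X -> measurable_fun setT h ->
  (forall x, 0 <= h x) -> all_moments P (fun w => h (X w)) ->
  (forall B, measurable B ->
     \int[P]_w (Z w * \1_B (X w)) = \int[P]_w Z w * \int[P]_w \1_B (X w)) ->
  \int[P]_w (Z w * h (X w)) = \int[P]_w Z w * \int[P]_w h (X w).
Proof.
move=> aZ mX mh h0 ah ind.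
pose mh' : measurable_fun setT (EFin \o h) := (measurable_EFinP _ _).2 mh.
pose g n : {nnsfun R >-> R} := nnsfun_approx measurableT mh' n.
have gh x : g ^~ x @ \oo --> h x.
  rewrite /g; under eq_fun do rewrite nnsfun_approxE.
  apply: (@cvg_approx _ _ _ setT (EFin \o h) x); rewrite /= ?ltry //.
  by move=> y _; rewrite lee_fin.
have gle n x : `|g n x| <= h x.
  rewrite ger0_norm // -lee_fin nnsfun_approxE.
  apply: (@le_approx _ _ _ setT (EFin \o h)) => //.
  by move=> y _; rewrite lee_fin.
have [_ c1] : integ P (fun w => h (X w)) /\ (fun n => \int[P]_w g n (X w)) @ \oo --> \int[P]_w h (X w).
  apply: (@Rdominated_convergence _ _ _ _ _ _ (fun w => h (X w))).
  - by move=> n; apply: measurableT_comp.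
  - exact: measurableT_comp.
  - by apply: aeW => w; exact: gh.
  - exact: all_moments_integ.
  - by apply: aeW => w n; exact: gle.
have aZh := all_momentsM aZ ah.
have [_ c2] : integ P (fun w => Z w * h (X w)) /\ (fun n => \int[P]_w (Z w * g n (X w))) @ \oo --> \int[P]_w (Z w * h (X w)).
  apply: (@Rdominated_convergence _ _ _ _ _ _ (fun w => `|Z w * h (X w)|)).
  - by move=> n; apply: measurable_funM; [case: aZ|apply: measurableT_comp].
  - by case: aZh.
  - by apply: aeW => w; apply: cvgM; [exact: cvg_cst|exact: gh].
  - exact/integrable_norm/all_moments_integ.
  - by apply: aeW => w n; rewrite !normrM ler_wpM2l // [leRHS]ger0_norm.
have c3 : (fun n => \int[P]_w (Z w * g n (X w))) @ \oo --> \int[P]_w Z w * \int[P]_w h (X w).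
  under eq_fun do rewrite uncorrelated_indic_sfun //.
  by apply: cvgM; [exact: cvg_cst|exact: c1].
exact: cvg_unique c2 c3.
Qed.

Lemma uncorrelated (Z X : T -> R) (h : R -> R) :
  all_moments P Z -> measurable_fun setT X -> measurable_fun setT h ->
  all_moments P (fun w => h (X w)) ->
  (forall B, measurable B ->
     \int[P]_w (Z w * \1_B (X w)) = \int[P]_w Z w * \int[P]_w \1_B (X w)) ->
  \int[P]_w (Z w * h (X w)) = \int[P]_w Z w * \int[P]_w h (X w).
Proof.
move=> aZ mX mh ah ind.
have part (s : R) : `|s| = 1 -> let hs x := Num.max (s * h x) 0 in
    measurable_fun setT hs /\ all_moments P (fun w => hs (X w)).
  move=> s1 hs; have mhs : measurable_fun setT hs.
    by apply: measurable_maxr => //; apply: measurable_funM.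
  split => //; split; first exact: measurableT_comp.
  move=> k; apply: (@integ_le _ _ _ _ _ (fun w => h (X w) ^+ k)).
  - by apply: measurable_funX; apply: measurableT_comp.
  - by case: ah.
  - move=> w; rewrite !normrX; apply: lerXn2r; rewrite ?nnegrE // /hs.
    rewrite -[leRHS]mul1r -s1 -normrM; case: (leP (s * h (X w)) 0) => [_|s0].
      by rewrite normr0.
    by [].
have [m1 a1] := part 1 (normr1 _).
have [m2 a2] : measurable_fun setT (fun x => Num.max (-1 * h x) 0) /\
    all_moments P (fun w => Num.max (-1 * h (X w)) 0) by apply: part; rewrite normrN1.
have hE x : h x = Num.max (1 * h x) 0 - Num.max (-1 * h x) 0.
  rewrite mul1r mulN1r; case: (leP (h x) 0) => ?; case: (leP (- h x) 0) => ?; lra.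
have ge0 s x : 0 <= Num.max (s * h x) 0 by rewrite le_max lexx orbT.
under eq_Rintegral do rewrite hE mulrBr.
under [X in _ = _ * X]eq_Rintegral do rewrite hE.
rewrite RintegralB //; try exact/all_moments_integ/all_momentsM.
rewrite RintegralB //; try exact/all_moments_integ.
rewrite (uncorrelated_ge0 aZ mX m1) // (uncorrelated_ge0 aZ mX m2) //.
by rewrite mulrBr.
Qed.

(* The observables are replaced one at a time, starting from indicators. *)
Lemma expectation_prod (I : finType) (X : I -> T -> R) (D J : {set I}) (g : I -> R -> R) :
  mutually_independent P X D -> J \subset D ->
  (forall i, measurable_fun setT (X i)) -> (forall i, measurable_fun setT (g i)) ->
  (forall i, all_moments P (fun w => g i (X i w))) ->
  \int[P]_w (\prod_(i in J) g i (X i w)) = \prod_(i in J) \int[P]_w g i (X i w).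
Proof.
move=> ind JD mX.
(* Induction on the number of observables in [J] that are not 0-1 valued; when there are none, the
   claim is independence itself. *)
have [n] := ubnP #|[set i in J | ~~ `[< forall x, g i x = 0 \/ g i x = 1 >]]%SET|.
elim: n g => // n IH g; rewrite ltnS => gn mg ag.
have [/eqP G0|/set0Pn[i0]] := boolP ([set i in J | ~~ `[< forall x, g i x = 0 \/ g i x = 1 >]]%SET == finset.set0).
  have g01 i : i \in J -> forall x, g i x = \1_(g i @^-1` [set 1]) x.
    move=> iJ x; have : i \notin [set i in J | ~~ `[< forall x, g i x = 0 \/ g i x = 1 >]]%SET.
      by rewrite G0 inE.
    rewrite inE iJ negbK => /asboolP /(_ x)[] e; rewrite indicE /preimage /= e.
      by rewrite memNset //= e; apply/eqP; rewrite eq_sym oner_eq0.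
    by rewrite mem_set.
  have mB i : measurable (g i @^-1` [set 1]).
    by rewrite -[X in measurable X]setTI; apply: mg.
  have mBX i : measurable (X i @^-1` (g i @^-1` [set 1])).
    by rewrite -[X in measurable X]setTI; apply: mX.
  have EB i : i \in J -> \int[P]_w g i (X i w) = fine (P (X i @^-1` (g i @^-1` [set 1]))).
    move=> iJ; rewrite -[in RHS](setIT (X i @^-1` _)) -(integral_indic P measurableT) //.
    by congr fine; apply: eq_integral => w _; rewrite g01.
  rewrite (eq_bigr (fun i => fine (P (X i @^-1` (g i @^-1` [set 1]))))) //.
  have := ind J (fun i => g i @^-1` [set 1]) JD mB.
  set A := \bigcap_(i in _) _ => PA.
  transitivity (fine (P A)).
    have mA : measurable A.
      by apply: fin_bigcap_measurable => //; exact: finite_finpred.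
    rewrite -[in RHS](setIT A) -(integral_indic P measurableT) //.
    congr fine; apply: eq_integral => w _; congr EFin.
    rewrite indicE; have [wA|wA] := boolP (w \in A).
      rewrite big1 // => i iJ; rewrite g01 // indicE mem_set //.
      by move/set_mem: wA => /(_ i); apply.
    move/negP: wA; rewrite inE /A => /existsNP[i /not_implyP[iJ /= giX]].
    rewrite (bigD1 i) //= g01 // indicE memNset ?mul0r //.
  rewrite PA -[RHS]/(fine (_%:E)); congr fine.
  by elim/big_rec2: _ => // i x y iJ ->; rewrite EFinM fineK // fin_num_measure.
rewrite inE => /andP[i0J /asboolPn ng].
pose g' (h : R -> R) i := if i == i0 then h else g i.
pose Z w := \prod_(i in J | i != i0) g i (X i w).
have aZ : all_moments P Z by exact: all_moments_prod.
have step (h : R -> R) : measurable_fun setT h -> (forall x, h x = 0 \/ h x = 1) ->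
    \int[P]_w (h (X i0 w) * Z w) =
    \int[P]_w h (X i0 w) * \prod_(i in J | i != i0) \int[P]_w g i (X i w).
  move=> mh h01; have := IH (g' h).
  rewrite (bigD1 i0) //= /g' eqxx.
  have -> : \prod_(i in J | i != i0) \int[P]_w (if i == i0 then h else g i) (X i w) =
      \prod_(i in J | i != i0) \int[P]_w g i (X i w).
    by apply: eq_bigr => i /andP[_ /negPf ->].
  have -> : \int[P]_w (\prod_(i in J) (if i == i0 then h else g i) (X i w)) =
      \int[P]_w (h (X i0 w) * Z w).
    apply: eq_Rintegral => w _; rewrite (bigD1 i0) //= eqxx; congr (_ * _).
    by apply: eq_bigr => i /andP[_ /negPf ->].
  apply => [|i|i].
  - apply: leq_trans gn; apply: proper_card; apply/properP; split.
      apply/fintype.subsetP => i; rewrite !inE => /andP[iJ].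
      case: eqP => [_ /asboolPn[] //|_ ngi]; by rewrite iJ.
    exists i0; first by rewrite inE i0J; apply/asboolPn.
    by rewrite inE eqxx negb_and negbK; apply/orP; right; apply/asboolP.
  - by case: eqP.
  - case: eqP => [->|_] //.
    apply: (@all_moments_bounded _ _ _ _ _ 1); first exact: measurableT_comp.
    by move=> w; case: (h01 (X i0 w)) => ->; rewrite ?normr0 ?normr1.
have mI (B : set R) : measurable B -> measurable_fun setT (\1_B : R -> R) by move=> ?; exact: measurable_indic.
have I01 (B : set R) (x : R) : \1_B x = 0 :> R \/ \1_B x = 1 :> R.
  by rewrite indicE; case: (_ \in _); [right|left].
(* With the constant 1, an indicator, in place of the observable at [i0], the induction hypothesis
   factorizes [Z] itself. *)
have EZ : \int[P]_w Z w = \prod_(i in J | i != i0) \int[P]_w g i (X i w).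
  have := step \1_setT (mI _ measurableT) (I01 _).
  under eq_Rintegral do rewrite indicT mul1r.
  under [X in _ = X * _]eq_Rintegral do rewrite indicT.
  by rewrite Rintegral_cst // [X in fine X]probability_setT !mul1r.
transitivity (\int[P]_w (Z w * g i0 (X i0 w))).
  by apply: eq_Rintegral => w _; rewrite (bigD1 i0) //= mulrC.
rewrite (uncorrelated aZ (mX i0)) //.
  by rewrite EZ [in RHS](bigD1 i0) //= mulrC.
move=> B mB; rewrite EZ mulrC -(step _ (mI _ mB) (I01 B)).
by apply: eq_Rintegral => w _; rewrite mulrC.
Qed.

End Independence.

(** * Moments of tensor entries *)

Section TensorMoments.
Variables (R : realType) (p : nat) (d : nat -> measure_display)
  (Omega : forall N : nat, measurableType (d N))
  (P : forall N : nat, probability (Omega N) R)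
  (T : forall N : nat, p.-tuple 'I_N -> {RV (P N) >-> R}) (M : nat -> R).
Hypothesis p_gt1 : (1 < p)%N.
Hypothesis hw : heavy_wigner T M.

Lemma tensor_sort_edge N (t : p.-tuple 'I_N) w : T (sort_edge t) w = T t w.
Proof.
have /perm.tuple_permP[s e] : perm_eq (sort_edge t) t by rewrite perm_sort.
rewrite -(hw_symmetric hw t s w); congr (T _ w); exact/val_inj.
Qed.

Lemma all_moments_tensor N (t : p.-tuple 'I_N) : all_moments (P N) (T t).
Proof.
split=> [|k]; first exact: measurable_funPT.
exact (hw_moments hw t k).
Qed.

Definition entry_moment N (t : p.-tuple 'I_N) m := \int[P N]_w (T t w ^+ m).

Lemma scaled_momentE N m (t : p.-tuple 'I_N) :
  scaled_moment T m t = N%:R ^+ (p - 1) * entry_moment t m.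
Proof. by rewrite /scaled_moment unlock. Qed.

Definition config_product (S : finType) N (f : {ffun S * 'I_p -> 'I_N}) w :=
  \prod_(s : S) T (edge f s) w.

Lemma all_moments_config (S : finType) N (f : {ffun S * 'I_p -> 'I_N}) :
  all_moments (P N) (config_product f).
Proof. apply: all_moments_prod => s; exact: all_moments_tensor. Qed.

Definition config_mean (S : finType) N (f : {ffun S * 'I_p -> 'I_N}) :=
  \int[P N]_w config_product f w.

(** Grouping the steps by sorted tuple leaves powers of entries at distinct sorted indices, and
    these entries are independent. *)
Lemma config_meanE (S : finType) N (f : {ffun S * 'I_p -> 'I_N}) :
  config_mean f = \prod_(t in edge_classes f) entry_moment t (class_mult f t).
Proof.
rewrite -(@expectation_prod _ _ _ (P N) _ (fun t => T t : Omega N -> R) _ (edge_classes f)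
  (fun t x => x ^+ class_mult f t) (hw_independent hw (N:=N))).
- apply: eq_Rintegral => w _; rewrite /config_product.
  rewrite (partition_big (fun s => sort_edge (edge f s)) [in edge_classes f]) /=; last first.
    by move=> s _; apply/imsetP; exists s.
  apply: eq_bigr => t _; rewrite -prodr_const; apply: eq_big => s; first by rewrite inE.
  by move=> /eqP <-; rewrite tensor_sort_edge.
- by apply/fintype.subsetP => t /imsetP[s _ ->]; rewrite inE sorted_sort_edge.
- by move=> t; exact: measurable_funPT.
- by move=> t; exact: exprn_measurable.
- by move=> t; apply: all_momentsX; exact: all_moments_tensor.
Qed.

Lemma entry_moment1 N (t : p.-tuple 'I_N) : entry_moment t 1 = 0.
Proof.
have := hw_centered hw t; rewrite unlock /entry_moment /Rintegral => E0.
by rewrite [X in fine X](_ : _ = 0%E).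
Qed.

Lemma scaled_moment_le m : (2 <= m)%N ->
  exists2 C, 0 < C & \forall N \near \oo, forall t : p.-tuple 'I_N, scaled_moment T m t <= C.
Proof.
move=> m2; have /eqO_exP[C C0 near_le] := hw_bounded hw m2.
exists C => //; near=> N => t.
have : `|sup (range (@scaled_moment _ p d Omega P T N m))| <= C * `|1|.
  by near: N; exact: near_le.
rewrite normr1 mulr1; apply: le_trans; apply: le_trans (ler_norm _).
apply: ub_le_sup; last by exists t.
(* The range is finite, so the sum of the absolute values bounds it. *)
exists (\sum_(t : p.-tuple 'I_N) `|scaled_moment T m t|) => _ [u _ <-].
rewrite (bigD1 u) //=; apply: le_trans (ler_norm _) _.
by rewrite lerDl sumr_ge0.
Unshelve. all: end_near. Qed.

(** [hw_bounded] bounds the moments only from above, which says nothing about a very negative odd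
    moment. But |x|^m <= x^(m-1) + x^(m+1) for odd m, and m > 2 keeps the even order m - 1 at least
    2. *)
Lemma entry_moment_odd N (t : p.-tuple 'I_N) m : odd m -> (2 < m)%N ->
  `|entry_moment t m| <= entry_moment t m.-1 + entry_moment t m.+1.
Proof.
case: m => // m /= em m2; have i k : integ (P N) (fun w => T t w ^+ k).
  by case: (all_moments_tensor t) => _ /(_ k).
apply: le_trans (le_normr_Rintegral measurableT (i _)) _.
rewrite -(RintegralD measurableT (i _) (i _)); apply: le_Rintegral => //.
- exact (integrable_norm (i _)).
- exact: integD.
move=> w _; rewrite -[m](odd_double_half m) (negPf em) add0n.
move: (T t w) => x; rewrite -mul2n !exprS !exprM.
have y0 : 0 <= (x ^+ 2) ^+ m./2 by rewrite exprn_ge0 // sqr_ge0.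
rewrite normrM [`|_ ^+ m./2|]ger0_norm //.
move: (_ ^+ m./2) y0 => y y0.
have /andP[x1 x2] : (- (1 + x * x) <= x) && (x <= 1 + x * x).
  by have := sqr_ge0 (x - 1); have := sqr_ge0 (x + 1); move=> *; apply/andP; split; nra.
have : `|x| <= 1 + x * x by rewrite ler_norml x1 x2.
move: (`|x|) => z zx; nra.
Qed.

Lemma entry_moment_even_ge0 N (t : p.-tuple 'I_N) m : ~~ odd m -> 0 <= entry_moment t m.
Proof.
move=> em; apply: Rintegral_ge0 => w _; exact: exprn_even_ge0.
Qed.

Lemma entry_moment_bound1 m : (0 < m)%N -> exists2 C, 1 <= C &
  \forall N \near \oo, forall t : p.-tuple 'I_N, `|entry_moment t m| <= C / N%:R ^+ (p - 1).
Proof.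
case: m => // -[_|m _].
  by exists 1 => //; near=> N => t; rewrite entry_moment1 normr0 divr_ge0 // exprn_ge0.
have key N (t : p.-tuple 'I_N) k C : (0 < N)%N -> scaled_moment T k t <= C ->
    entry_moment t k <= C / N%:R ^+ (p - 1).
  move=> N0; rewrite scaled_momentE mulrC -ler_pdivlMr // exprn_gt0 // ltr0n //.
have [om|em] := boolP (odd m.+2); last first.
  have [C C0 nC] := @scaled_moment_le m.+2 isT.
  exists (1 + C); first by rewrite lerDl ltW.
  near=> N => t; rewrite ger0_norm ?entry_moment_even_ge0 //; apply: key.
    by near: N; exact: nbhs_infty_gt.
  apply: (@le_trans _ _ C); last by rewrite lerDr.
  by move: t; near: N; exact: nC.
have m2 : (2 < m.+2)%N by case: m om.
have [C C0 nC] := @scaled_moment_le m.+1 m2.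
have [D D0 nD] := @scaled_moment_le m.+3 isT.
exists (1 + C + D); first by rewrite -addrA lerDl addr_ge0 // ltW.
near=> N => t; apply: le_trans (entry_moment_odd t om m2) _ => /=.
have N0 : (0 < N)%N by near: N; exact: nbhs_infty_gt.
rewrite -addrA mulrDl mulrDl; apply: le_trans (_ : C / N%:R ^+ (p - 1) + D / N%:R ^+ (p - 1) <= _); last first.
  by rewrite lerDr divr_ge0 // exprn_ge0.
apply: lerD; apply: key => //; move: t; near: N; [exact: nC|exact: nD].
Unshelve. all: end_near. Qed.

Lemma entry_moment_bound K : exists2 C, 1 <= C &
  \forall N \near \oo, forall (t : p.-tuple 'I_N) m, (0 < m <= K)%N ->
    `|entry_moment t m| <= C / N%:R ^+ (p - 1).
Proof.
elim: K => [|K [C C1 nC]].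
  by exists 1 => //; near=> N => t m /andP[]; case: m.
have [D D1 nD] := @entry_moment_bound1 K.+1 isT.
exists (C + D); first by rewrite -[1]addr0 lerD // (le_trans ler01).
near=> N => t m /andP[m0]; rewrite leq_eqVlt => /predU1P[->|mK].
  apply: (@le_trans _ _ (D / N%:R ^+ (p - 1))); first by move: t; near: N; exact: nD.
  by rewrite ler_wpM2r ?invr_ge0 ?exprn_ge0 // lerDr (le_trans ler01).
apply: (@le_trans _ _ (C / N%:R ^+ (p - 1))).
  by move: t m m0 mK; near: N; apply: filterS nC => N nC t m m0 mK; apply: nC; rewrite m0.
by rewrite ler_wpM2r ?invr_ge0 ?exprn_ge0 // lerDl (le_trans ler01).
Unshelve. all: end_near. Qed.

Lemma class_mult_gt0 (S : finType) N (f : {ffun S * 'I_p -> 'I_N}) t :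
  t \in edge_classes f -> (0 < class_mult f t <= #|S|)%N.
Proof.
move=> /imsetP[s _ ->]; rewrite max_card andbT; apply/card_gt0P; exists s.
by rewrite inE.
Qed.

Lemma config_mean_bound (S : finType) : exists2 C, 1 <= C & \forall N \near \oo,
  forall f : {ffun S * 'I_p -> 'I_N},
    \prod_(t in edge_classes f) `|entry_moment t (class_mult f t)| <=
      C / N%:R ^+ ((p - 1) * #|edge_classes f|).
Proof.
have [C C1 nC] := entry_moment_bound #|S|.
exists (C ^+ #|S|); first exact: exprn_ege1.
near=> N => f.
apply: (@le_trans _ _ (\prod_(t in edge_classes f) (C / N%:R ^+ (p - 1)))).
  apply: ler_prod => t tf; rewrite normr_ge0 /=.
  have := class_mult_gt0 tf; move: t {tf} (class_mult f t).
  by near: N; exact: nC.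
rewrite prodr_const exprMn exprVn exprM ler_wpM2r ?invr_ge0 ?exprn_ge0 //.
(* There are at most #|S| classes, and [1 <= C] makes the largest exponent the worst. *)
by apply: ler_weXn2l => //; exact: leq_imset_card.
Unshelve. all: end_near. Qed.

End TensorMoments.

(** * Convergence of the normalized traces *)

Section Limits.
Variable R : realType.

Lemma cvg0_le_inv (a : nat -> R) C :
  (\forall N \near \oo, `|a N| <= C / N%:R) -> a @ \oo --> (0 : R).
Proof.
move=> h; apply/cvgr0Pnorm_lt => e e0; near=> N.
apply: (@le_lt_trans _ _ (C / N%:R)); first by near: N; exact: h.
rewrite ltr_pdivrMr ?ltr0n; last by near: N; exact: nbhs_infty_gt.
by rewrite mulrC -ltr_pdivrMr //; near: N; exact: nbhs_infty_gtr.
Unshelve. all: end_near. Qed.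

(** The ratio is the proportion of injections among the maps from n points to N points. *)
Lemma cvg_ffact_ratio n : (fun N => (N ^_ n)%:R / N%:R ^+ n) @ \oo --> (1 : R).
Proof.
elim: n => [|n IH].
  by under eq_fun do rewrite ffactn0 expr0 divr1; exact: cvg_cst.
have c1 : (fun N => (N - n)%:R / N%:R) @ \oo --> (1 : R).
  rewrite -[X in _ --> X]subr0; apply: cvg_trans (_ : (fun N => 1 - n%:R / N%:R) @ \oo `=>` _).
    apply: near_eq_cvg; near=> N.
    have N0 : (0 < N)%N by near: N; exact: nbhs_infty_gt.
    rewrite natrB; last by near: N; exact: nbhs_infty_ge.
    by rewrite mulrBl divff // pnatr_eq0 -lt0n.
  apply: cvgB; first exact: cvg_cst.
  apply: (@cvg0_le_inv _ n%:R); apply: nearW => N.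
  by rewrite ger0_norm // divr_ge0.
rewrite -[X in _ --> X]mulr1; under eq_fun do rewrite ffactnSr natrM exprSr invfM mulrACA.
exact: cvgM.
Unshelve. all: end_near. Qed.

(** One [dl] serves every [y]: the product is evaluated at all injections of the vertices
    simultaneously, and the moments converge uniformly in the index. *)
Lemma prod_close (I : eqType) (s : seq I) (L : I -> R) e : 0 < e ->
  exists2 dl, 0 < dl & forall y : I -> R, (forall i, i \in s -> `|y i - L i| < dl) ->
    `|\prod_(i <- s) y i - \prod_(i <- s) L i| < e.
Proof.
elim: s e => [|i s IH] e e0.
  by exists 1 => // y _; rewrite !big_nil subrr normr0.
set Q := \prod_(j <- s) L j.
have Li0 : 0 < `|L i| + 1 by rewrite ltr_wpDl.
have Q0 : 0 < `|Q| + 1 by rewrite ltr_wpDl.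
have [d1 d10 h1] := IH (e / (2 * (`|L i| + 1))) (divr_gt0 e0 (mulr_gt0 (ltr0n _ 2) Li0)).
(* Chosen for y_i Y - L_i Q = y_i (Y - Q) + (y_i - L_i) Q: the bound 1 gives |y_i| <= |L_i| + 1, and
   each term is then less than e / 2. *)
exists (Num.min (Num.min d1 1) (e / (2 * (`|Q| + 1)))).
  by rewrite !lt_min d10 ltr01 divr_gt0 // mulr_gt0.
move=> y ys; rewrite !big_cons -/Q; set Y := \prod_(j <- s) y j.
have /h1 YQ : forall j, j \in s -> `|y j - L j| < d1.
  by move=> j js; have := ys j; rewrite inE js orbT !lt_min -!andbA => /(_ isT) /andP[].
have := ys i; rewrite inE eqxx !lt_min => /(_ isT) /andP[/andP[_ y1]].
rewrite ltr_pdivlMr ?mulr_gt0 // => yQ; move: YQ; rewrite ltr_pdivlMr ?mulr_gt0 // => YQ.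
have -> : y i * Y - L i * Q = y i * (Y - Q) + (y i - L i) * Q by ring.
apply: le_lt_trans (ler_normD _ _) _; rewrite !normrM.
have yL : `|y i| <= `|L i| + 1.
  by rewrite -[y i](subrK (L i)) addrC; apply: le_trans (ler_normD _ _) _; rewrite lerD2l ltW.
move: yQ YQ; move: `|Y - Q| (normr_ge0 (Y - Q)) `|y i - L i| (normr_ge0 (y i - L i)) => u u0 v v0 yQ YQ.
have : `|y i| * u <= (`|L i| + 1) * u by rewrite ler_wpM2r.
have : v * `|Q| <= v * (`|Q| + 1) by rewrite ler_wpM2l // lerDl.
lra.
Qed.

End Limits.

Section ConfigLimits.
Variables (R : realType) (p : nat) (d : nat -> measure_display)
  (Omega : forall N : nat, measurableType (d N))
  (P : forall N : nat, probability (Omega N) R)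
  (T : forall N : nat, p.-tuple 'I_N -> {RV (P N) >-> R}) (M : nat -> R).
Hypothesis p_gt1 : (1 < p)%N.
Hypothesis hw : heavy_wigner T M.

Lemma card_injections n N : (#|[pred i : {ffun 'I_n -> 'I_N} | injectiveb i]| = N ^_ n)%N.
Proof. by rewrite -[in RHS](card_ord N) -[in RHS](card_ord n) -card_inj_ffuns; apply: eq_card => i; rewrite !inE. Qed.

Lemma ffact_le_exp n N : (N ^_ n <= N ^ n)%N.
Proof.
rewrite -card_injections; apply: leq_trans (max_card _) _.
by rewrite card_ffun !card_ord.
Qed.

Lemma config_mean_le (S : finType) : exists2 C, 1 <= C & \forall N \near \oo,
  forall f : {ffun S * 'I_p -> 'I_N},
    `|config_mean T f| <= C / N%:R ^+ ((p - 1) * #|edge_classes f|).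
Proof.
have [C C1 nC] := config_mean_bound hw S.
exists C => //; apply: filterS nC => N nC f.
by rewrite (config_meanE hw) normr_prod.
Qed.

Section FixedPattern.
Variables (k n : nat) (f : {ffun 'I_k.+1 * 'I_p -> 'I_n}).
Hypothesis f_chain : chain p_gt1 f.
Hypothesis f_onto : [set f x | x in {: 'I_k.+1 * 'I_p}]%SET == [set: 'I_n]%SET.

Let mean_sum N := N%:R^-1 * \sum_(i : {ffun 'I_n -> 'I_N} | injectiveb i) config_mean T (ffcomp i f).

(** There are at most N^n injections, each with a mean of order N^(-n), so the prefactor 1 / N
    survives. *)
Lemma pattern_limit_negligible :
  (forall N (i : {ffun 'I_n -> 'I_N}), injective i ->
     (n <= (p - 1) * #|edge_classes (ffcomp i f)|)%N) ->
  mean_sum @ \oo --> (0 : R).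
Proof.
move=> nle; have [C C1 nC] := config_mean_le 'I_k.+1.
apply: (@cvg0_le_inv _ _ C); near=> N.
have N0 : (0 < N)%N by near: N; exact: nbhs_infty_gt.
have N0R : 0 < N%:R :> R by rewrite ltr0n.
rewrite /mean_sum normrM ger0_norm ?invr_ge0 // mulrC ler_pM2r ?invr_gt0 //.
apply: le_trans (ler_norm_sum _ _ _) _.
apply: (@le_trans _ _ (\sum_(i : {ffun 'I_n -> 'I_N} | injectiveb i) C / N%:R ^+ n)).
  apply: ler_sum => i /injectiveP inji.
  apply: (@le_trans _ _ (C / N%:R ^+ ((p - 1) * #|edge_classes (ffcomp i f)|))).
    by move: (ffcomp i f); near: N; exact: nC.
  rewrite ler_pM2l ?(lt_le_trans ltr01) // lef_pV2 ?posrE ?exprn_gt0 //.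
  by apply: ler_weXn2l; [rewrite ler1n|exact: nle].
rewrite sumr_const card_injections -[(C / _) *+ _]mulr_natr mulrAC ler_pdivrMr ?exprn_gt0 //.
by rewrite ler_pM2l ?(lt_le_trans ltr01) // -natrX ler_nat ffact_le_exp.
Unshelve. all: end_near. Qed.

Hypothesis f_uniq : forall s, uniq (edge f s).
(** By this equation N^n is N times N^(p-1) for each hyperedge: dividing by N^n normalizes the sum
    over injections, accounts for the prefactor 1 / N and turns every moment into a scaled
    moment. *)
Hypothesis f_tree : n = (1 + (p - 1) * #|edge_sets f|)%N.

Lemma pattern_limit_tree : (forall e, e \in edge_sets f -> (1 < edge_mult f e)%N) ->
  mean_sum @ \oo --> \prod_(e in edge_sets f) M (edge_mult f e).
Proof.
move=> m2; set L := \prod_(e in _) _.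
pose y N (i : {ffun 'I_n -> 'I_N}) :=
  \prod_(e in edge_sets f) scaled_moment T (edge_mult f e) (class_of_edge_set i f e).
have sumE : \forall N \near \oo, mean_sum N = (N%:R ^+ n)^-1 *
    \sum_(i : {ffun 'I_n -> 'I_N} | injectiveb i) y N i.
  near=> N; have N0 : N%:R != 0 :> R by rewrite pnatr_eq0 -lt0n; near: N; exact: nbhs_infty_gt.
  rewrite /mean_sum !mulr_sumr; apply: eq_bigr => i /injectiveP inji.
  rewrite (config_meanE hw) (prod_edge_classes inji f_uniq (fun t m => entry_moment T t m)).
  rewrite /y; under [in RHS]eq_bigr do rewrite scaled_momentE.
  rewrite big_split /= prodr_const mulrA; congr (_ * _).
  have -> : N%:R ^+ n = N%:R * (N%:R ^+ (p - 1)) ^+ #|edge_sets f| :> R.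
    by rewrite -exprM -exprS; congr (_ ^+ _); rewrite -add1n.
  by rewrite invfM -mulrA mulVf ?mulr1 // !expf_neq0.
have yL e : 0 < e -> \forall N \near \oo,
    forall i : {ffun 'I_n -> 'I_N}, injective i -> `|y N i - L| < e.
  move=> e0; have [dl dl0 close] := prod_close (enum (edge_sets f)) (fun e => M (edge_mult f e)) e0.
  (* The hyperedges of the pattern are finitely many, so one threshold for N serves them all. *)
  have near_e : \forall N \near \oo, forall e0 : {e | e \in edge_sets f},
      forall t : p.-tuple 'I_N, sorted ltn (map val t) ->
      `|scaled_moment T (edge_mult f (val e0)) t - M (edge_mult f (val e0))| < dl.
    apply: filter_forall => -[e1 e1f]; exact (hw_limit hw (m2 e1 e1f) dl0).
  near=> N => i inji; rewrite /y /L -!big_enum; apply: close => e1; rewrite mem_enum => e1f.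
  have st := sorted_class_of_edge_set inji f_uniq e1.
  move: (class_of_edge_set i f e1) st => t st.
  rewrite -[e1]/(val (exist _ e1 e1f)); move: (exist _ _ _) t st.
  by near: N; exact: near_e.
rewrite -[L]mulr1; set b := fun N => L * ((N ^_ n)%:R / N%:R ^+ n).
have bL : b @ \oo --> L * 1 by apply: cvgM; [exact: cvg_cst|exact: cvg_ffact_ratio].
suff ab : (fun N => mean_sum N - b N) @ \oo --> (0 : R).
  rewrite -[L * 1]add0r; apply: cvg_trans (cvgD ab bL).
  by apply: near_eq_cvg; apply: nearW => N; rewrite /= subrK.
apply/cvgr0Pnorm_lt => e e0; near=> N.
have N0 : (0 < N)%N by near: N; exact: nbhs_infty_gt.
have N0R : 0 < N%:R ^+ n :> R by rewrite exprn_gt0 // ltr0n.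
have -> : mean_sum N = (N%:R ^+ n)^-1 * \sum_(i : {ffun 'I_n -> 'I_N} | injectiveb i) y N i.
  by near: N; exact: sumE.
have -> : b N = (N%:R ^+ n)^-1 * \sum_(i : {ffun 'I_n -> 'I_N} | injectiveb i) L.
  by rewrite sumr_const card_injections -[L *+ _]mulr_natr /b mulrA mulrC.
rewrite -mulrBr -sumrB normrM ger0_norm ?invr_ge0 ?ltW // mulrC ltr_pdivrMr //.
apply: le_lt_trans (ler_norm_sum _ _ _) _.
apply: (@le_lt_trans _ _ (\sum_(i : {ffun 'I_n -> 'I_N} | injectiveb i) e / 2)).
  apply: ler_sum => i /injectiveP inji; apply/ltW; move: i inji; near: N.
  by apply: yL; rewrite divr_gt0.
rewrite sumr_const card_injections -[_ *+ _]mulr_natr.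
apply: (@le_lt_trans _ _ (e / 2 * N%:R ^+ n)).
  by rewrite ler_pM2l ?divr_gt0 // -natrX ler_nat ffact_le_exp.
by rewrite ltr_pM2r // ltr_pdivrMr // mulr_natr mulr2n ltrDl.
Unshelve. all: end_near. Qed.

Lemma pattern_limit_simple e : e \in edge_sets f -> edge_mult f e = 1%N ->
  mean_sum @ \oo --> (0 : R).
Proof.
move=> ef e1; rewrite (_ : mean_sum = fun=> 0); first exact: cvg_cst.
apply/funext => N; rewrite /mean_sum big1 ?mulr0 // => i /injectiveP inji.
rewrite (config_meanE hw) (prod_edge_classes inji f_uniq (fun t m => entry_moment T t m)).
by rewrite (bigD1 e) //= e1 (entry_moment1 hw) mul0r.
Qed.

End FixedPattern.

(** A repeated entry or a strict vertex bound costs a factor N. In the equality case without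
    repeated entries, all the classes are strictly increasing, so the moments have limits, unless a
    hyperedge is used once and the mean vanishes. *)
Lemma pattern_limit (k n : nat) (f : {ffun 'I_k.+1 * 'I_p -> 'I_n}) : chain p_gt1 f ->
  [set f x | x in {: 'I_k.+1 * 'I_p}]%SET == [set: 'I_n]%SET ->
  (fun N => N%:R^-1 * \sum_(i : {ffun 'I_n -> 'I_N} | injectiveb i) config_mean T (ffcomp i f))
    @ \oo --> (if tree_config p_gt1 f then \prod_(e in edge_sets f) M (edge_mult f e) else 0).
Proof.
move=> ch onto; rewrite /tree_config ch onto /=.
have bound N (i : {ffun 'I_n -> 'I_N}) : injective i ->
    (n + ~~ [forall s, uniq (edge f s)] <= 1 + (p - 1) * #|edge_classes (ffcomp i f)|)%N.
  move=> inji; have chi : chain p_gt1 (ffcomp i f) by rewrite chain_ffcomp.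
  have := card_vertices_chain chi; rewrite card_vertices_ffcomp //; last exact/eqP.
  rewrite (_ : [forall s, uniq (edge (ffcomp i f) s)] = [forall s, uniq (edge f s)]) //.
  by apply: eq_forallb => s; rewrite uniq_edge_ffcomp.
have [/forallP un|nun] := boolP [forall s, uniq (edge f s)]; last first.
  apply: pattern_limit_negligible => N i /bound; by rewrite nun addn1 add1n ltnS.
case: eqP => [nE|nE] /=; last first.
  apply: pattern_limit_negligible => N i inji; have := bound N i inji.
  rewrite (introT forallP un) (card_edge_classes_ffcomp inji un) addn0 leq_eqVlt.
  by case/predU1P=> [/nE|]; rewrite // add1n ltnS.
case: (boolP [forall e in _, _]) => [/forall_inP m2|].
  exact: pattern_limit_tree.
rewrite negb_forall_in => /exists_inP[e ef em]; apply: (pattern_limit_simple un ef).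
have : (0 < edge_mult f e)%N.
  by case/imsetP: ef => s _ ->; apply/card_gt0P; exists s; rewrite inE.
by move: em; lia.
Qed.

End ConfigLimits.

Lemma cvg_sumr (R : realType) (I : Type) (s : seq I) (Q : pred I) (F : I -> nat -> R) (l : I -> R) :
  (forall i, Q i -> F i @ \oo --> l i) ->
  (fun N => \sum_(i <- s | Q i) F i N) @ \oo --> \sum_(i <- s | Q i) l i.
Proof.
move=> Fl; elim: s => [|i s IH].
  by rewrite big_nil; under eq_fun do rewrite big_nil; exact: cvg_cst.
rewrite big_cons; under eq_fun do rewrite big_cons.
by case: ifP => Qi //; apply: cvgD => //; exact: Fl.
Qed.

Lemma walk_sum_scale (R : realType) n k p (M M' : nat -> R) g (H : rooted_fat_hypergraph n k) :
  (0 < p)%N -> fat_hypertree p H -> (forall r, M' r = g ^+ r * M r) ->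
  walk_sum M' H = g ^+ k * walk_sum M H.
Proof.
move=> p0 tH M'E; rewrite /walk_sum mulr_sumr; apply: eq_bigr => w.
rewrite inE => /and3P[_ _ /forall_inP wH].
under eq_bigr do rewrite M'E; rewrite big_split /=; congr (_ * _).
rewrite -expr_sum; congr (_ ^+ _).
have [_ _ _ _ sk] := (fat_hypertreeP H p0).1 tH; rewrite -[RHS]sk.
by apply: eq_bigr => e /wH /eqP.
Qed.

Section TraceMoments.
Variables (R : realType) (p : nat) (d : nat -> measure_display)
  (Omega : forall N : nat, measurableType (d N))
  (P : forall N : nat, probability (Omega N) R)
  (T : forall N : nat, p.-tuple 'I_N -> {RV (P N) >-> R}) (M : nat -> R).
Hypothesis p_gt1 : (1 < p)%N.
Hypothesis hw : heavy_wigner T M.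

Definition tensor_matrix N (w : Omega N) : 'M[R]_N :=
  contracted_matrix (M 2%N) (fun t : p.-tuple 'I_N => T t w).

Definition spectral_moment k N (w : Omega N) := N%:R^-1 * \tr (tensor_matrix w ^+ k).

Let c : R := (Num.sqrt (M 2%N * (p - 2)`!%:R))^-1.

Lemma spectral_momentE k N (w : Omega N) : spectral_moment k.+1 w =
  c ^+ k.+1 * N%:R^-1 *
    \sum_(f : {ffun 'I_k.+1 * 'I_p -> 'I_N} | chain p_gt1 f) config_product T f w.
Proof.
rewrite /spectral_moment (@trace_contracted _ p N (fun t => T t w) p_gt1 _ c).
  by rewrite mulrCA mulrA.
by move=> a b; rewrite mxE.
Qed.

Lemma spectral_moment0 N (w : Omega N) : (0 < N)%N -> spectral_moment 0 w = 1.
Proof.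
by move=> N0; rewrite /spectral_moment expr0 mxtrace1 mulVf // pnatr_eq0 -lt0n.
Qed.

Lemma integ_config (S : finType) N (f : {ffun S * 'I_p -> 'I_N}) :
  integ (P N) (config_product T f).
Proof. exact (all_moments_integ (all_moments_config hw f)). Qed.

Lemma mean_spectral_moment k N : \int[P N]_w spectral_moment k.+1 w =
  c ^+ k.+1 * N%:R^-1 *
    \sum_(f : {ffun 'I_k.+1 * 'I_p -> 'I_N} | chain p_gt1 f) config_mean T f.
Proof.
under eq_Rintegral do rewrite spectral_momentE.
rewrite RintegralZl //; last by apply: integ_sum => f _; exact: integ_config.
by rewrite Rintegral_sum // => f _; exact: integ_config.
Qed.

Lemma cvg_mean_config k :
  (fun N => N%:R^-1 * \sum_(f : {ffun 'I_k.+1 * 'I_p -> 'I_N} | chain p_gt1 f) config_mean T f)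
    @ \oo --> ((p - 2)`! ^ k.+1)%:R * \sum_(n < (k.+1 * p).+1) (n`!%:R)^-1 *
      \sum_(H in fat_hypertrees n k.+1 p) walk_sum M H.
Proof.
rewrite mulr_sumr.
under [X in _ --> X]eq_bigr => n _.
  rewrite mulrCA -(sum_tree_config n k p_gt1 M).
  over.
(* Extension by 0 off the chains, so that [pattern_sum], which sums over all maps, applies. *)
pose G N (f : {ffun 'I_k.+1 * 'I_p -> 'I_N}) := if chain p_gt1 f then config_mean T f else 0.
have sumE N : N%:R^-1 * \sum_(f : {ffun 'I_k.+1 * 'I_p -> 'I_N} | chain p_gt1 f) config_mean T f =
    \sum_(n < (k.+1 * p).+1) (n`!%:R)^-1 *
    \sum_(f : {ffun 'I_k.+1 * 'I_p -> 'I_n} | [set f x | x in {: 'I_k.+1 * 'I_p}]%SET == [set: 'I_n]%SET)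
      (N%:R^-1 * \sum_(i : {ffun 'I_n -> 'I_N} | injectiveb i) G N (ffcomp i f)).
  rewrite big_mkcond (pattern_sum (G N)) mulr_sumr card_prod !card_ord.
  by apply: eq_bigr => n _; rewrite mulrCA -mulr_sumr.
rewrite (funext sumE).
apply: cvg_sumr => n _; apply: cvgM; first exact: cvg_cst.
rewrite [X in _ --> X](_ : _ = \sum_(f : {ffun 'I_k.+1 * 'I_p -> 'I_n} |
    [set f x | x in {: 'I_k.+1 * 'I_p}]%SET == [set: 'I_n]%SET)
    if tree_config p_gt1 f then \prod_(e in edge_sets f) M (edge_mult f e) else 0); last first.
  rewrite -big_mkcondr /=; apply: eq_bigl => f; rewrite andbC.
  by case: (boolP (tree_config p_gt1 f)) => // /and5P[_ ->].
apply: cvg_sumr => f onto; rewrite /G.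
have [ch|nch] := boolP (chain p_gt1 f); last first.
  rewrite /tree_config (negPf nch) /=.
  rewrite (_ : (fun N => _) = fun=> 0); first exact: cvg_cst.
  apply/funext => N; rewrite big1 ?mulr0 // => i /injectiveP inji.
  by rewrite chain_ffcomp // (negPf nch).
have := pattern_limit hw ch onto; rewrite (_ : (fun N => _) = fun N => N%:R^-1 *
  \sum_(i : {ffun 'I_n -> 'I_N} | injectiveb i) (if chain p_gt1 (ffcomp i f) then config_mean T (ffcomp i f) else 0)) //.
apply/funext => N; congr (_ * _); apply: eq_bigr => i /injectiveP inji.
by rewrite chain_ffcomp // ch.
Qed.

Lemma vertices_ffcomp (S : finType) n N (i : {ffun 'I_n -> 'I_N}) (f : {ffun S * 'I_p -> 'I_n}) :
  injective i -> [set f x | x in {: S * 'I_p}]%SET == [set: 'I_n]%SET ->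
  #|vertices (ffcomp i f)| = n.
Proof.
move=> inji /eqP fT; rewrite -[RHS]card_ord -cardsT -fT -(card_imset _ inji) -imset_comp.
by congr #|pred_of_set _|; apply: eq_imset => x; rewrite ffunE.
Qed.

(** A pattern with n vertices has at most N^n relabellings, each of weight N^(-n); the number of
    patterns does not depend on N. *)
Lemma sum_inv_vertices (S : finType) : exists2 C : R, 0 <= C &
  forall N, (0 < N)%N -> \sum_(f : {ffun S * 'I_p -> 'I_N}) (N%:R ^+ #|vertices f|)^-1 <= C.
Proof.
exists (\sum_(n < #|{: S * 'I_p}|.+1) (n`!%:R)^-1 *
  \sum_(f : {ffun S * 'I_p -> 'I_n} | [set f x | x in {: S * 'I_p}]%SET == [set: 'I_n]%SET) 1).
  by apply: sumr_ge0 => n _; rewrite mulr_ge0 ?invr_ge0 ?sumr_ge0.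
move=> N N0; rewrite pattern_sum; apply: ler_sum => n _.
rewrite ler_wpM2l ?invr_ge0 //; apply: ler_sum => f onto.
apply: (@le_trans _ _ (\sum_(i : {ffun 'I_n -> 'I_N} | injectiveb i) (N%:R ^+ n)^-1)).
  by apply: ler_sum => i /injectiveP inji; rewrite vertices_ffcomp.
rewrite sumr_const card_injections -[_ *+ _]mulr_natl ler_pdivrMr ?exprn_gt0 ?ltr0n //.
by rewrite mul1r -natrX ler_nat ffact_le_exp.
Qed.

Lemma config_mean_pair_disjoint k N (f g : {ffun 'I_k.+1 * 'I_p -> 'I_N}) :
  (edge_classes f :&: edge_classes g)%SET = finset.set0 ->
  config_mean T (pair_config f g) = config_mean T f * config_mean T g.
Proof.
move=> dis; rewrite !(config_meanE hw) edge_classes_pair.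
rewrite (eq_bigl [predU edge_classes f & edge_classes g]); last by move=> t; rewrite !inE.
rewrite bigU /=; last by rewrite -finset.setI_eq0 dis.
have multE t : class_mult (pair_config f g) t = (class_mult f t + class_mult g t)%N.
  rewrite /class_mult -!sum1dep_card big_sumType /=; congr (_ + _)%N.
    by apply: eq_bigl => s; rewrite edge_pairl.
  by apply: eq_bigl => s; rewrite edge_pairr.
have mult0 (h : {ffun 'I_k.+1 * 'I_p -> 'I_N}) t : t \notin edge_classes h -> class_mult h t = 0%N.
  move=> th; apply/eqP; rewrite cards_eq0; apply/eqP/setP => s; rewrite !inE.
  by apply: contraNF th => /eqP <-; apply/imsetP; exists s.
congr (_ * _); apply: eq_bigr => t tf; rewrite multE.
  rewrite (mult0 g) ?addn0 //; apply/negP => tg.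
  by have : t \in (edge_classes f :&: edge_classes g)%SET; [rewrite inE tf tg|rewrite dis inE].
rewrite (mult0 f) ?add0n //; apply/negP => tg.
by have : t \in (edge_classes f :&: edge_classes g)%SET; [rewrite inE tf tg|rewrite dis inE].
Qed.

(** If a class is shared, v vertices and E classes of the pair satisfy v <= 1 + (p - 1) E, so the
    joint mean is of order N^(1-v). The product of the means is no larger in order, because the two
    chains taken separately have at least E classes in total. *)
Lemma config_covariance_le k : exists2 C, 0 <= C & \forall N \near \oo,
  forall f g : {ffun 'I_k.+1 * 'I_p -> 'I_N}, chain p_gt1 f -> chain p_gt1 g ->
    `|config_mean T (pair_config f g) - config_mean T f * config_mean T g| <=
      C * N%:R * (N%:R ^+ #|vertices (pair_config f g)|)^-1.
Proof.
have [C C1 nC] := config_mean_le hw ('I_k.+1 + 'I_k.+1)%type.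
have [D D1 nD] := config_mean_le hw 'I_k.+1.
have C0 := le_trans ler01 C1; have D0 := le_trans ler01 D1.
exists (C + D * D); first by rewrite addr_ge0 // mulr_ge0.
near=> N => f g cf cg.
have N0 : (0 < N)%N by near: N; exact: nbhs_infty_gt.
have N1 : 1 <= N%:R :> R by rewrite ler1n.
have N0R : 0 < N%:R :> R by rewrite ltr0n.
have [dis|ndis] := eqVneq (edge_classes f :&: edge_classes g)%SET finset.set0.
  rewrite config_mean_pair_disjoint // subrr normr0.
  by rewrite mulr_ge0 ?invr_ge0 ?exprn_ge0 // mulr_ge0 // addr_ge0 // mulr_ge0.
have vle := card_vertices_pair cf cg ndis.
set v := #|vertices _| in vle *; set E := #|edge_classes (pair_config f g)| in vle *.
have NE : (N%:R ^+ ((p - 1) * E))^-1 <= N%:R * (N%:R ^+ v)^-1 :> R.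
  rewrite -ler_pdivrMl // -invfM -exprS lef_pV2 ?posrE ?exprn_gt0 //.
  by apply: ler_weXn2l => //; rewrite -add1n.
apply: le_trans (ler_normB _ _) _; rewrite -mulrA mulrDl; apply: lerD.
  apply: (@le_trans _ _ (C * (N%:R ^+ ((p - 1) * E))^-1)); last by rewrite ler_wpM2l.
  by rewrite /E; move: (pair_config f g); near: N; exact: nC.
rewrite normrM.
apply: (@le_trans _ _ ((D / N%:R ^+ ((p - 1) * #|edge_classes f|)) *
    (D / N%:R ^+ ((p - 1) * #|edge_classes g|)))).
  by apply: ler_pM => //; [move: f {cf ndis v E vle NE}|move: g {cg ndis v E vle NE}]; near: N; exact: nD.
rewrite mulrACA ler_wpM2l ?mulr_ge0 //; apply: le_trans NE.
rewrite -invfM -exprD lef_pV2 ?posrE ?exprn_gt0 //; apply: ler_weXn2l => //.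
by rewrite -mulnDr leq_mul2l /E edge_classes_pair cardsU leq_subr orbT.
Unshelve. all: end_near. Qed.

Lemma config_product_pair k N (f g : {ffun 'I_k.+1 * 'I_p -> 'I_N}) w :
  config_product T (pair_config f g) w = config_product T f w * config_product T g w.
Proof.
rewrite /config_product big_sumType /=; congr (_ * _).
  by apply: eq_bigr => s _; rewrite edge_pairl.
by apply: eq_bigr => s _; rewrite edge_pairr.
Qed.

Lemma integ_spectral_moment k N : integ (P N) (spectral_moment k (N:=N)).
Proof.
case: k => [|k].
  rewrite (_ : spectral_moment 0 (N:=N) = fun=> N%:R^-1 * N%:R).
    exact/all_moments_integ/all_moments_cst.
  by apply/funext => w; rewrite /spectral_moment expr0 mxtrace1.
rewrite (_ : spectral_moment k.+1 (N:=N) = fun w => c ^+ k.+1 * N%:R^-1 *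
    \sum_(f : {ffun 'I_k.+1 * 'I_p -> 'I_N} | chain p_gt1 f) config_product T f w).
  by apply/integZ/integ_sum => f _; exact: integ_config.
by apply/funext => w; exact: spectral_momentE.
Qed.

Lemma spectral_moment_sqr k N (w : Omega N) : spectral_moment k.+1 w ^+ 2 =
  (c ^+ k.+1 * N%:R^-1) ^+ 2 *
    \sum_(f : {ffun 'I_k.+1 * 'I_p -> 'I_N} | chain p_gt1 f)
    \sum_(g : {ffun 'I_k.+1 * 'I_p -> 'I_N} | chain p_gt1 g) config_product T (pair_config f g) w.
Proof.
rewrite spectral_momentE exprMn; congr (_ * _); rewrite expr2 mulr_suml.
apply: eq_bigr => f _; rewrite mulr_sumr; apply: eq_bigr => g _.
by rewrite config_product_pair.
Qed.

Lemma integ_spectral_moment_sqr k N : integ (P N) (fun w => spectral_moment k (N:=N) w ^+ 2).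
Proof.
case: k => [|k].
  rewrite (_ : (fun w => _) = fun=> (N%:R^-1 * N%:R) ^+ 2).
    exact/all_moments_integ/all_moments_cst.
  by apply/funext => w; rewrite /spectral_moment expr0 mxtrace1.
rewrite (funext (@spectral_moment_sqr k N)).
by apply/integZ/integ_sum => f _; apply/integ_sum => g _; exact: integ_config.
Qed.

(** The prefactor N^(-2), the factor N in the covariance bound and the bounded sum of N^(-v) leave a
    variance of order 1 / N. *)
Lemma cvg_variance k : (fun N => \int[P N]_w (spectral_moment k.+1 w ^+ 2) -
  (\int[P N]_w spectral_moment k.+1 w) ^+ 2) @ \oo --> (0 : R).
Proof.
have [C C0 nC] := config_covariance_le k.
have [D D0 hD] := sum_inv_vertices ('I_k.+1 + 'I_k.+1)%type.
apply: (@cvg0_le_inv _ _ ((c ^+ k.+1) ^+ 2 * (C * D))); near=> N.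
have N0 : (0 < N)%N by near: N; exact: nbhs_infty_gt.
have N0R : 0 < N%:R :> R by rewrite ltr0n.
under eq_Rintegral do rewrite spectral_moment_sqr.
rewrite RintegralZl //; last first.
  by apply: integ_sum => f _; apply: integ_sum => g _; exact: integ_config.
rewrite Rintegral_sum => [|f _]; last by apply: integ_sum => g _; exact: integ_config.
rewrite (eq_bigr (fun f => \sum_(g | chain p_gt1 g) config_mean T (pair_config f g))); last first.
  by move=> f _; rewrite Rintegral_sum // => g _; exact: integ_config.
rewrite mean_spectral_moment [X in _ - X]exprMn -mulrBr normrM ger0_norm ?sqr_ge0 //.
rewrite exprMn -[leLHS]mulrA -[leRHS]mulrA; apply: ler_wpM2l; first exact: sqr_ge0.
rewrite -ler_pdivlMl ?exprn_gt0 ?invr_gt0 //.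
rewrite expr2 mulr_suml -sumrB.
apply: (@le_trans _ _ (\sum_(f : {ffun 'I_k.+1 * 'I_p -> 'I_N} | chain p_gt1 f)
    \sum_(g : {ffun 'I_k.+1 * 'I_p -> 'I_N} | chain p_gt1 g)
    C * N%:R * (N%:R ^+ #|vertices (pair_config f g)|)^-1)).
  apply: le_trans (ler_norm_sum _ _ _) _; apply: ler_sum => f cf.
  rewrite mulr_sumr -sumrB; apply: le_trans (ler_norm_sum _ _ _) _; apply: ler_sum => g cg.
  by move: f g cf cg; near: N; exact: nC.
under eq_bigr do rewrite -mulr_sumr; rewrite -mulr_sumr.
have -> : (N%:R^-1 ^+ 2)^-1 * (C * D / N%:R) = C * N%:R * D by field; rewrite gt_eqF.
rewrite ler_wpM2l ?mulr_ge0 //; apply: le_trans (hD N N0).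
(* Pairs of chains inject into all maps on the doubled set of steps, whose terms are nonnegative. *)
pose h (fg : {ffun 'I_k.+1 * 'I_p -> 'I_N} * {ffun 'I_k.+1 * 'I_p -> 'I_N}) := pair_config fg.1 fg.2.
have hinj : injective h.
  move=> [f g] [f' g'] /ffunP e; congr pair; apply/ffunP => -[s l].
    by have := e (inl s, l); rewrite !ffunE.
  by have := e (inr s, l); rewrite !ffunE.
rewrite pair_big /=.
apply: (@le_trans _ _ (\sum_(F in [set h x | x in predT]%SET) (N%:R ^+ #|vertices F|)^-1)).
  rewrite big_imset /=; last by move=> x y _ _; exact: hinj.
  rewrite [leLHS]big_mkcond /=; apply: ler_sum => x _; case: ifP => // _.
rewrite big_mkcond; apply: ler_sum => F _; case: ifP => // _.
Unshelve. all: end_near. Qed.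

Section Eta.
Hypothesis M2_gt0 : 0 < M 2%N.
Let M' r : R := ((p - 2)`!%:R `^ (r%:R / 2)) * M r / (M 2%N `^ (r%:R / 2)).

Lemma cvg_mean k : (fun N => \int[P N]_w spectral_moment k w) @ \oo --> eta p M' k.
Proof.
case: k => [|k].
  rewrite [X in _ --> X]/=; apply: cvg_trans (_ : (fun=> 1) @ \oo `=>` _); last exact: cvg_cst.
  apply: near_eq_cvg; near=> N.
  have N0 : (0 < N)%N by near: N; exact: nbhs_infty_gt.
  under eq_Rintegral do rewrite spectral_moment0 //.
  by rewrite Rintegral_cst // [X in fine X]probability_setT mulr1.
have p0 := ltnW p_gt1.
have F0 : 0 < (p - 2)`!%:R :> R by rewrite ltr0n fact_gt0.
pose g : R := Num.sqrt (p - 2)`!%:R / Num.sqrt (M 2%N).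
have M'E r : M' r = g ^+ r * M r.
  rewrite /M' [r%:R / 2]mulrC !powRrM !powR12_sqrt ?ltW // !powR_mulrn ?sqrtr_ge0 //.
  by rewrite mulrAC expr_div_n.
(* Each step contributes the normalization [c] and (p - 2)! orderings; their product is the factor
   [g] by which M' rescales M. *)
have cg : c * (p - 2)`!%:R = g.
  rewrite /c /g sqrtrM ?ltW // -[X in _ * X](sqr_sqrtr (ltW F0)).
  by field; rewrite !gt_eqF ?sqrtr_gt0.
rewrite eta_labelled //.
rewrite [X in _ --> X](_ : _ = c ^+ k.+1 * (((p - 2)`! ^ k.+1)%:R *
    \sum_(n < (k.+1 * p).+1) (n`!%:R)^-1 * \sum_(H in fat_hypertrees n k.+1 p) walk_sum M H)).
  under eq_fun do rewrite mean_spectral_moment -mulrA.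
  by apply: cvgM; [exact: cvg_cst|exact: cvg_mean_config].
rewrite mulrA natrX -exprMn cg [RHS]mulr_sumr; apply: eq_bigr => n _.
rewrite [RHS]mulrCA; congr (_ * _); rewrite mulr_sumr; apply: eq_bigr => H.
by rewrite inE => /asboolP tH; rewrite (walk_sum_scale p0 tH M'E).
Unshelve. all: end_near. Qed.

End Eta.
End TraceMoments.

(** * Quantile functions and the moment method *)

Section HellySelection.
Variable R : realType.

(** The limit is the supremum of the thresholds that the sequence reaches on a set in [U]. For a
    threshold beyond it, the ultrafilter contains the complementary set. *)
Lemma ultrafilter_limit (U : set_system nat) (x : nat -> R) B : UltraFilter U ->
  (forall n, `|x n| <= B) -> exists y, forall e, 0 < e -> U [set n | `|x n - y| < e].
Proof.
move=> UU xB; pose E := [set c | U [set n | c <= x n]].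
have supE : has_sup E.
  split; [exists (- B)|exists B].
    by apply: filterS (@filterT _ U _) => n _ /=; have := xB n; rewrite ler_norml => /andP[].
  move=> c /filter_ex[n /= cx]; apply: le_trans cx _.
  by have := xB n; rewrite ler_norml => /andP[].
exists (sup E) => e e0.
have [c Ec ce] := sup_adherent e0 supE.
have U2 : U [set n | x n < sup E + e].
  have [//|h] := in_ultra_setVsetC [set n | x n < sup E + e] UU.
  have : E (sup E + e).
    by apply: filterS h => n /= /negP; rewrite -leNgt.
  by move/(sup_upper_bound supE); rewrite gerDl leNgt e0.
apply: filterS2 Ec U2 => n /= cn ne; rewrite ltr_norml; apply/andP; split.
  by rewrite ltrBrDl (lt_le_trans ce).
by rewrite ltrBlDl.
Qed.

(* The limit along an ultrafilter at the rational points is realized by a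
   subsequence; between the rational points monotonicity controls everything
   except at the countably many jumps. *)
Lemma helly_selection (q : nat -> R -> R) (B : R -> R) :
  (forall n (u v : R), 0 < u -> u <= v -> v < 1 -> q n u <= q n v) ->
  (forall n (u : R), 0 < u < 1 -> `|q n u| <= B u) ->
  exists (sg : nat -> nat) (Q : R -> R) (J : set R),
    [/\ forall j, (j <= sg j)%N, forall u v : R, 0 < u -> u <= v -> v < 1 -> Q u <= Q v,
        countable J & forall u : R, 0 < u < 1 -> ~ J u -> q (sg j) u @[j --> \oo] --> Q u].
Proof.
move=> nd bd.
have [U [UU ooU]] := ultraFilterLemma (_ : ProperFilter (\oo : set_system nat)).
have UP : ProperFilter U by exact: ultra_proper.
have UF : Filter U by exact: filter_filter.
have ylim (r : rat) : exists y : R, 0 < (ratr r : R) < 1 ->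
    forall e : R, 0 < e -> U [set n | `|q n (ratr r) - y| < e].
  have [r01|r01] := boolP (0 < (ratr r : R) < 1); last by exists 0.
  by have [y hy] := ultrafilter_limit UU (fun n => bd n _ r01); exists y.
have {ylim}[y hy] := choice ylim.
(* Index [sg j] is at least j and good for all rationals with code less than j, finitely many
   conditions that all hold on sets in [U]. *)
have sgP j : exists n, (j <= n)%N /\ forall r : rat, (pickle r < j)%N -> 0 < (ratr r : R) < 1 ->
    `|q n (ratr r) - y r| < j.+1%:R^-1.
  have Uj : U [set n | forall i : 'I_j, forall r : rat, unpickle i = Some r -> 0 < (ratr r : R) < 1 ->
      `|q n (ratr r) - y r| < j.+1%:R^-1].
    apply: filter_forall => i; case: (unpickle i) => [r|]; last by apply: nearW.
    have [r01|r01] := boolP (0 < (ratr r : R) < 1); last first.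
      by apply: nearW => n r' [<-] h; case: (negP r01 h).
    by apply: filterS (hy r r01 j.+1%:R^-1 _) => [n hn r' [<-] _|]; rewrite ?invr_gt0.
  have Uge : U [set n | (j <= n)%N] by apply: ooU; exact: nbhs_infty_ge.
  have UI := @filterI _ U UF _ _ Uj Uge.
  have [n [hn jn]] := filter_ex UI; exists n; split => // r rj.
  by apply: (hn (Ordinal rj)); rewrite /= pickleK.
have {sgP}[sg sgP] := choice sgP.
have sg_cvg (r : rat) : 0 < (ratr r : R) < 1 -> forall e, 0 < e ->
    \forall j \near \oo, `|q (sg j) (ratr r) - y r| < e.
  move=> r01 e e0; near=> j.
  have rj : (pickle r < j)%N by near: j; exact: nbhs_infty_gt.
  apply: lt_trans ((sgP j).2 r rj r01) _.
  by near: j; exact: near_infty_natSinv_lt (PosNum e0).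
have ymono r r' : 0 < (ratr r : R) -> (ratr r : R) <= ratr r' -> (ratr r' : R) < 1 -> y r <= y r'.
  move=> r0 rr' r1; apply/ler_addgt0Pl => e e0.
  have e20 : 0 < e / 2 by rewrite divr_gt0.
  have h1 := sg_cvg r (introT andP (conj r0 (le_lt_trans rr' r1))) _ e20.
  have h2 := sg_cvg r' (introT andP (conj (lt_le_trans r0 rr') r1)) _ e20.
  have hI := @filterI _ _ eventually_filter _ _ h1 h2.
  have [j [/= a b]] := filter_ex hI.
  have := nd (sg j) _ _ r0 rr' r1; move: a b; rewrite !ltr_norml => /andP[a1 a2] /andP[b1 b2] ?.
  lra.
pose L (u : R) := [set y r | r in [set r : rat | 0 < (ratr r : R) < u]].
have between (u v : R) : u < v -> exists r : rat, u < ratr r < v.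
  by move=> uv; have [r] := rat_in_itvoo uv; rewrite in_itv; exists r.
have Lne (u : R) : 0 < u -> L u !=set0.
  by move=> /between[r ?]; exists (y r), r.
have Lub (u : R) r : 0 < u -> u <= ratr r -> (ratr r : R) < 1 -> ubound (L u) (y r).
  move=> u0 ur r1 _ [r' /= /andP[r'0 r'u] <-]; apply: ymono => //.
  exact: ltW (lt_le_trans r'u ur).
have Lsup (u : R) : 0 < u < 1 -> has_sup (L u).
  move=> /andP[u0 u1]; split; first exact: Lne.
  by have [r /andP[ur r1]] := between _ _ u1; exists (y r); apply: Lub => //; exact: ltW.
pose Q (u : R) := sup (L u).
have QleY (u : R) r : 0 < u -> u <= ratr r -> (ratr r : R) < 1 -> Q u <= y r.
  by move=> u0 ur r1; apply: ge_sup; [exact: Lne|exact: Lub].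
have YleQ (u : R) r : 0 < (ratr r : R) -> ratr r < u -> u < 1 -> y r <= Q u.
  move=> r0 ru u1; apply: sup_upper_bound; first by apply: Lsup; rewrite (lt_trans r0 ru).
  by exists r => //=; rewrite r0.
(* The jumps: a fixed gap separates [Q u] from the limits at all rational points to the right of
   [u]. *)
pose J := [set u : R | 0 < u < 1 /\ exists e : R, 0 < e /\ forall r : rat, u < (ratr r : R) < 1 -> Q u + e < y r].
exists sg, Q, J; split.
- by move=> j; exact: (sgP j).1.
- move=> u v u0 uv v1; move: uv; rewrite le_eqVlt => /predU1P[-> //|uv].
  have [r /andP[ur rv]] := between _ _ uv.
  apply: le_trans (QleY _ _ u0 (ltW ur) (lt_trans rv v1)) _.
  by apply: YleQ => //; exact: lt_trans ur.
(* Each jump contains a rational value, and by monotonicity distinct jumps contain distinct ones. *)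
- have tP (u : R) : exists t : rat, J u -> Q u < ratr t /\ forall r : rat, u < (ratr r : R) < 1 -> ratr t < y r.
    have [[u01 [e [e0 he]]]|nJ] := pselect (J u); last by exists 0%Q.
    have [t /andP[t1 t2]] := between (Q u) (Q u + e) (ltr_pwDr e0 (lexx _)).
    by exists t => _; split => // r /he; exact: lt_trans.
  have [t ht] := choice tP.
  apply/countable_injP; exists (fun u => pickle (t u)) => u v /set_mem Ju /set_mem Jv.
  move=> /(pcan_inj pickleK) tuv; have [Qu hu] := ht u Ju; have [Qv hv] := ht v Jv.
  have [/andP[u0 u1] _] := Ju; have [/andP[v0 v1] _] := Jv.
  have aux (a b : R) : 0 < a -> b < 1 -> Q b < ratr (t b) -> (forall r : rat, a < (ratr r : R) < 1 -> ratr (t a) < y r) ->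
      t a = t b -> a < b -> False.
    move=> a0 b1 Qb ha tab ab; have [r /andP[ar rb]] := between _ _ ab.
    have := ha r; rewrite ar (lt_trans rb b1) => /(_ isT) tr.
    have := YleQ b r (lt_trans a0 ar) rb b1; rewrite leNgt (lt_trans Qb) // -tab //.
  have [uv|vu|//] := ltgtP u v; first by case: (aux u v).
  by case: (aux v u).
move=> u /andP[u0 u1] nJ; apply/cvgrPdist_lt => e e0.
have e20 : 0 < e / 2 by rewrite divr_gt0.
(* Off the jumps, [q (sg j) u] is squeezed between its values at rationals r < u < r' whose limits
   are within e / 2 of [Q u]. *)
have [_ [r /= /andP[r0 ru] <-] rQ] := sup_adherent e20 (Lsup u (introT andP (conj u0 u1))).
have [r' [/andP[ur' r'1] yr']] : exists r' : rat, u < (ratr r' : R) < 1 /\ y r' <= Q u + e / 2.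
  apply: contrapT => h; apply: nJ; split; first by rewrite u0.
  exists (e / 2); split => // r' ur'; rewrite ltNge; apply/negP => yr'.
  by apply: h; exists r'.
have h1 := sg_cvg r (introT andP (conj r0 (lt_trans ru u1))) _ e20.
have h2 := sg_cvg r' (introT andP (conj (lt_trans u0 ur') r'1)) _ e20.
apply: filterS2 h1 h2 => j; rewrite !ltr_norml => /andP[a1 a2] /andP[b1 b2].
have c1 := nd (sg j) _ _ r0 (ltW ru) u1.
have c2 := nd (sg j) _ _ u0 (ltW ur') r'1.
by move: rQ yr'; rewrite -/(Q u) => rQ yr'; apply/andP; split; lra.
Unshelve. all: end_near. Qed.

End HellySelection.

(** * An integrable envelope on the unit interval *)

Section InverseSqrt.
Variable R : realType.
Local Notation lebesgue := (@lebesgue_measure R).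

Definition inv_sqrt_ends (u : R) := u `^ (- 2^-1) + (1 - u) `^ (- 2^-1).

Lemma inv_sqrt_ends_ge0 u : 0 <= inv_sqrt_ends u.
Proof. by rewrite addr_ge0 // powR_ge0. Qed.

Lemma is_derive_powR_onem (u a : R) : 0 < 1 - u ->
  is_derive u 1 (fun x => (1 - x) `^ a) (- (a * (1 - u) `^ (a - 1))).
Proof.
move=> v0; have := @is_derive1_comp _ (fun x : R => x `^ a) (fun x : R => 1 - x) u _ _ (is_derive1_powR a v0) _.
move=> /(_ (-1)); rewrite mulrN1; apply.
by apply: is_derive_eq; rewrite add0r mul1r.
Qed.

Lemma is_derive_primitive (u : R) : 0 < u < 1 ->
  is_derive u 1 (fun x => 2 * x `^ 2^-1 - 2 * (1 - x) `^ 2^-1) (inv_sqrt_ends u).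
Proof.
move=> /andP[u0 u1]; have v0 : 0 < 1 - u by rewrite subr_gt0.
have d1 := is_derive1_powR 2^-1 u0; have d2 := is_derive_powR_onem 2^-1 v0.
have d3 := is_deriveB (is_deriveZ (2 : R) d1) (is_deriveZ (2 : R) d2).
refine (is_derive_eq d3 _).
have -> : 2^-1 - 1 = - 2^-1 :> R by lra.
rewrite /GRing.scale /= mulrN opprK !mulrA divff ?mul1r //.
Qed.

(** The primitive 2 sqrt(x) - 2 sqrt(1 - x) takes its values between -2 and 2, whence the constant
    4, uniform in the end points. *)
Lemma integral_inv_sqrt_ends (a b : R) : 0 < a -> a < b -> b < 1 ->
  (\int[lebesgue]_(x in `[a, b]) (inv_sqrt_ends x)%:E <= 4%:E)%E.
Proof.
move=> a0 ab b1.
have ab01 (x : R) : a <= x <= b -> 0 < x < 1.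
  by move=> /andP[ax xb]; rewrite (lt_le_trans a0) // (le_lt_trans xb).
have cF : forall x : R, 0 < x < 1 -> {for x, continuous (fun x => 2 * x `^ 2^-1 - 2 * (1 - x) `^ 2^-1)}.
  move=> x x01; have [+ _] := is_derive_primitive x01.
  by move=> /derivable1_diffP /differentiable_continuous.
rewrite (@continuous_FTC2 _ _ (fun x => 2 * x `^ 2^-1 - 2 * (1 - x) `^ 2^-1)) //.
- rewrite -EFinB lee_fin.
  have s1 (x : R) : 0 <= x -> x <= 1 -> 0 <= x `^ 2^-1 <= 1.
    by move=> x0 x1; rewrite powR_ge0 powR12_sqrt // -sqrtr1 ler_wsqrtr.
  have /s1/(_ (ltW b1)) /andP[_ ?] := ltW (lt_trans a0 ab).
  have /andP[_ ?] : 0 <= (1 - a) `^ 2^-1 <= 1.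
    by apply: s1; [rewrite subr_ge0 ltW // (lt_trans ab)|rewrite gerBl ltW].
  by have := powR_ge0 (1 - b) 2^-1; have := powR_ge0 a 2^-1; move=> *; lra.
- apply: continuous_in_subspaceT => x /set_mem /=; rewrite in_itv /= => /ab01 /andP[x0 x1].
  have v0 : 0 < 1 - x by rewrite subr_gt0.
  apply: cvgD.
    have [+ _] := is_derive1_powR (- 2^-1) x0.
    by move=> /derivable1_diffP/differentiable_continuous.
  have [+ _] := is_derive_powR_onem (- 2^-1) v0.
  by move=> /derivable1_diffP/differentiable_continuous.
- split.
  + move=> x xab; have : is_derive x 1 (fun x => 2 * x `^ 2^-1 - 2 * (1 - x) `^ 2^-1) (inv_sqrt_ends x).
      by apply/is_derive_primitive/ab01; move: xab; rewrite in_itv /= => /andP[/ltW -> /ltW ->].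
    by case.
  + by apply: cvg_at_right_filter; apply: cF; apply: ab01; rewrite lexx ltW.
  + by apply: cvg_at_left_filter; apply: cF; apply: ab01; rewrite lexx ltW.
- move=> x xab; rewrite derive1E.
  have dx : is_derive x 1 (fun x => 2 * x `^ 2^-1 - 2 * (1 - x) `^ 2^-1) (inv_sqrt_ends x).
    by apply/is_derive_primitive/ab01; move: xab; rewrite in_itv /= => /andP[/ltW -> /ltW ->].
  exact: derive_val.
Qed.

Lemma measurable_inv_sqrt_ends : measurable_fun setT inv_sqrt_ends.
Proof.
apply: measurable_funD; first exact: measurable_powR.
apply: (measurableT_comp (measurable_powR _)) => //.
by apply: measurable_funB.
Qed.

Definition unif01 : probability (measurableTypeR R) R := uniform_prob (@ltr01 R).

Lemma unif01E (U : set R) : measurable U -> unif01 U = lebesgue (U `&` `[0, 1]).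
Proof.
move=> mU; have := @integral_uniform _ _ _ (@ltr01 R) (EFin \o \1_U).
rewrite subr0 invr1 mul1e /= => h.
rewrite -[in LHS](setIT U) -(integral_indic unif01 measurableT mU) h.
- by rewrite integral_indic.
- by apply/measurable_EFinP; exact: measurable_indic.
- by move=> x; rewrite lee_fin.
Qed.

Lemma integ_inv_sqrt_ends : integ unif01 inv_sqrt_ends.
Proof.
have mG := measurable_inv_sqrt_ends.
apply/integrableP; split; first exact/measurable_EFinP.
have -> : (\int[unif01]_x `|(EFin \o inv_sqrt_ends) x| =
    \int[unif01]_x (inv_sqrt_ends x)%:E)%E.
  by apply: eq_integral => x _; rewrite /= ger0_norm // inv_sqrt_ends_ge0.
rewrite integral_uniform; last 2 first.
- exact/measurable_EFinP.
- by move=> x; rewrite lee_fin inv_sqrt_ends_ge0.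
rewrite subr0 invr1 mul1e.
have -> : (\int[lebesgue]_(x in `[0%R, 1%R]) (inv_sqrt_ends x)%:E =
    \int[lebesgue]_(x in `]0%R, 1%R[) (inv_sqrt_ends x)%:E)%E.
  rewrite integral_itv_bndo_bndc ?integral_itv_obnd_cbnd //;
    by apply/measurable_EFinP; exact: measurable_funTS.
(* The shift by 3 makes 1 / (n + 3) < 1 / 2, so every interval is nondegenerate. *)
pose F n := `[n.+3%:R^-1 : R, 1 - n.+3%:R^-1]%classic.
have -> : `]0%R, 1%R[%classic = \bigcup_n F n.
  apply/seteqP; split => [x /=|x [n _]]; rewrite /F /= !in_itv /=.
    move=> /andP[x0 x1].
    have [n hn] : exists n, n.+3%:R^-1 <= Num.min x (1 - x).
      have m0 : 0 < Num.min x (1 - x) by rewrite lt_min x0 subr_gt0.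
      have [n hn] := ltr_add_invr (y := 0) m0.
      exists n; apply: le_trans (ltW hn); rewrite add0r lef_pV2 ?posrE ?ltr0n // ler_nat.
      by rewrite ltnS (leq_trans _ (leqnSn _)).
    exists n => //=; rewrite in_itv /=; move: hn; rewrite le_min => /andP[-> hn] /=.
    by rewrite lerBrDr -lerBrDl.
  move=> /andP[a b]; rewrite (lt_le_trans _ a) ?invr_gt0 //=.
  by rewrite (le_lt_trans b) // gtrBl invr_gt0.
have c : (\int[lebesgue]_(x in F n) (inv_sqrt_ends x)%:E @[n --> \oo] -->
    \int[lebesgue]_(x in \bigcup_n F n) (inv_sqrt_ends x)%:E)%E.
  apply: ge0_nondecreasing_set_cvg_integral.
  - move=> m n mn; apply/subsetPset => x; rewrite /F /= !in_itv /= => /andP[a b].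
    have mn' : n.+3%:R^-1 <= m.+3%:R^-1 :> R by rewrite lef_pV2 ?posrE ?ltr0n // ler_nat !ltnS.
    by rewrite (le_trans mn' a) (le_trans b) // lerD2l lerN2.
  - by move=> n; exact: measurable_itv.
  - by move=> n; apply/measurable_EFinP; exact: measurable_funTS.
  - by move=> n x _; rewrite lee_fin inv_sqrt_ends_ge0.
rewrite -(cvg_lim _ c) //.
apply: (@le_lt_trans _ _ 4%:E); last by rewrite ltry.
apply: lime_le; first by apply/cvg_ex; eexists; exact: c.
near=> n; apply: integral_inv_sqrt_ends.
- by rewrite invr_gt0.
- have : n.+3%:R^-1 < 2^-1 :> R by rewrite ltf_pV2 ?posrE ?ltr0n // ltr_nat.
  by move: (n.+3%:R^-1) => y; lra.
- by rewrite gtrBl invr_gt0.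
Unshelve. all: end_near. Qed.

End InverseSqrt.

(** * Quantile functions of finite sorted lists *)

Section Quantiles.
Variable R : realType.
Local Notation lebesgue := (@lebesgue_measure R).
Implicit Types (s : seq R) (f : R -> R).

Definition emean f s := (size s)%:R^-1 * \sum_(x <- s) f x.

Let slot s i : set R := [set` `[i%:R / (size s)%:R, i.+1%:R / (size s)%:R[%R].

Definition quantile s (u : R) := \sum_(i < size s) s`_i * \1_(slot s i) u.

Lemma slotP s u : s != [::] -> 0 <= u < 1 ->
  exists2 i : 'I_(size s), i%:R <= (size s)%:R * u < i.+1%:R & forall j : 'I_(size s), (\1_(slot s j) u : R) = (j == i)%:R.
Proof.
move=> s0 /andP[u0 u1]; set n := size s.
have n0 : (0 < n)%N by rewrite lt0n size_eq0.
have nR : 0 < n%:R :> R by rewrite ltr0n.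
have [lo hi] := andP (truncn_itv (mulr_ge0 (ltW nR) u0)).
have lt_n : (Num.truncn (n%:R * u) < n)%N.
  by rewrite -(ltr_nat R) (le_lt_trans lo) // gtr_pMr.
exists (Ordinal lt_n) => [|j]; first by rewrite /= lo hi.
rewrite /indic /slot mem_setE in_itv /= ler_pdivrMr // ltr_pdivlMr // mulrC.
congr ((nat_of_bool _)%:R); apply/idP/eqP => [h|->]; last by rewrite lo hi.
by apply/val_inj/esym/truncn_def.
Qed.

Lemma quantileE s u : s != [::] -> 0 <= u < 1 ->
  exists2 i : 'I_(size s), i%:R <= (size s)%:R * u < i.+1%:R & quantile s u = s`_i.
Proof.
move=> s0 u01; have [i iu ind] := slotP s0 u01; exists i => //.
rewrite /quantile (bigD1 i) //= ind eqxx mulr1 big1 ?addr0 // => j ji.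
by rewrite ind (negPf ji) mulr0.
Qed.

Lemma measurable_quantile s : measurable_fun setT (quantile s).
Proof.
apply: measurable_sum => i; apply: (@measurable_funM _ _ _ _ (cst s`_i)) => //.
by apply: measurable_indic; exact: measurable_itv.
Qed.

Lemma unif01_ae : {ae @unif01 R, forall u : R, 0 < u < 1}.
Proof.
pose U : set R := `]-oo, 0%R] `|` `[1%R, +oo[.
have mU : measurable U by apply: measurableU; exact: measurable_itv.
exists U; split => //.
- rewrite unif01E //.
  apply: countable_lebesgue_measure0.
  apply: (@sub_countable _ _ _ [set 0; 1]); last exact: finite_set_countable.
  apply: subset_card_le => x /= []; rewrite /U /= !in_itv /= ?andbT => -[] h /andP[a b].
    by left; apply/le_anti; rewrite h a.
  by right; apply/le_anti; rewrite h b.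
- move=> x /= /negP; rewrite negb_and -!leNgt => /orP[] h; [left|right]; rewrite /= in_itv /= ?andbT //.
Qed.

Lemma unif01_slot s (i : 'I_(size s)) : @unif01 R (slot s i) = ((size s)%:R^-1)%:E.
Proof.
have n0 : 0 < (size s)%:R :> R by rewrite ltr0n (leq_trans _ (ltn_ord i)).
rewrite unif01E; last exact: measurable_itv.
rewrite (_ : slot s i `&` _ = slot s i); last first.
  apply/setIidl => x; rewrite /slot /= !in_itv /= => /andP[a b].
  rewrite (le_trans _ a) ?divr_ge0 //= (le_trans (ltW b)) //.
  by rewrite ler_pdivrMr // mul1r ler_nat.
rewrite /slot lebesgue_measure_itv /= lte_fin ltr_pM2r ?invr_gt0 // ltr_nat leqnn.
by rewrite -EFinB -mulrBl -natrB // subSnn mul1r.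
Qed.

Lemma integral_quantile s f : s != [::] -> measurable_fun setT f ->
  \int[@unif01 R]_u f (quantile s u) = emean f s.
Proof.
move=> s0 mf.
have i1 (i : 'I_(size s)) : integ (@unif01 R) (fun u => \1_(slot s i) u).
  apply: all_moments_integ; apply: (@all_moments_bounded _ _ _ _ _ 1).
    by apply: measurable_indic; exact: measurable_itv.
  by move=> w; rewrite /indic ger0_norm //; case: (_ \in _).
transitivity (\int[@unif01 R]_u \sum_(i < size s) f s`_i * \1_(slot s i) u).
  rewrite /Rintegral; congr fine; apply: ae_eq_integral => //.
  - by apply/measurable_EFinP; apply: measurableT_comp => //; exact: measurable_quantile.
  - apply/measurable_EFinP; apply: measurable_sum => i; apply: measurable_funM => //.
    by apply: measurable_indic; exact: measurable_itv.
  have F := ae_filter_ringOfSetsType (@unif01 R).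
  have := unif01_ae; apply: filterS => u /andP[u0 u1] _; congr EFin.
  have [i iu ind] : exists2 i : 'I_(size s), i%:R <= (size s)%:R * u < i.+1%:R & forall j : 'I_(size s), (\1_(slot s j) u : R) = (j == i)%:R.
    by apply: slotP; rewrite // ltW.
  have sel (c : 'I_(size s) -> R) : \sum_(j < size s) c j * \1_(slot s j) u = c i.
    rewrite (bigD1 i) //= ind eqxx mulr1 big1 ?addr0 // => j ji.
    by rewrite ind (negPf ji) mulr0.
  by rewrite sel /quantile (sel (fun i => s`_i)).
rewrite Rintegral_sum; last by move=> i _; exact: integZ (i1 i).
rewrite /emean big_distrr /= (big_nth 0) big_mkord; apply: eq_bigr => i _.
rewrite RintegralZl //; last exact: i1.
rewrite mulrC; congr (_ * _).
rewrite /Rintegral integral_indic ?setIT //; last exact: measurable_itv.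
by rewrite [X in fine X](unif01_slot i).
Qed.

Lemma quantile_nondecreasing s (u v : R) : s != [::] -> sorted <=%R s ->
  0 < u -> u <= v -> v < 1 -> quantile s u <= quantile s v.
Proof.
move=> s0 ss u0 uv v1.
have [|i /andP[iu ui] ->] := quantileE s0 (u := u); first by rewrite ltW //= (le_lt_trans uv).
have [|j /andP[jv vj] ->] := quantileE s0 (u := v); first by rewrite v1 (le_trans (ltW u0)).
apply: (sorted_leq_nth le_trans lexx 0 ss); rewrite ?inE ?ltn_ord //.
rewrite -ltnS -(ltr_nat R) (le_lt_trans iu) // (le_lt_trans _ vj) //.
exact: ler_wpM2l.
Qed.

Lemma card_le_sum (s : seq R) (g : R -> R) (i : 'I_(size s)) (D : pred 'I_(size s)) c :
  (forall x, 0 <= g x) -> (forall j, D j -> c <= g s`_j) ->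
  #|D|%:R * c <= \sum_(x <- s) g x.
Proof.
move=> g0 Dg; rewrite (big_nth 0) big_mkord (bigID D) /= -[leLHS]addr0 lerD ?sumr_ge0 //.
by rewrite mulr_natl -sumr_const; apply: ler_sum => j; apply: Dg.
Qed.

(** Markov's inequality read on ranks. If the value at rank [i] is nonnegative, the entries from
    rank [i] on, a fraction at least 1 - u, are at least as large in absolute value; if it is
    negative, so are the entries up to rank [i], a fraction at least u. The square root passes from
    order 2k to order k. *)
Lemma quantile_bound s k (u B : R) : s != [::] -> sorted <=%R s -> 0 < u < 1 ->
  emean (fun x => x ^+ (k * 2)) s <= B ->
  `|quantile s u| ^+ k <= Num.sqrt B * inv_sqrt_ends u.
Proof.
move=> s0 ss /andP[u0 u1] sB; set n := size s.
have nR : 0 < n%:R :> R by rewrite ltr0n lt0n size_eq0.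
have g0 (x : R) : 0 <= x ^+ (k * 2) by rewrite exprM sqr_ge0.
have [|i /andP[iu ui] ->] := quantileE s0 (u := u); first by rewrite ltW.
have mono (x y : R) : `|x| <= `|y| -> x ^+ (k * 2) <= y ^+ (k * 2).
  move=> xy; rewrite mulnC !exprM -(real_normK (num_real x)) -(real_normK (num_real y)).
  by rewrite -!exprM lerXn2r // nnegrE.
have tail (D : pred 'I_n) (v : R) : 0 < v -> v * n%:R <= #|D|%:R ->
    (forall j, D j -> `|s`_i| <= `|s`_j|) ->
    `|s`_i| ^+ k <= Num.sqrt B * v `^ (- 2^-1).
  move=> v0 vD Ds; have := @card_le_sum s (fun x => x ^+ (k * 2)) i D (s`_i ^+ (k * 2)) g0.
  move=> /(_ (fun j Dj => mono _ _ (Ds j Dj))) h.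
  have sv : s`_i ^+ (k * 2) <= B * v^-1.
    apply: le_trans (ler_wpM2r _ sB); last by rewrite invr_ge0 ltW.
    rewrite ler_pdivlMr // /emean mulrC ler_pdivlMl // mulrA; apply: le_trans h.
    by rewrite ler_wpM2r // mulrC.
  rewrite powRN powR12_sqrt ?(ltW v0) // -sqrtrV // -?sqrtrM ?(ltW v0) //.
    rewrite -[leLHS]ger0_norm ?exprn_ge0 // -sqrtr_sqr ler_wsqrtr //.
    by rewrite -normrX real_normK ?num_real // -exprM.
  by apply: le_trans sB; rewrite mulr_ge0 ?invr_ge0 ?sumr_ge0.
rewrite /inv_sqrt_ends mulrDr.
have [si|si] := leP 0 s`_i.
  rewrite -[leLHS]add0r lerD ?mulr_ge0 ?sqrtr_ge0 ?powR_ge0 //.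
  apply: (tail (fun j : 'I_n => (i <= j)%N)); rewrite ?subr_gt0 //.
    have -> : #|(fun j : 'I_n => (i <= j)%N)| = (n - i)%N.
      rewrite -sum1_card (reindex_inj rev_ord_inj) /= -(card_ord (n - i)) -sum1_card.
      rewrite (big_ord_widen_cond n predT (fun=> 1%N)) ?leq_subr //=.
      by apply: eq_bigl => j; rewrite /in_mem /=; have := ltn_ord j; have := ltn_ord i; rewrite -/n; lia.
    by rewrite natrB ?(ltnW (ltn_ord i)) // mulrBl mul1r mulrC lerB.
  move=> j ij; have sj : s`_i <= s`_j.
    by apply: (sorted_leq_nth le_trans lexx 0 ss); rewrite ?inE ?ltn_ord.
  by rewrite !ger0_norm // (le_trans si).
rewrite -[leLHS]addr0 lerD ?mulr_ge0 ?sqrtr_ge0 ?powR_ge0 //.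
apply: (tail (fun j : 'I_n => (j < i.+1)%N)) => //.
  have -> : #|(fun j : 'I_n => (j < i.+1)%N)| = i.+1.
    rewrite -sum1_card -[RHS]card_ord -sum1_card (big_ord_widen_cond n predT (fun=> 1%N)) ?ltn_ord //=.
  by rewrite mulrC ltW.
move=> j ij; have sj : s`_j <= s`_i.
  by apply: (sorted_leq_nth le_trans lexx 0 ss); rewrite ?inE ?ltn_ord.
by rewrite !ltr0_norm ?(le_lt_trans sj) // lerN2.
Qed.

End Quantiles.

(** * Limits of finite lists with convergent moments *)

Section MomentMethod.
Variable R : realType.
Implicit Types (s : seq R) (f : R -> R) (m : nat -> R).

(** By monotonicity the preimages of half-lines within ]0, 1[ are intervals. *)
Lemma measurable_nondecreasing01 (Q : R -> R) :
  (forall u v : R, 0 < u -> u <= v -> v < 1 -> Q u <= Q v) ->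
  measurable_fun setT (Q \_ `]0%R, 1%R[).
Proof.
move=> Qnd; apply/(measurable_restrictT _ (measurable_itv _)); apply: (measurability (@RGenCInfty.G R)) => [|/= _ [_] [r] -> <-].
  exact: RGenCInfty.measurableE.
apply: is_interval_measurable => s t /=; rewrite !in_itv /= !andbT.
move=> [/andP[s0 s1] rs] [/andP[t0 t1] rt] u /andP[su ut].
have u01 : 0 < u < 1 by rewrite (lt_le_trans s0) ?(le_lt_trans ut).
by split; rewrite ?in_itv /= ?andbT // (le_trans rs) // Qnd // (le_lt_trans ut).
Qed.

(** The condition [j <= sg j] stands in for monotonicity of [sg]: it already makes [sg] preserve
    limits. *)
Lemma moment_subsequence (s : nat -> seq R) m :
  (forall n, s n != [::]) -> (forall n, sorted <=%R (s n)) ->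
  (forall k, emean (fun x => x ^+ k) (s n) @[n --> \oo] --> m k) ->
  exists sg (nu : probability (measurableTypeR R) R),
    [/\ forall j, (j <= sg j)%N, has_moments nu m &
        forall f, continuous f -> (exists C, forall x, `|f x| <= C) ->
          emean f (s (sg j)) @[j --> \oo] --> \int[nu]_x f x].
Proof.
move=> s0 ss sm.
have bound k : exists B, forall n, emean (fun x => x ^+ k) (s n) <= B.
  have [M [_ hM]] : bounded_fun (fun n => emean (fun x => x ^+ k) (s n)).
    by apply/cvg_seq_bounded/cvg_ex; exists (m k); exact: sm.
  by exists (M + 1) => n; apply: le_trans (ler_norm _) (hM (M + 1) _ n _); rewrite ?ltrDl.
have qB k : exists B, forall n (u : R), 0 < u < 1 ->
    `|quantile (s n) u| ^+ k <= Num.sqrt B * inv_sqrt_ends u.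
  by have [B hB] := bound (k * 2)%N; exists B => n u u01; exact: quantile_bound.
have [B1 hB1] := qB 1%N.
have [sg [Q [J [sgj Qnd Jc Qcv]]]] := @helly_selection R (fun n => quantile (s n))
  (fun u => Num.sqrt B1 * inv_sqrt_ends u)
  (fun n u v u0 uv v1 => quantile_nondecreasing (s0 n) (ss n) u0 uv v1) hB1.
pose Q1 := Q \_ `]0%R, 1%R[.
have mQ1 : measurable_fun setT Q1 := measurable_nondecreasing01 Qnd.
have J0 : {ae @unif01 R, forall u : R, ~ J u}.
  exists J; split; last by move=> u /= /contrapT.
    exact: countable_measurable.
  rewrite unif01E; last exact: countable_measurable.
  apply: countable_lebesgue_measure0; apply: (@sub_countable _ _ _ J) => //.
  by apply: subset_card_le; exact: subIsetl.
have F := ae_filter_ringOfSetsType (@unif01 R).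
have lim f h : continuous f -> integ (@unif01 R) h ->
    (forall n (u : R), 0 < u < 1 -> `|f (quantile (s n) u)| <= h u) ->
    integ (@unif01 R) (f \o Q1) /\
    emean f (s (sg j)) @[j --> \oo] --> \int[@unif01 R]_u f (Q1 u).
  move=> cf ih fh.
  have mf : measurable_fun setT f by exact: continuous_measurable_fun.
  have [|||||i c] := @Rdominated_convergence _ _ _ (@unif01 R)
    (fun j u => f (quantile (s (sg j)) u)) (f \o Q1) h.
  - by move=> n; exact: (measurableT_comp mf (@measurable_quantile _ _)).
  - exact: (measurableT_comp mf mQ1).
  - have := J0; have := @unif01_ae R; apply: filterS2 => u u01 Ju.
    rewrite /Q1 /= patchE mem_setE in_itv /= u01.
    by apply: (continuous_cvg _ (cf (Q u))); exact: Qcv.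
  - exact: ih.
  - by have := @unif01_ae R; apply: filterS => u u01 n; exact: fh.
  split=> //; move: c; under eq_fun do rewrite integral_quantile //.
  by [].
(* The limit law is the image of the uniform law under the limit quantile function. *)
pose X := MeasurableFun.Pack (MeasurableFun.Class (isMeasurableFun.Build _ _ (measurableTypeR R) (measurableTypeR R) Q1 mQ1)).
pose nu : probability (measurableTypeR R) R := distribution (@unif01 R) X.
have nuE f : measurable_fun setT f -> integ (@unif01 R) (f \o Q1) ->
    integ nu f /\ \int[nu]_x f x = \int[@unif01 R]_u f (Q1 u).
  move=> mf fi; have mF : measurable_fun setT (EFin \o f) by exact/measurable_EFinP.
  split; first exact (@integrable_pushforward _ _ (measurableTypeR R) (measurableTypeR R) R Q1 mQ1 (@unif01 R) setT _ mF fi measurableT).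
  by rewrite /Rintegral; congr fine; exact (@integral_pushforward _ _ (measurableTypeR R) (measurableTypeR R) R Q1 mQ1 (@unif01 R) setT _ mF fi measurableT).
exists sg, nu; split => //.
- move=> k; have [B hB] := qB k.
  have [|||i c] := lim (fun x => x ^+ k) (fun u => Num.sqrt B * inv_sqrt_ends u).
  + exact: exprn_continuous.
  + by apply: integZ; exact: integ_inv_sqrt_ends.
  + by move=> n u u01; rewrite normrX; exact: hB.
  have [|i' ->] := nuE (fun x => x ^+ k) _ i.
    exact: continuous_measurable_fun (@exprn_continuous _ k).
  split; first exact: i'.
  apply: (cvg_unique _ c); first exact: Rhausdorff.
  apply: cvg_comp _ (sm k); apply/cvgnyPge => A; near=> j.
  by apply: leq_trans (sgj j); near: j; exact: nbhs_infty_ge.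
- move=> f cf [C fC].
  have [||i c] := lim f (fun=> C) cf.
  + by apply: all_moments_integ; exact: all_moments_cst.
  + by move=> n u _.
  have [|_ ->] := nuE f _ i; first exact: continuous_measurable_fun.
  exact: c.
Unshelve. all: end_near. Qed.

(** Taking K = n and d = 1 / (n + 1) gives one sequence of lists along which every moment
    converges. *)
Lemma approachable_moments m :
  (forall K d, 0 < d -> exists s, [/\ s != [::], sorted <=%R s &
     forall k, (k <= K)%N -> `|emean (fun x => x ^+ k) s - m k| < d]) ->
  exists nu : probability (measurableTypeR R) R, has_moments nu m.
Proof.
move=> H.
have /choice[s hs] : forall n, exists s, [/\ s != [::], sorted <=%R s &
   forall k, (k <= n)%N -> `|emean (fun x => x ^+ k) s - m k| < n.+1%:R^-1].
  by move=> n; apply: H; rewrite invr_gt0.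
have [|||sg [nu [_ nuM _]]] := @moment_subsequence s m; last by exists nu.
- by move=> n; case: (hs n).
- by move=> n; case: (hs n).
move=> k; apply/cvgrPdist_lt => e e0; near=> n; rewrite distrC.
have [_ _ /(_ k _)/lt_trans] := hs n; apply.
  by near: n; exact: nbhs_infty_ge.
by near: n; exact: near_infty_natSinv_lt (PosNum e0).
Unshelve. all: end_near. Qed.

(** Compactness by contradiction: counterexamples for K = n and d = 1 / (n + 1) have a subsequential
    limit law with moments [m]. Determinacy identifies it with [nu], so the integrals of [f]
    converge to the value they were to avoid. *)
Lemma determinate_approximation m (nu : probability (measurableTypeR R) R) f eps :
  has_moments nu m -> moment_determinate m -> continuous f ->
  (exists C, forall x, `|f x| <= C) -> 0 < eps ->
  exists K d, 0 < d /\ forall s, s != [::] -> sorted <=%R s ->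
     (forall k, (k <= K)%N -> `|emean (fun x => x ^+ k) s - m k| < d) ->
     `|emean f s - \int[nu]_x f x| <= eps.
Proof.
move=> nuM det cf fC e0; apply: contrapT => H.
have /choice[s hs] : forall n : nat, exists s, [/\ s != [::], sorted <=%R s,
   forall k, (k <= n)%N -> `|emean (fun x => x ^+ k) s - m k| < n.+1%:R^-1 &
   eps < `|emean f s - \int[nu]_x f x|].
  move=> n; apply: contrapT => Hn; apply: H; exists n, n.+1%:R^-1.
  split=> [|s s0 ss sm]; first by rewrite invr_gt0.
  by rewrite leNgt; apply/negP => h; apply: Hn; exists s.
have [|||sg [nu' [sgj nuM' /(_ f cf fC) lf]]] := @moment_subsequence s m.
- by move=> n; case: (hs n).
- by move=> n; case: (hs n).
- move=> k; apply/cvgrPdist_lt => e e_gt0; near=> n; rewrite distrC.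
  have [_ _ /(_ k _)/lt_trans + _] := hs n; apply.
    by near: n; exact: nbhs_infty_ge.
  by near: n; exact: near_infty_natSinv_lt (PosNum e_gt0).
have eqI : \int[nu']_x f x = \int[nu]_x f x.
  rewrite /Rintegral; congr fine; apply: eq_measure_integral => A mA _.
  exact: det.
have [j _ /(_ j (leqnn j))] : \forall j \near \oo, `|\int[nu]_x f x - emean f (s (sg j))| < eps.
  by move/cvgrPdist_lt: lf => /(_ eps e0); rewrite eqI.
rewrite distrC => h; have [_ _ _] := hs (sg j).
by rewrite ltNge ltW.
Unshelve. all: end_near. Qed.

End MomentMethod.

(** * Spectra of random symmetric matrices *)

Lemma expr_conj_diag (F : fieldType) n (P : 'M[F]_n) (D : 'rV[F]_n) k : P \in unitmx ->
  (invmx P *m diag_mx D *m P) ^+ k = invmx P *m diag_mx (\row_i D 0 i ^+ k) *m P.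
Proof.
move=> Pu; elim: k => [|k IH].
  rewrite expr0 (_ : diag_mx _ = 1%:M) ?mulmx1 ?mulVmx //.
  by apply/matrixP => i j; rewrite !mxE expr0.
rewrite exprS IH -[_ * _]/(_ *m _) !mulmxA mulmxK //.
rewrite -[invmx P *m _ *m diag_mx _]mulmxA mulmx_diag; congr (_ *m diag_mx _ *m _).
by apply/rowP => i; rewrite !mxE exprS.
Qed.

Section Spectrum.
Variables (R : realType) (N : nat).
Implicit Types A : 'M[R]_N.

(* Diagonalize over R[i], where the eigenvalues of a symmetric real matrix are real. *)
Lemma symmetric_spectrum A : A^T = A ->
  exists d : 'rV[R]_N, char_poly A = \prod_i ('X - (d 0 i)%:P) /\
    forall k, \tr (A ^+ k) = \sum_i d 0 i ^+ k.
Proof.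
move=> symA; pose c := real_complex R : R -> R[i]; pose B : 'M[R[i]]_N := map_mx c A.
have Bh : B \is hermsymmx.
  apply: realsym_hermsym.
    by apply/is_hermitianmxP; rewrite expr0 scale1r map_mx_id //; apply/matrixP => i j; rewrite !mxE -[A in RHS]symA mxE.
  by apply/mxOverP => i j; rewrite mxE complex_real.
have /mxOverP Dreal := hermitian_spectral_diag_real Bh.
set P := spectralmx B; set D := spectral_diag B in Dreal.
have BE : B = invmx P *m diag_mx D *m P by apply/orthomx_spectralP/hermitian_normalmx.
have Pu : P \in unitmx := spectral_unit B.
pose d : 'rV[R]_N := \row_i complex.Re (D 0 i).
have dE i : c (d 0 i) = D 0 i.
  by rewrite mxE; have /complex_realP[x ->] := Dreal 0 i.
exists d; split=> [|k].
  apply: (@map_poly_inj _ _ c); rewrite map_char_poly rmorph_prod /=.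
  transitivity (char_poly (diag_mx D)); last first.
    rewrite char_poly_trig ?diag_mx_is_trig //; apply: eq_bigr => i _.
    by rewrite rmorphB /= map_polyX map_polyC -[RHS]/('X - (c (d 0 i))%:P) dE mxE eqxx.
  rewrite -/B /char_poly /char_poly_mx; set PP := map_mx polyC P.
  have PPu : map_mx polyC (invmx P) *m PP = 1%:M by rewrite -map_mxM mulVmx // map_mx1.
  have -> : 'X%:M - map_mx polyC B =
      map_mx polyC (invmx P) *m ('X%:M - map_mx polyC (diag_mx D)) *m PP.
    rewrite mulmxBr mulmxBl [_ *m 'X%:M]scalar_mxC -[_ *m _ *m PP]mulmxA PPu mulmx1; congr (_ - _).
    by rewrite {1}BE !map_mxM.
  by rewrite !det_mulmx mulrAC -det_mulmx PPu det1 mul1r.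
apply: (@complexI R).
transitivity (\tr (B ^+ k)).
  rewrite -[RHS]/(\tr (map_mx c A ^+ k)).
  have -> : map_mx c A ^+ k = map_mx c (A ^+ k).
    elim: k => [|k IH]; first by rewrite !expr0 map_mx1.
    by rewrite !exprS IH map_mxM.
  rewrite -[LHS]/(real_complex R (\tr (A ^+ k))) /mxtrace rmorph_sum; apply: eq_bigr => i _.
  by rewrite [RHS]mxE.
rewrite BE expr_conj_diag //.
rewrite mxtrace_mulC mulmxA mulmxV // mul1mx mxtrace_diag rmorph_sum.
by apply: eq_bigr => i _; rewrite mxE -dE rmorphXn.
Qed.

Lemma eigenvaluesP A : A^T = A ->
  [/\ sorted <=%R (eigenvalues A), size (eigenvalues A) = N &
      forall k, \tr (A ^+ k) = \sum_(x <- eigenvalues A) x ^+ k].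
Proof.
move=> /symmetric_spectrum[d [cp trA]].
pose s := sort <=%R [seq d 0 i | i : 'I_N].
have ps : perm_eq s [seq d 0 i | i : 'I_N] by rewrite perm_sort.
have [ss eqA] : [set s | sorted <=%R s /\
    char_poly A = \prod_(x <- s) ('X - x%:P)] (eigenvalues A).
  apply: (@xgetPex _ [::]); exists s; split.
    by apply: sort_sorted; exact: le_total.
  by rewrite cp (perm_big _ ps) big_map big_enum.
have pe : perm_eq (eigenvalues A) [seq d 0 i | i : 'I_N].
  by apply: prod_XsubC_eq; rewrite -eqA cp big_map big_enum.
split=> // [|k].
  by rewrite (perm_size pe) size_map -cardE card_ord.
by rewrite trA (perm_big _ pe) big_map big_enum.
Qed.

End Spectrum.

Lemma integral_esd (R : realType) N (A : 'M[R]_N) (f : R -> R) :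
  size (eigenvalues A) = N -> measurable_fun setT f ->
  \int[esd A]_x f x = emean f (eigenvalues A).
Proof.
move=> sA mf.
have ge0 (g : R -> R) : measurable_fun setT g -> (forall x, 0 <= g x) ->
    (\int[esd A]_x (g x)%:E = (emean g (eigenvalues A))%:E)%E.
  move=> mg g0; have mG : measurable_fun setT (EFin \o g) by exact/measurable_EFinP.
  rewrite /esd ge0_integral_mscale //; last by move=> x _; rewrite lee_fin.
  rewrite ge0_integral_measure_sum //; last by move=> x _; rewrite lee_fin.
  under eq_bigr do rewrite integral_dirac // diracT mul1e.
  by rewrite sumEFin -EFinM /emean sA (big_nth 0) big_mkord sA.
rewrite /Rintegral integralE.
have -> : (\int[esd A]_x ((fun x => (f x)%:E)^\+ x) =
    \int[esd A]_x (Num.max (f x) 0)%:E)%E.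
  by apply: eq_integral => x _; rewrite funeposE EFin_max.
have -> : (\int[esd A]_x ((fun x => (f x)%:E)^\- x) =
    \int[esd A]_x (Num.max (- f x) 0)%:E)%E.
  by apply: eq_integral => x _; rewrite funenegE EFin_max.
have maxr0_ge0 x : 0 <= Num.max x 0 :> R by rewrite le_max lexx orbT.
have mp : measurable_fun setT (fun x => Num.max (f x) 0) by exact: measurable_maxr.
have mn : measurable_fun setT (fun x => Num.max (- f x) 0).
  by apply: measurable_maxr => //; exact: measurableT_comp.
rewrite (ge0 _ mp) // (ge0 _ mn) // -EFinB /=.
rewrite /emean -mulrBr -sumrB; congr (_ * _); apply: eq_bigr => x _.
by rewrite /Num.max; case: ifPn; case: ifPn; rewrite -?leNgt; lra.
Qed.

(** Reduces the measurability of an order statistic to that of the number of entries below a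
    threshold. *)
Lemma sorted_nth_lt (R : realType) (s : seq R) i c : sorted <=%R s -> (i < size s)%N ->
  (s`_i < c) = (i < count (fun x : R => x < c)%R s)%N.
Proof.
move=> ss iS; have [sic|sic] := ltP.
  apply/esym; rewrite -(cat_take_drop i.+1 s) count_cat (leq_trans _ (leq_addr _ _)) //.
  have : all (fun x : R => x < c)%R (take i.+1 s).
    apply/(all_nthP 0) => j; rewrite size_takel // => ji; rewrite nth_take //.
    apply: le_lt_trans sic; apply: (sorted_leq_nth le_trans lexx 0 ss) => //.
    exact: leq_trans ji iS.
  by rewrite all_count size_takel // => /eqP ->.
apply/esym/negbTE; rewrite -leqNgt -{1}(cat_take_drop i s) count_cat.
rewrite [X in (_ + X)%N](_ : _ = 0%N) ?addn0.
  by rewrite (leq_trans (count_size _ _)) // size_take_min geq_minl.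
apply/eqP; rewrite -leqn0 leqNgt -has_count; apply/hasPn => x.
move=> /(nthP 0)[j]; rewrite size_drop => jS <-; rewrite nth_drop -leNgt.
apply: le_trans sic _; apply: (sorted_leq_nth le_trans lexx 0 ss) => //.
- by rewrite inE -ltn_subRL.
- exact: leq_addr.
Qed.

(* The functions g for which the sum of g over the list is measurable form a
   vector space closed under pointwise limits. It contains the polynomials, hence
   x |-> exp(a x), hence x |-> exp(- exp(n (x - c))), hence in the limit the
   indicators of half-lines. *)
Section MeasurableLists.
Context d (W : measurableType d) (R : realType) (e : W -> seq R).
Hypothesis measurable_power_sums : forall k, measurable_fun setT (fun w => \sum_(x <- e w) x ^+ k).

Let V (g : R -> R) := measurable_fun setT (fun w => \sum_(x <- e w) g x).

Let VZ c g : V g -> V (fun x => c * g x).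
Proof.
move=> Vg; rewrite /V; under eq_fun do rewrite -mulr_sumr.
exact: measurable_funM.
Qed.

Let VD g h : V g -> V h -> V (fun x => g x + h x).
Proof.
move=> Vg Vh; rewrite /V; under eq_fun do rewrite big_split /=.
exact: measurable_funD.
Qed.

Let V0 : V (fun=> 0).
Proof.
rewrite /V; under eq_fun do rewrite big1 //.
exact: measurable_cst.
Qed.

Let V_sum n (g : nat -> R -> R) : (forall k, V (g k)) -> V (fun x => \sum_(0 <= k < n) g k x).
Proof.
move=> Vg; elim: n => [|n IH]; first by under eq_fun do rewrite big_geq //; exact: V0.
by under eq_fun do rewrite big_nat_recr //=; exact: VD.
Qed.

Let V_cvg g (h : nat -> R -> R) : (forall n, V (h n)) -> (forall x, h n x @[n --> \oo] --> g x) -> V g.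
Proof.
move=> Vh hg; apply: (measurable_fun_cvg (h := fun n w => \sum_(x <- e w) h n x)) => // w _.
by apply: cvg_sumr => x _; exact: hg.
Qed.

Let V_expR g : (forall k, V (fun x => g x ^+ k)) -> V (fun x => expR (g x)).
Proof.
move=> Vg; apply: (@V_cvg _ (fun n x => series (exp_coeff (g x)) n)) => [n|x]; last first.
  exact: is_cvg_series_exp_coeff.
rewrite /series /=; apply: V_sum => k.
rewrite /exp_coeff /=; under eq_fun do rewrite mulrC.
exact: VZ.
Qed.

Let V_lin_exp a : V (fun x => expR (a * x)).
Proof. by apply: V_expR => k; under eq_fun do rewrite exprMn; exact (VZ (a ^+ k) (measurable_power_sums k)). Qed.

(** The free power [x ^+ i] lets one factor x - c be expanded at a time, in place of a binomial
    expansion. *)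
Let V_shift c i j : V (fun x => x ^+ i * (x - c) ^+ j).
Proof.
elim: j i => [|j IH] i; first by under eq_fun do rewrite expr0 mulr1; exact: measurable_power_sums.
have H x : x ^+ i * (x - c) ^+ j.+1 = x ^+ i.+1 * (x - c) ^+ j + (- c) * (x ^+ i * (x - c) ^+ j).
  by rewrite !exprS; ring.
by rewrite (funext H); apply: VD; [exact: IH|apply: VZ; exact: IH].
Qed.

Let V_lt c : V (fun x => (x < c)%R%:R).
Proof.
have expN0 (t : R) : 0 < t -> expR (- (n%:R * t)) @[n --> \oo] --> (0 : R).
  move=> t0; under eq_fun do rewrite -mulrN expRM_natl.
  by apply: cvg_expr; rewrite ger0_norm ?expR_ge0 // expR_lt1 oppr_lt0.
(* The first term tends to 1 for x < c, to 0 for x > c, but to exp(-1) at x = c; the second removes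
   that value, because exp(- n (x - c)^2) tends to the indicator of c. *)
pose h n x : R := expR (- expR (n%:R * (x - c))) + (- expR (-1)) * expR (- (n%:R * (x - c) ^+ 2)).
apply: (@V_cvg _ h) => [n|x].
  apply: VD.
    apply: V_expR => k.
    have H x : (- expR (n%:R * (x - c))) ^+ k =
        ((-1) ^+ k * expR (- (k%:R * n%:R * c))) * expR ((k%:R * n%:R) * x).
      rewrite [LHS]exprNn -expRM_natl -[RHS]mulrA -expRD; congr (_ * expR _); ring.
    by rewrite (funext H); exact: VZ.
  apply/VZ/V_expR => k.
  have H x : (- (n%:R * (x - c) ^+ 2)) ^+ k = (- n%:R) ^+ k * (x ^+ 0 * (x - c) ^+ (2 * k)).
    by rewrite -mulNr exprMn expr0 mul1r exprM.
  by rewrite (funext H); apply: VZ; exact: V_shift.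
have sq : x != c -> expR (- (n%:R * (x - c) ^+ 2)) @[n --> \oo] --> (0 : R).
  by move=> xc; apply: expN0; rewrite exprn_even_gt0 //= subr_eq0.
have [xc|cx|->] := ltgtP x c; rewrite /h.
- rewrite -[X in _ --> X]addr0 -[X in _ --> _ + X](mulr0 (- expR (-1))) -[X in _ --> X + _]expR0.
  apply: cvgD; last by apply: cvgM; [exact: cvg_cst|apply: sq; rewrite lt_eqF].
  apply: (continuous_cvg _ (@continuous_expR R _)); rewrite -oppr0; apply: cvgN.
  under eq_fun do rewrite -[x - c]opprB mulrN.
  by apply: expN0; rewrite subr_gt0.
- rewrite -[X in _ --> X]addr0 -[X in _ --> _ + X](mulr0 (- expR (-1))).
  apply: cvgD; last by apply: cvgM; [exact: cvg_cst|apply: sq; rewrite gt_eqF].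
  apply: (@squeeze_cvgr _ _ _ _ (fun=> 0) (fun n => expR (- (n%:R * (x - c))))).
  + near=> n; rewrite expR_ge0 ler_expR lerN2.
    by apply: le_trans (expR_ge1Dx _); rewrite lerDr.
  + exact: cvg_cst.
  + by apply: expN0; rewrite subr_gt0.
- rewrite subrr; under eq_fun do rewrite expr0n /= !mulr0 expR0 oppr0 expR0 mulr1 subrr.
  exact: cvg_cst.
Unshelve. all: end_near. Qed.

Variable N : nat.
Hypothesis sorted_e : forall w, sorted <=%R (e w).
Hypothesis size_e : forall w, size (e w) = N.

Lemma measurable_nth_sorted i : (i < N)%N -> measurable_fun setT (fun w => (e w)`_i).
Proof.
move=> iN; apply: (measurability _ (RGenInftyO.measurableE R)) => //.
move=> _ [_ [c ->] <-]; rewrite setTI.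
have mc : measurable_fun setT (fun w => \sum_(x <- e w) (x < c)%R%:R : R) := V_lt c.
have cE w : \sum_(x <- e w) (x < c)%R%:R = (count (fun x : R => x < c)%R (e w))%:R :> R.
  by rewrite -natr_sum -sum1_count [in RHS]big_mkcond; congr (_%:R); apply: eq_bigr => x _; case: ifP.
have preE : (fun w => (e w)`_i) @^-1` `]-oo, c[ =
    (fun w => \sum_(x <- e w) (x < c)%R%:R : R) @^-1` `]i%:R, +oo[.
  by apply/seteqP; split=> w /=; rewrite !in_itv /= ?andbT sorted_nth_lt ?size_e // cE ltr_nat.
rewrite preE -[X in measurable X]setTI; exact (mc measurableT _ (measurable_itv _)).
Qed.

Lemma measurable_emean_sorted f : measurable_fun setT f -> measurable_fun setT (fun w => emean f (e w)).
Proof.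
move=> mf; rewrite /emean.
have H w : (size (e w))%:R^-1 * \sum_(x <- e w) f x = N%:R^-1 * \sum_(i < N) f (e w)`_i.
  by rewrite (big_nth 0) big_mkord size_e.
rewrite (funext H); apply: measurable_funM => //; apply: measurable_sum => i.
by apply: measurableT_comp => //; apply: measurable_nth_sorted.
Qed.

End MeasurableLists.

(** * Convergence of the spectra *)

(** Chebyshev's inequality about [a] in place of the mean: the second moment of X - a is the
    variance plus the square of the bias. *)
Lemma chebyshev_near d (T : measurableType d) (R : realType) (P : probability T R) (X : T -> R) (a e : R) :
  integ P X -> integ P (fun w => X w ^+ 2) -> 0 < e ->
  measurable [set w | e <= `|X w - a|] /\
  (P [set w | (e <= `|X w - a|)%R] <=
   (((\int[P]_w (X w ^+ 2) - (\int[P]_w X w) ^+ 2) + (\int[P]_w X w - a) ^+ 2) / e ^+ 2)%:E)%E.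
Proof.
move=> iX iX2 e0; set D := [set w | _].
have mX := integ_measurable iX.
have mD : measurable D.
  rewrite (_ : D = (fun w => `|X w - a|) @^-1` `[e, +oo[); last first.
    by apply/seteqP; split=> w; rewrite /D /= in_itv /= andbT.
  rewrite -[X in measurable X]setTI.
  have mY : measurable_fun setT (fun w => `|X w - a|).
    by apply: measurableT_comp => //; apply: measurable_funB.
  exact (mY measurableT _ (measurable_itv _)).
split=> //; have e20 : 0 < e ^+ 2 by rewrite exprn_gt0.
(* The factor 1 makes each term a scalar multiple of an integrable function, so that linearity
   applies uniformly. *)
have YE w : X w ^+ 2 - 2 * a * X w + a ^+ 2 * 1 = (X w - a) ^+ 2 by ring.
have i1 : integ P (fun=> 1) := all_moments_integ (all_moments_cst P 1).
have iY : integ P (fun w => X w ^+ 2 - 2 * a * X w + a ^+ 2 * 1).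
  by apply: integD; [apply: integB => //; exact: integZ|exact: integZ].
have EY : \int[P]_w (X w ^+ 2 - 2 * a * X w + a ^+ 2 * 1) =
    (\int[P]_w (X w ^+ 2) - (\int[P]_w X w) ^+ 2) + (\int[P]_w X w - a) ^+ 2.
  rewrite RintegralD //; [|by apply: integB => //; exact: integZ|exact: integZ].
  rewrite RintegralB //; last exact: integZ.
  rewrite RintegralZl // RintegralZl // Rintegral_cst // [X in fine X]probability_setT /=.
  by ring.
rewrite -EY EFinM lee_pdivlMr // muleC /Rintegral fineK; last exact: (integrable_fin_num measurableT iY).
rewrite -integral_cst //.
apply: (@le_trans _ _ (\int[P]_(w in D) (X w ^+ 2 - 2 * a * X w + a ^+ 2 * 1)%:E)%E).
  apply: ge0_le_integral => //.
  - by move=> w _; rewrite lee_fin ltW.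
  - by apply: measurable_funTS; exact: (measurable_int P iY).
  move=> w Dw; rewrite lee_fin YE.
  by rewrite -[leRHS]real_normK ?num_real // lerXn2r // nnegrE ltW.
apply: ge0_subset_integral => //; first exact: (measurable_int P iY).
by move=> w _; rewrite lee_fin YE sqr_ge0.
Qed.

Section Spectra.
Variables (R : realType) (p : nat) (d : nat -> measure_display)
  (Omega : forall N : nat, measurableType (d N))
  (P : forall N : nat, probability (Omega N) R)
  (T : forall N : nat, p.-tuple 'I_N -> {RV (P N) >-> R}) (M : nat -> R).
Hypothesis p_gt1 : (1 < p)%N.
Hypothesis hw : heavy_wigner T M.
Hypothesis M2_gt0 : 0 < M 2%N.
Let M' r : R := ((p - 2)`!%:R `^ (r%:R / 2)) * M r / (M 2%N `^ (r%:R / 2)).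

Lemma tensor_matrix_sym N (w : Omega N) : (tensor_matrix T M w)^T = tensor_matrix T M w.
Proof.
apply/matrixP => a b; rewrite !mxE; congr (_ * _); apply: eq_bigr => j _.
pose o0 := Ordinal (ltnW p_gt1); pose o1 := Ordinal p_gt1.
rewrite -(hw_symmetric hw (tensor_index a b j) (tperm o0 o1) w); congr (T _ w).
apply: eq_from_tnth => l; rewrite !tnth_mktuple.
have [->|l0] := eqVneq l o0; first by rewrite tpermL.
have [->|l1] := eqVneq l o1; first by rewrite tpermR.
rewrite tpermD 1?eq_sym //; case: l l0 l1 => -[|[|l]] lp l0 l1.
- by case/negP: l0; apply/eqP; exact: val_inj.
- by case/negP: l1; apply/eqP; exact: val_inj.
apply: set_nth_default => /=; rewrite size_tuple; lia.
Qed.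

Let spectrum N (w : Omega N) := eigenvalues (tensor_matrix T M w).

Lemma size_spectrum N (w : Omega N) : size (spectrum w) = N.
Proof. by have [] := eigenvaluesP (tensor_matrix_sym w). Qed.

Lemma sorted_spectrum N (w : Omega N) : sorted <=%R (spectrum w).
Proof. by have [] := eigenvaluesP (tensor_matrix_sym w). Qed.

Lemma spectral_moment_emean k N (w : Omega N) :
  spectral_moment T M k w = emean (fun x => x ^+ k) (spectrum w).
Proof.
have [_ _ trE] := eigenvaluesP (tensor_matrix_sym w).
by rewrite /emean size_spectrum /spectral_moment trE.
Qed.

Lemma measurable_emean_spectrum N f : (0 < N)%N -> measurable_fun setT f ->
  measurable_fun setT (fun w : Omega N => emean f (spectrum w)).
Proof.
move=> N0 mf; apply: (@measurable_emean_sorted _ _ _ _ _ N) => //.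
- move=> k; have H (w : Omega N) : \sum_(x <- spectrum w) x ^+ k = N%:R * spectral_moment T M k w.
    by rewrite spectral_moment_emean /emean size_spectrum mulrA mulfV ?mul1r // pnatr_eq0 -lt0n.
  rewrite (funext H); apply: measurable_funM => //.
  exact: integ_measurable (integ_spectral_moment p_gt1 hw k N).
- exact: sorted_spectrum.
- exact: size_spectrum.
Qed.

Let bad K (e : R) N := [set w : Omega N | exists2 k, (k <= K)%N & e <= `|spectral_moment T M k w - eta p M' k|].

Lemma moments_in_probability K e r : 0 < e -> 0 < r ->
  \forall N \near \oo, measurable (@bad K e N) /\ (P N (@bad K e N) <= r%:E)%E.
Proof.
move=> e0.
have one k s : 0 < s -> \forall N \near \oo,
    measurable [set w : Omega N | e <= `|spectral_moment T M k w - eta p M' k|] /\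
    (P N [set w : Omega N | (e <= `|spectral_moment T M k w - eta p M' k|)%R] <= s%:E)%E.
  (* The moment of order 0 is exactly 1 once N > 0, so its event is empty; the variance estimate
     covers the positive orders. *)
  case: k => [|k] s0; near=> N.
    have N0 : (0 < N)%N by near: N; exact: nbhs_infty_gt.
    rewrite (_ : [set w | _] = set0); first by rewrite measure0 lee_fin ltW.
    by apply/seteqP; split=> w //=; rewrite spectral_moment0 // subrr normr0 leNgt e0.
  have [mB PB] := chebyshev_near (eta p M' k.+1) (integ_spectral_moment p_gt1 hw k.+1 N)
    (integ_spectral_moment_sqr p_gt1 hw k.+1 N) e0.
  split=> //; apply: le_trans PB _; rewrite lee_fin ltW //.
  near: N; have : (fun N => (\int[P N]_w spectral_moment T M k.+1 w ^+ 2 -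
      (\int[P N]_w spectral_moment T M k.+1 w) ^+ 2 +
      (\int[P N]_w spectral_moment T M k.+1 w - eta p M' k.+1) ^+ 2) / e ^+ 2) @ \oo --> (0 : R).
    rewrite -[X in _ --> X](mul0r (e ^+ 2)^-1); apply: cvgM; last exact: cvg_cst.
    rewrite -[X in _ --> X]addr0; apply: cvgD; first exact: cvg_variance.
    have cm : (fun N => \int[P N]_w spectral_moment T M k.+1 w - eta p M' k.+1) @ \oo --> (0 : R).
      by rewrite -[X in _ --> X](subrr (eta p M' k.+1)); apply: cvgB; [exact: cvg_mean|exact: cvg_cst].
    by rewrite -[X in _ --> X](mulr0 (0 : R)); apply: cvgM.
  move=> /cvgrPdist_lt /(_ _ s0); apply: filterS => N; rewrite sub0r normrN.
  exact: le_lt_trans (ler_norm _).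
elim: K r => [|K IH] r r0.
  apply: filterS (one 0%N r r0) => N.
  rewrite (_ : @bad 0 e N = [set w | e <= `|spectral_moment T M 0 w - eta p M' 0|]) //.
  by apply/seteqP; split=> w => [[k]|h]; [rewrite leqn0 => /eqP ->|exists 0%N].
have r2 : 0 < r / 2 by rewrite divr_gt0.
apply: filterS2 (IH _ r2) (one K.+1 _ r2) => N [m1 P1] [m2 P2].
rewrite (_ : @bad K.+1 e N = @bad K e N `|` [set w | e <= `|spectral_moment T M K.+1 w - eta p M' K.+1|]).
  split; first exact: measurableU.
  by apply: le_trans (measureU2 _ m1 m2) _; rewrite [r in leRHS]splitr EFinD leeD.
apply/seteqP; split=> w => [[k]|[[k kK h]|h]].
- by rewrite leq_eqVlt => /orP[/eqP -> h|kK h]; [right|left; exists k].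
- by exists k => //; exact: leqW.
- by exists K.+1.
Unshelve. all: end_near. Qed.

(** An event of probability at most 1 / 2 is not the whole space: an outcome outside it has a
    spectrum, now a deterministic list, whose moments up to order K are within e of [eta]. *)
Lemma limit_moments : exists nu : probability (measurableTypeR R) R, has_moments nu (eta p M').
Proof.
apply: approachable_moments => K e e0.
have [N [N0 [_ Pbad]]] : exists N, (0 < N)%N /\ (measurable (@bad K e N) /\ (P N (@bad K e N) <= 2^-1%:E)%E).
  have [|N [? ?]] := @filter_ex _ (\oo : set_system nat) _ _ (filterI (nbhs_infty_gt 0)
    (moments_in_probability K e0 (_ : 0 < 2^-1))); last by exists N.
  by rewrite invr_gt0.
have [w wbad] : exists w, ~ @bad K e N w.
  apply: contrapT => h; move: Pbad; rewrite (_ : @bad K e N = setT).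
    by rewrite probability_setT lee_fin leNgt invf_lt1 // ltr1n.
  by apply/seteqP; split=> w // _; apply: contrapT => hw'; apply: h; exists w.
exists (spectrum w); split.
- by rewrite -size_eq0 size_spectrum -lt0n.
- exact: sorted_spectrum.
move=> k kK; rewrite -spectral_moment_emean ltNge; apply/negP => h.
by apply: wbad; exists k.
Qed.

(** [determinate_approximation] is a deterministic implication, so the deviation event for [f] is
    contained in the event that one of finitely many spectral moments deviates. *)
Lemma weak_limit (nu : probability (measurableTypeR R) R) :
  has_moments nu (eta p M') -> moment_determinate (eta p M') ->
  cvg_weakly_in_probability P (fun N w => esd (tensor_matrix T M w)) nu.
Proof.
move=> nuM det f cf fC e e0.
have [K [dl [dl0 close]]] := determinate_approximation nuM det cf fC e0.
have mf : measurable_fun setT f by exact: continuous_measurable_fun.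
pose S N := [set w | e < `|\int[esd (tensor_matrix T M w)]_x f x - \int[nu]_x f x|] : set (Omega N).
suff small r : 0 < r -> \forall N \near \oo, measurable (S N) /\ (P N (S N) <= r%:E)%E.
  apply/fine_cvgP; split.
    by apply: filterS (small 1 ltr01) => N [mS _]; exact: fin_num_measure.
  apply/cvgrPdist_le => r r0; apply: filterS (small r r0) => N [mS PS].
  by rewrite sub0r normrN ger0_norm ?fine_ge0 // -lee_fin fineK ?fin_num_measure.
move=> r0; near=> N.
have N0 : (0 < N)%N by near: N; exact: nbhs_infty_gt.
have [mB PB] : measurable (@bad K dl N) /\ (P N (@bad K dl N) <= r%:E)%E.
  by near: N; exact: moments_in_probability.
have SE : S N = [set w | e < `|emean f (spectrum w) - \int[nu]_x f x|].
  by apply/seteqP; split=> w /=; rewrite /S /= integral_esd // size_spectrum.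
(* Monotonicity of [P N] is applied to [S N], which must therefore be measurable. *)
have mS : measurable (S N).
  rewrite SE (_ : [set w | _] = (fun w => `|emean f (spectrum w) - \int[nu]_x f x|) @^-1` `]e, +oo[).
    rewrite -[X in measurable X]setTI.
    have mY : measurable_fun setT (fun w => `|emean f (@spectrum N w) - \int[nu]_x f x|).
      by apply: measurableT_comp => //; apply: measurable_funB => //; exact: measurable_emean_spectrum.
    exact (mY measurableT _ (measurable_itv _)).
  by apply/seteqP; split=> w /=; rewrite in_itv /= andbT.
have SB : S N `<=` @bad K dl N.
  rewrite SE => w /=; rewrite ltNge => /negP h; apply: contrapT => nb; apply: h.
  apply: close.
  - by rewrite -size_eq0 size_spectrum -lt0n.
  - exact: sorted_spectrum.
  move=> k kK; rewrite -spectral_moment_emean ltNge; apply/negP => h.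
  by apply: nb; exists k.
by split=> //; apply: le_trans PB; apply: le_measure; rewrite ?inE.
Unshelve. all: end_near. Qed.

End Spectra.

Local Close Scope classical_set_scope.

Theorem theorem1p9 (R : realType) (p : nat) (d : nat -> measure_display)
    (Omega : forall N : nat, measurableType (d N))
    (P : forall N : nat, probability (Omega N) R)
    (T : forall N : nat, p.-tuple 'I_N -> {RV (P N) >-> R})
    (M : nat -> R) :
  (2 <= p)%N -> heavy_wigner T M -> 0 < M 2%N ->
  let M' := fun r : nat =>
    ((p - 2)`!%:R `^ (r%:R / 2)) * M r / (M 2%N `^ (r%:R / 2)) in
  let A := fun (N : nat) (w : Omega N) =>
    contracted_matrix (M 2%N) (fun i : p.-tuple 'I_N => T N i w) in
  (exists nu : probability (measurableTypeR R) R,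
     has_moments nu (eta p M') /\
     (moment_determinate (eta p M') ->
      cvg_weakly_in_probability P (fun N w => esd (A N w)) nu)) /\
  eta p M' 2%N = 1.
Proof.
move=> p_gt1 hw M2_gt0 M' A; split; last first.
  (* The powers of M_2 cancel in M'_2, which equals (p - 2)!, and [eta2] divides by the same
     factorial. *)
  have two_halves : 2%:R / 2 = 1 :> R by rewrite divff.
  have fact_neq0 : (p - 2)`!%:R != 0 :> R by rewrite pnatr_eq0 -lt0n fact_gt0.
  by rewrite eta2 // /M' two_halves !powRr1 ?ler0n ?(ltW M2_gt0) // mulfK ?gt_eqF // divff.
have [nu nuM] := limit_moments p_gt1 hw M2_gt0; exists nu; split=> // det.
exact: (weak_limit p_gt1 hw M2_gt0 nuM det).
Qed.
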